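(* There is a universal constant $C\in(0,+\infty)$ such that, for any countable, locally finite, oriented, symmetric, connected graph $\mathsf G=(\mathsf V,\mathsf E)$ equipped with independent square-integrable positive random resistances $r(e)\sim\mu_e$, $e\in\mathsf E_{1/2}$, and any pair of distinct vertices $(u,v)$, $$\operatorname{Var}(\mathcal R^{u,v})\le\sum_{e\in\mathsf E_{1/2}}\|\Delta_e\mathcal R^{u,v}\|_2^2\le K(\mu)\operatorname{Var}(\mathcal R^{u,v}),$$ where, with $r'$ an independent copy of $r$ and suprema over $e\in\mathsf E_{1/2}$, $$K(\mu)=C\,\sup_{e}\left(\mathbb E[r^8(e)]+\mathbb E[r^{-8}(e)]\right)^6\ \sup_e\frac{\mathbb E\left[(r(e)-r'(e))^2\left(\frac1{r^6(e)}+r^6(e)\right)\right]}{\mathbb E\left[(r(e)-r'(e))_+^2\min\left\{1,\frac1{r^4(e)}\right\}\right]}\in[0,+\infty].$$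
   Context: Graphs: $\mathsf G=(\mathsf V,\mathsf E)$ has no loops; each edge $e=(e_-,e_+)\in\mathsf E\subset\mathsf V^2$ occurs together with $-e=(e_+,e_-)$. $\mathsf E_{1/2}\subset\mathsf E$ contains exactly one of $e,-e$ for every edge. For $r\in(0,\infty)^{\mathsf E_{1/2}}$, $\ell^2_-(\mathsf E,r)$ is the Hilbert space of functions $\theta:\mathsf E\to\mathbb R$ with $\theta(-e)=-\theta(e)$ and $\sum_{e\in\mathsf E_{1/2}}r(e)\theta(e)^2<\infty$. With $d^*\theta(x)=\sum_{e_-=x}\theta(e)$, a unit flow from $u$ to $v$ ($u\ne v$) is $\theta\in\ell^2_-(\mathsf E,r)$ with $d^*\theta=\mathbf 1_u-\mathbf 1_v$, and $$\mathcal R^{u,v}(r)=\inf\Big\{\sum_{e\in\mathsf E_{1/2}}r(e)\theta(e)^2:\ \theta\in \ell^2_-(\mathsf E,r)\text{ a unit flow from }u\text{ to }v\Big\}.$$ Randomness: $r=(r(e))_{e\in\mathsf E_{1/2}}$ has law $\mathbb P=\bigotimes_{e}\mu_e$, each $\mu_e$ a probability measure on $(0,\infty)$ with finite second moment. For $f\in L^2(\mathbb P)$, $\Delta_ef(r)=f(r)-\int f(r)\,d\mu_e(r(e))$ (integration of the coordinate $r(e)$ only); $\|\cdot\|_2$ is the $L^2(\mathbb P)$ norm. Conventions: inequalities are in $[0,\infty]$; $0/0=0$ and $0\cdot\infty=0$. *)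

(* Defs.v *)
From HB Require Import structures.
From mathcomp Require Import all_boot all_order all_algebra.
From mathcomp Require Import finmap.
From mathcomp Require Import all_classical all_reals all_analysis.

Set Implicit Arguments.
Unset Strict Implicit.
Unset Printing Implicit Defensive.

Import Order.TTheory GRing.Theory Num.Theory.
Import numFieldNormedType.Exports.

Local Open Scope classical_set_scope.
Local Open Scope ring_scope.

Record graph := Graph {
  vertex :> countType;
  adj : rel vertex;
  adj_irrefl : irreflexive adj;
  adj_sym : symmetric adj;
  adj_locally_finite : forall x, finite_set [set y | adj x y];
  adj_connected : forall x y, exists p, path adj x p /\ last x p = y
}.

(* E, as a subtype of V * V: e.1 and e.2 are the endpoints e_- and e_+. *)
Definition edge (G : graph) := {e : G * G | adj e.1 e.2}.

Definition tail (G : graph) (e : edge G) : G := (val e).1.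
Definition head (G : graph) (e : edge G) : G := (val e).2.

Lemma adj_rev (G : graph) (e : edge G) : adj (head e) (tail e).
Proof. by rewrite adj_sym; exact: valP e. Qed.

Definition rev_edge (G : graph) (e : edge G) : edge G :=
  exist (fun e : G * G => adj e.1 e.2) (head e, tail e) (adj_rev e).

(* [half] contains exactly one of e and -e, for every edge e. *)
Definition is_orientation (G : graph) (half : pred (edge G)) : Prop :=
  forall e, half (rev_edge e) = ~~ half e.

Definition half_edge (G : graph) (half : pred (edge G)) :=
  {e : edge G | half e}.

Section EffectiveResistance.
Context (R : realType) (G : graph) (half : pred (edge G)).
Implicit Types (r : half_edge half -> R) (theta : edge G -> R) (u v x : G).

Definition energy r theta : \bar R :=
  \esum_(e in [set: half_edge half]) (r e * theta (val e) ^+ 2)%:E.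

Definition ell2_minus r : set (edge G -> R) :=
  [set theta | (forall e, theta (rev_edge e) = - theta e) /\
               (energy r theta < +oo)%E].

(* The index set is finite because the graph is locally finite. *)
Definition dstar theta x : R :=
  \sum_(e \in [set e : edge G | tail e = x]) theta e.

Definition unit_flow r u v : set (edge G -> R) :=
  [set theta | ell2_minus r theta /\
    forall x, dstar theta x = (x == u)%:R - (x == v)%:R].

(* For positive r the infimum is a real number (a path from u to v carries a
   unit flow of finite energy), so that [fine] loses nothing. *)
Definition resistance u v r : R :=
  fine (ereal_inf [set energy r theta | theta in unit_flow r u v]).

End EffectiveResistance.

Section RandomResistances.
Context (R : realType).
Implicit Types (m : probability (measurableTypeR R) R).

(* [m] is a probability measure on the real line carried by (0, +oo); the
   integrals below are restricted to (0, +oo), where alone the integrands are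
   meaningful. *)
Definition carried_by_pos m : Prop := m [set` `]0%R, +oo[] = 1%E.

Definition expect_law m (g : R -> R) : \bar R :=
  (\int[m]_(s in `]0%R, +oo[) (g s)%:E)%E.

(* E[g(r, r')] for r, r' independent with the same law m. *)
Definition expect_law2 m (g : R -> R -> R) : \bar R :=
  (\int[(m \x m)%E]_(z in `]0%R, +oo[ `*` `]0%R, +oo[) (g z.1 z.2)%:E)%E.

Section Family.
Context (I : countType) (mu : I -> probability (measurableTypeR R) R).

(* The law of the family r is the product of the mu i: the finite-dimensional
   cylinders have the product probabilities. *)
Definition has_product_law d (Omega : measurableType d)
    (P : probability Omega R) (r : I -> {RV P >-> measurableTypeR R}) : Prop :=
  forall (A : {fset I}) (B : I -> set (measurableTypeR R)),
    (forall i, measurable (B i)) ->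
    P (\bigcap_(i in [set` A]) (r i @^-1` B i)) =
    (\prod_(i <- A) mu i (B i))%E.

Definition update (r : I -> R) (i : I) (s : R) : I -> R :=
  fun j => if j == i then s else r j.

Definition Delta (i : I) (f : (I -> R) -> R) (r : I -> R) : R :=
  f r - \int[mu i]_(s in `]0, +oo[) f (update r i s).

(* Extended-real division and multiplication satisfy 0 / 0 = 0,
   a / 0 = +oo for a > 0, and 0 * +oo = 0. *)
Definition Kconst (C : R) : \bar R :=
  (C%:E
   * ereal_sup (range (fun i : I =>
       (expect_law (mu i) (fun s => s ^+ 8)%R
        + expect_law (mu i) (fun s => s ^- 8)%R) ^+ 6))
   * ereal_sup (range (fun i : I =>
       expect_law2 (mu i) (fun s s' =>
         (s - s') ^+ 2 * (1 / s ^+ 6 + s ^+ 6))%R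
       / expect_law2 (mu i) (fun s s' =>
         (Num.max 0 (s - s')) ^+ 2 * Num.min 1 (1 / s ^+ 4))%R)))%E.

End Family.
End RandomResistances.

(* Main.v *)
(* The left inequality is the Efron-Stein inequality, applied to the minimal
   energies of an exhausting sequence of finite networks.

   For the right one, let L be the sum of the operators Delta_e, so that
   S := sum_e |Delta_e f|^2 = <f, L f> and |L f|^2 = S + sum_(e <> e') |Delta_e Delta_e' f|^2.
   If the last sum is at most K S, then S = <f - E f, L f> and Cauchy-Schwarz give
   S <= (1 + K) Var f. On a finite network f is the energy of the minimal flow
   theta, the derivative of f in r(e) is theta(e)^2, and that of theta(e) in r(e') is
   - theta(e') G(e, e'), where G r is an orthogonal projection; hence
   Delta_e Delta_e' f is controlled by G(e, e')^2 (theta(e)^4 + theta(e')^4), up to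
   powers of r and 1/r at e and e'. As sum_e' r(e) r(e') G(e, e')^2 <= 1, the sum over
   all pairs is at most a multiple of sum_e theta(e)^4, and this is recovered from the
   first-order terms: f(r) - f(r') >= (r(e) - r'(e)) min(1, r(e)^-2) theta(e)^2 when
   only r(e) decreases to r'(e), with theta(e) taken at r(e) = 1. *)

Require Import Defs.
From HB Require Import structures.
From mathcomp Require Import all_boot all_order all_algebra.
From mathcomp Require Import finmap ring lra.
From mathcomp Require Import all_classical all_reals all_analysis.
From mathcomp Require Import measurable_realfun.

Set Implicit Arguments.
Unset Strict Implicit.
Unset Printing Implicit Defensive.

Import Order.TTheory GRing.Theory Num.Theory.
Import numFieldNormedType.Exports.

Local Open Scope classical_set_scope.
Local Open Scope ring_scope.

(** * Energy minimization on a finite network *)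

(** No derivative is ever taken: changing one resistance is a perturbation of rank one, under which
    the Green matrix, the current and the energy change by exact formulas, bilinear in values before
    and after the change. The obstacle is that a second difference involves several values of [r(e)]
    and [r(e')], whereas the identity that bounds the sum over [e'] holds at the actual resistances.
    Everything is therefore compared with the network where [r(e) = r(e') = 1]: there the kernel is
    independent of both coordinates and expectations factorize. The way back to the actual
    resistances costs a weight [V] at [e] and at [e'], which is removed by bounding the mean of
    [1/V] from below. In powers of the eighth moment this costs two for the kernel, two for one of
    the weights of the second difference and one for the current: five of the six powers in the
    constant. The other weight is paid by the ratio in [K]. On an infinite graph, conservation is
    imposed at finitely many vertices only. The minimal energies then increase to the resistance,
    which dominates them, so they converge in [L^2] and both inequalities survive the limit. *)

Section FiniteNetwork.
Context (F : realFieldType) (m N : nat) (W : 'M[F]_(m, N)) (phi : 'rV[F]_N).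
Implicit Types (r : 'I_N -> F).

Definition resist_mx r : 'M[F]_N := diag_mx (\row_k r k).

Definition gram r : 'M[F]_m := W *m resist_mx r *m W^T.

(* The matrix of the orthogonal projection onto the row space of [W], for the
   inner product weighted by [r], is [green r *m resist_mx r]. *)
Definition green r : 'M[F]_N := W^T *m invmx (gram r) *m W.

(** The component of [phi] orthogonal to the row space of [W] for the inner product weighted by [r],
    hence the element of least energy in [phi] plus that space. *)
Definition current r : 'rV[F]_N := phi - phi *m resist_mx r *m green r.

Definition min_energy r : F := \sum_k r k * current r 0 k ^+ 2.

Lemma mul_resist_mx n (A : 'M[F]_(n, N)) r i k :
  (A *m resist_mx r) i k = A i k * r k.
Proof. by rewrite mul_mx_diag !mxE. Qed.

Lemma mul_resist_form r (x y : 'rV[F]_N) :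
  (x *m resist_mx r *m y^T) 0 0 = \sum_k r k * x 0 k * y 0 k.
Proof.
rewrite mxE; apply: eq_bigr => k _.
by rewrite mul_resist_mx mxE (mulrC (x 0 k)).
Qed.

Lemma resist_mx_tr r : (resist_mx r)^T = resist_mx r.
Proof. exact: tr_diag_mx. Qed.

Hypothesis Wfree : row_free W.
Local Notation pos r := (forall k, 0 < r k).

(** If [c *m gram r = 0], the energy of [c *m W] vanishes, so [c *m W = 0] because [r] is positive,
    and [c = 0] because the rows of [W] are free. *)
Lemma gram_unit r : pos r -> gram r \in unitmx.
Proof.
move=> r0; rewrite -row_free_unit -kermx_eq0; apply/eqP/row_matrixP => i.
rewrite row0; set c := row i _.
have cG : c *m gram r = 0 by rewrite /c -row_mul mulmx_ker row0.
have cW : c *m W = 0.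
  have : (c *m W *m resist_mx r *m (c *m W)^T) 0 0 = 0.
    have -> : c *m W *m resist_mx r *m (c *m W)^T = c *m gram r *m c^T.
      by rewrite trmx_mul /gram !mulmxA.
    by rewrite cG mul0mx mxE.
  rewrite mul_resist_form => /eqP; rewrite psumr_eq0; last first.
    by move=> k _; rewrite -mulrA -expr2 mulr_ge0 ?sqr_ge0 ?ltW.
  move=> /allP H; apply/rowP => k; rewrite [RHS]mxE.
  have := H k (mem_index_enum _).
  by rewrite /= -mulrA mulf_eq0 (gt_eqF (r0 k)) /= mulf_eq0 orbb => /eqP.
by move: cW => /eqP; rewrite -(mul0mx _ W) => /eqP /(row_free_inj Wfree).
Qed.

Lemma green_tr r : (green r)^T = green r.
Proof.
rewrite /green !trmx_mul trmxK trmx_inv mulmxA; congr (_ *m invmx _ *m _).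
by rewrite /gram !trmx_mul trmxK resist_mx_tr mulmxA.
Qed.

Lemma green_sym r k l : green r k l = green r l k.
Proof. by rewrite -[in LHS]green_tr mxE. Qed.

Lemma mul_green r : pos r -> W *m resist_mx r *m green r = W.
Proof. by move=> r0; rewrite /green !mulmxA mulmxV ?mul1mx ?gram_unit. Qed.

Lemma mul_green_tr r : pos r -> green r *m resist_mx r *m W^T = W^T.
Proof.
move=> r0; rewrite -{1}green_tr -[in LHS](resist_mx_tr r) -trmx_mul -trmx_mul.
by rewrite mulmxA mul_green.
Qed.

(** The columns of [green r'] lie in the column space of [W^T], on which [green r *m resist_mx r] is
    the identity whatever [r'] is. This freedom gives the resolvent identity of [green_update]. *)
Lemma green_mul r r' : pos r -> green r *m resist_mx r *m green r' = green r'.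
Proof. by move=> r0; rewrite [green r']/green !mulmxA mul_green_tr. Qed.

Lemma mul_green' r r' : pos r' -> green r *m resist_mx r' *m green r' = green r.
Proof.
move=> r0; have WG := mul_green r0.
by rewrite [green r]/green -!mulmxA [W *m (_ *m _)]mulmxA WG.
Qed.

Lemma current_orth r : pos r -> current r *m resist_mx r *m W^T = 0.
Proof.
move=> r0; rewrite /current; move: (mul_green_tr r0); move: (green r) => G GW.
by rewrite !mulmxBl -!mulmxA (mulmxA G) GW subrr.
Qed.

Lemma current_orth_green r r' :
  pos r -> current r *m resist_mx r *m green r' = 0.
Proof. by move=> r0; rewrite /green !mulmxA current_orth // !mul0mx. Qed.

(** Both currents differ from [phi] by an element of the row space of [W], on which the projection
    is the identity. *)
Lemma current_sub r r' : pos r -> pos r' ->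
  (current r' - current r) *m resist_mx r *m green r = current r' - current r.
Proof.
move=> r0 r'0; have [c ->] : exists c, current r' - current r = c *m W.
  exists (phi *m resist_mx r *m W^T *m invmx (gram r)
          - phi *m resist_mx r' *m W^T *m invmx (gram r')).
  by rewrite /current /green mulmxBl !mulmxA opprB addrC addrA subrK.
by rewrite -!mulmxA (mulmxA W) mul_green.
Qed.

(** Pythagoras: [x - current r] is in the row space of [W], to which [current r] is orthogonal. *)
Lemma min_energyE r (x : 'rV[F]_N) : pos r -> (exists c, x - current r = c *m W) ->
  \sum_k r k * x 0 k ^+ 2 =
  min_energy r + \sum_k r k * (x 0 k - current r 0 k) ^+ 2.
Proof.
move=> r0 [c xc].
have : (current r *m resist_mx r *m (x - current r)^T) 0 0 = 0.
  by rewrite xc trmx_mul mulmxA current_orth // mul0mx mxE.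
rewrite mul_resist_form => o.
pose S := \sum_k r k * current r 0 k * (x - current r) 0 k.
rewrite -[RHS]addr0 -[X in _ + X](_ : 2 * S = 0); last by rewrite [S]o mulr0.
rewrite /S mulr_sumr /min_energy.
by rewrite -!big_split /=; apply: eq_bigr => k _; rewrite !mxE; ring.
Qed.

Lemma current_flow r : exists c, current r - phi = c *m W.
Proof.
exists (- (phi *m resist_mx r *m W^T *m invmx (gram r))).
by rewrite /current /green addrAC subrr sub0r mulNmx !mulmxA.
Qed.

Lemma sum_green_sqr r i : pos r -> \sum_k r k * green r i k ^+ 2 = green r i i.
Proof.
move=> r0; rewrite -[in RHS](green_mul r r0) mxE; apply: eq_bigr => k _.
by rewrite mul_resist_mx [green r k i]green_sym expr2; ring.
Qed.

Section Update.
Variables (j : 'I_N) (r r' : 'I_N -> F).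
Hypotheses (r0 : pos r) (r'0 : pos r') (rr' : forall k, k != j -> r' k = r k).
Local Notation x := (r' j - r j).

(** Resolvent identity: [green r - green r'] is [green r *m (resist_mx r' - resist_mx r) *m green
    r'], and the middle factor has a single nonzero entry, at [j]. *)
Lemma green_update k l :
  green r k l - green r' k l = x * green r k j * green r' j l.
Proof.
have -> : green r k l = \sum_i green r k i * r' i * green r' i l.
  rewrite -[in LHS](mul_green' r r'0) mxE.
  by apply: eq_bigr => i _; rewrite mul_resist_mx.
have -> : green r' k l = \sum_i green r k i * r i * green r' i l.
  rewrite -[in LHS](green_mul r' r0) mxE.
  by apply: eq_bigr => i _; rewrite mul_resist_mx.
rewrite -sumrB (bigD1 j) //= big1 => [|i ij]; first by rewrite addr0; ring.
by rewrite rr' // subrr.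
Qed.

(** Each current is orthogonal to the row space for its own weights. What is projected is the
    mismatch of the two inner products on [current r'], carried by the entry [j]. *)
Lemma current_update k :
  current r' 0 k - current r 0 k = - x * current r' 0 j * green r j k.
Proof.
have D0 : (current r' *m (resist_mx r' *m green r)) 0 k = 0.
  by rewrite mulmxA current_orth_green // mxE.
have -> : current r' 0 k - current r 0 k = (current r' *m resist_mx r *m green r) 0 k.
  have := congr1 (fun A : 'rV_N => A 0 k) (current_sub r0 r'0).
  move: (current_orth_green r r0); move: (current r) (current r') (green r) => c c' g cg.
  by rewrite mulmxBl mulmxBl cg subr0 [in RHS]mxE [in X in _ + X]mxE.
rewrite -[LHS]subr0 -[X in _ - X]D0 mulmxA mxE [in X in _ - X]mxE.
rewrite -sumrB (bigD1 j) //= big1 => [|i ij].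
  by rewrite !mul_resist_mx addr0; ring.
by rewrite !mul_resist_mx rr' // subrr.
Qed.

Lemma current_orth_sub s s' : pos s -> pos s' ->
  \sum_k s k * current s 0 k * current s' 0 k = min_energy s.
Proof.
move=> s0 s'0; have : (current s *m resist_mx s *m (current s' - current s)^T) 0 0 = 0.
  rewrite -current_sub // trmx_mul green_tr mulmxA current_orth_green //.
  by rewrite mul0mx mxE.
rewrite mul_resist_form => H; apply/eqP; rewrite -subr_eq0 -sumrB.
apply/eqP; rewrite -[RHS]H; apply: eq_bigr => k _; rewrite !mxE; ring.
Qed.

(** By [current_orth_sub] both energies are pairings of the same two currents, weighted by [r'] and
    by [r]; only the term at [j] differs. *)
Lemma min_energy_update :
  min_energy r' - min_energy r = x * current r 0 j * current r' 0 j.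
Proof.
rewrite -(current_orth_sub r'0 r0) -(current_orth_sub r0 r'0) -sumrB.
move: (current r) (current r') => c c'.
rewrite (bigD1 j) //= big1 => [|i ij]; first by rewrite addr0; ring.
by rewrite rr' //; ring.
Qed.

End Update.
End FiniteNetwork.

(** * Responses of a finite network and their dependence on two resistances *)

Lemma update_same (R : realType) (I : countType) (x : I -> R) i s :
  update x i s i = s.
Proof. by rewrite /update eqxx. Qed.

Lemma update_other (R : realType) (I : countType) (x : I -> R) i j s :
  j != i -> update x i s j = x j.
Proof. by rewrite /update => /negbTE ->. Qed.

Lemma update_id (R : realType) (I : countType) (x : I -> R) i :
  update x i (x i) = x.
Proof. by apply/funext => j; rewrite /update; case: eqVneq => [->|]. Qed.

Lemma update_update (R : realType) (I : countType) (x : I -> R) i s t :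
  update (update x i s) i t = update x i t.
Proof. by apply/funext => j; rewrite /update; case: eqVneq. Qed.

Lemma updateC (R : realType) (I : countType) (x : I -> R) i j s t : i != j ->
  update (update x i s) j t = update (update x j t) i s.
Proof.
move=> ij; apply/funext => k; rewrite /update.
by case: (eqVneq k j) => [->|//]; rewrite eq_sym (negbTE ij).
Qed.

(* The three functions are, for resistances [r], the Green matrix of the cycle
   space, the current of the minimal flow and its energy; [es] lists the edges
   of a finite network, and everything vanishes on the other edges. *)
Record response (R : realType) (I : countType) := Response {
  edges : seq I;
  grn : (I -> R) -> I -> I -> R;
  cur : (I -> R) -> I -> R;
  nrg : (I -> R) -> R;
  edges_uniq : uniq edges;
  grn_out : forall r i j, j \notin edges -> grn r i j = 0;
  cur_out : forall r j, j \notin edges -> cur r j = 0;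
  grn_sym : forall r i j, grn r i j = grn r j i;
  grn_sum : forall r i, (forall k, 0 < r k) ->
    \sum_(k <- edges) r k * grn r i k ^+ 2 = grn r i i;
  grn_update : forall r r' j, (forall k, 0 < r k) -> (forall k, 0 < r' k) ->
    (forall k, k != j -> r' k = r k) -> forall k l,
    grn r k l - grn r' k l = (r' j - r j) * grn r k j * grn r' j l;
  cur_update : forall r r' j, (forall k, 0 < r k) -> (forall k, 0 < r' k) ->
    (forall k, k != j -> r' k = r k) -> forall k,
    cur r' k - cur r k = - (r' j - r j) * cur r' j * grn r j k;
  nrg_update : forall r r' j, (forall k, 0 < r k) -> (forall k, 0 < r' k) ->
    (forall k, k != j -> r' k = r k) ->
    nrg r' - nrg r = (r' j - r j) * cur r j * cur r' j
}.

Section ResponseBounds.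
Context (R : realType) (I : countType) (rho : response R I).
Implicit Types (r : I -> R) (i j k l : I) (s t : R).
Local Notation G := (grn rho).
Local Notation th := (cur rho).
Local Notation Res := (nrg rho).
Local Notation pos r := (forall k, 0 < r k).

Lemma pos_update r i s : pos r -> 0 < s -> pos (update r i s).
Proof. by move=> r0 s0 k; rewrite /update; case: ifP. Qed.

Lemma grn_sqr_le r i j : pos r -> r j * G r i j ^+ 2 <= G r i i.
Proof.
move=> r0; rewrite -(grn_sum _ i r0); have [jin|jout] := boolP (j \in edges rho).
  rewrite (bigD1_seq j) ?edges_uniq //= lerDl; apply: sumr_ge0 => k _.
  by rewrite mulr_ge0 ?sqr_ge0 // ltW.
rewrite (grn_out _ _ jout) expr2 mulr0 mulr0; apply: sumr_ge0 => k _.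
by rewrite mulr_ge0 ?sqr_ge0 // ltW.
Qed.

Lemma grn_diag_ge0 r i : pos r -> 0 <= G r i i.
Proof.
by move=> r0; rewrite -(grn_sum _ i r0) sumr_ge0 // => k _; rewrite mulr_ge0 ?sqr_ge0 // ltW.
Qed.

(** The case [j = i] of [grn_sqr_le], divided by [G r i i]: a diagonal entry of a projection is at
    most [1]. *)
Lemma grn_diag_le r i : pos r -> r i * G r i i <= 1.
Proof.
move=> r0; have := grn_sqr_le i i r0; have := grn_diag_ge0 i r0.
rewrite le_eqVlt => /predU1P[<-|G0]; first by rewrite mulr0 ler01.
by rewrite expr2 mulrA -[leRHS]mul1r ler_pM2r.
Qed.

Lemma grn_sqr_le1 r i j : pos r -> r i * r j * G r i j ^+ 2 <= 1.
Proof.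
move=> r0; apply: le_trans (grn_diag_le i r0).
by rewrite -mulrA ler_pM2l // grn_sqr_le.
Qed.

(* A resistance changes from [s] to [s'], and [a], [b] are the values before and
   after the change of a current or of a Green function. *)
Lemma ratio_bound (a b g s s' h : R) : 0 < s -> 0 < s' -> 0 <= g ->
  s * g <= 1 -> b * (1 + (s' - s) * g) = a -> 1 <= h -> s <= h * s' ->
  `|b| <= h * `|a|.
Proof.
move=> s0 s'0 g0 sg ba h1 hs.
have h0 : 0 < h by apply: lt_le_trans h1.
(* The right side minus [1] equals [(h - 1) * (1 - s * g) + (h * s' - s) * g], a sum of two
   nonnegative terms. *)
have key : 1 <= h * (1 + (s' - s) * g).
  have : 0 <= (h * s' - s) * g by rewrite mulr_ge0 // subr_ge0.
  have : 0 <= (h - 1) * (1 - s * g) by rewrite mulr_ge0 // subr_ge0.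
  nra.
have p0 : 0 <= 1 + (s' - s) * g by rewrite -(pmulr_rge0 _ h0) (le_trans _ key).
rewrite -ba normrM (ger0_norm p0) mulrCA -[leLHS]mulr1.
by rewrite ler_wpM2l.
Qed.

Section OneCoordinate.
Variables (r r' : I -> R) (j : I) (h : R).
Hypotheses (r0 : pos r) (r'0 : pos r') (rr' : forall k, k != j -> r' k = r k).
Hypotheses (h1 : 1 <= h) (hr : r j <= h * r' j).

(** At [k = j] the update formula is a scalar equation: the current at the changed edge is divided
    by [1 + (r' j - r j) * G r j j]. *)
Lemma cur_ratio : `|th r' j| <= h * `|th r j|.
Proof.
apply: (ratio_bound (g := G r j j) (r0 j) (r'0 j)) => //.
- exact: grn_diag_ge0.
- exact: grn_diag_le.
- by have := cur_update rho r0 r'0 rr' j => H; lra.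
Qed.

Lemma grn_ratio l : `|G r' j l| <= h * `|G r j l|.
Proof.
apply: (ratio_bound (g := G r j j) (r0 j) (r'0 j)) => //.
- exact: grn_diag_ge0.
- exact: grn_diag_le.
- by have := grn_update rho r0 r'0 rr' j l => H; lra.
Qed.

End OneCoordinate.

(** [vv] is the common weight in which all losses are expressed; [hh s] is the factor lost, by
    [cur_ratio] and [grn_ratio], when a resistance moves from [1] to [s]. *)
Definition vv s := s + s^-1.
Definition hh s := 1 + s^-1.

Lemma vv_ge2 s : 0 < s -> 2 <= vv s.
Proof.
move=> s0; rewrite /vv -subr_ge0.
have -> : s + s^-1 - 2 = (s - 1) ^+ 2 / s by field; rewrite gt_eqF.
by rewrite divr_ge0 ?sqr_ge0 // ltW.
Qed.

Section TwoCoordinates.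
Variables (x : I -> R) (i j : I).
Hypotheses (x0 : pos x) (ij : i != j).
Local Notation E s t := (update (update x i s) j t).

Lemma E_pos s t : 0 < s -> 0 < t -> pos (E s t).
Proof. by move=> s0 t0; do 2![apply: pos_update => //]. Qed.

Lemma E_i s t : E s t i = s.
Proof. by rewrite update_other // update_same. Qed.

Lemma E_j s t : E s t j = t.
Proof. by rewrite update_same. Qed.

Lemma E_offi s s' t k : k != i -> E s' t k = E s t k.
Proof.
by move=> ki; rewrite /update; case: eqP => // _; rewrite (negbTE ki).
Qed.

Lemma E_offj s t t' k : k != j -> E s t' k = E s t k.
Proof. by move=> kj; rewrite /update (negbTE kj). Qed.


Lemma hh_ge1 s : 0 < s -> 1 <= hh s.
Proof. by move=> s0; rewrite lerDl invr_ge0 ltW. Qed.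

Lemma hh_mul s : 0 < s -> 1 <= hh s * s.
Proof.
by move=> s0; rewrite /hh mulrDl mulVf ?gt_eqF // mul1r lerDr ltW.
Qed.

Lemma hh_le_vv s : 0 < s -> hh s <= 2 * vv s.
Proof.
move=> s0; have v2 := vv_ge2 s0; have i0 : 0 < s^-1 by rewrite invr_gt0.
by move: v2; rewrite /hh /vv; lra.
Qed.

(** Because [(t - 1) * (1 + t^-1) = t - t^-1]. *)
Lemma dist1_hh t : 0 < t -> `|t - 1| * hh t <= vv t.
Proof.
move=> t0; have i0 : 0 < t^-1 by rewrite invr_gt0.
have tV : t * t^-1 = 1 by rewrite divff ?gt_eqF.
rewrite -[X in _ * X]gtr0_norm /hh /vv; last by lra.
by rewrite -normrM ler_norml; apply/andP; split; nra.
Qed.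

(** From [(1, 1)] to [(1, t)] by the update formula, where the Green entry is taken at unit
    resistances and so is at most [1]; then from [(1, t)] to [(s, t)] by the ratio bound. *)
Lemma cur_E_le s t : 0 < s -> 0 < t ->
  `|th (E s t) i| <= hh s * (`|th (E 1 1) i| + vv t * `|th (E 1 1) j|).
Proof.
move=> s0 t0; have p1 := E_pos ltr01 ltr01; have p1t := E_pos ltr01 t0.
apply: (@le_trans _ _ (hh s * `|th (E 1 t) i|)).
  apply: (cur_ratio p1t (E_pos s0 t0)); first exact: E_offi.
    exact: hh_ge1.
  by rewrite !E_i hh_mul.
rewrite ler_pM2l ?(lt_le_trans _ (hh_ge1 s0)) //.
have := cur_update rho p1 p1t (E_offj 1 1 t) i; rewrite !E_j => /eqP.
rewrite subr_eq addrC => /eqP ->; apply: (le_trans (ler_normD _ _)).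
rewrite lerD2l !normrM normrN.
have G1 : `|G (E 1 1) j i| <= 1.
  rewrite -(@expr_le1 _ 2) // real_normK ?num_real //.
  by have := grn_sqr_le1 j i p1; rewrite E_i E_j !mul1r.
have thj : `|th (E 1 t) j| <= hh t * `|th (E 1 1) j|.
  apply: (cur_ratio p1 p1t); first exact: E_offj.
    exact: hh_ge1.
  by rewrite !E_j hh_mul.
apply: (@le_trans _ _ (`|t - 1| * (hh t * `|th (E 1 1) j|))).
  rewrite -[leRHS]mulr1; apply: ler_pM => //; by rewrite ?mulr_ge0 ?ler_wpM2l.
by rewrite mulrA ler_wpM2r // dist1_hh.
Qed.

Lemma grn_E_le s t : 0 < s -> 0 < t ->
  `|G (E s t) i j| <= hh s * (hh t * `|G (E 1 1) i j|).
Proof.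
move=> s0 t0; have p1 := E_pos ltr01 ltr01; have p1t := E_pos ltr01 t0.
apply: (@le_trans _ _ (hh s * `|G (E 1 t) i j|)).
  apply: (grn_ratio p1t (E_pos s0 t0)); first exact: E_offi.
    exact: hh_ge1.
  by rewrite !E_i hh_mul.
rewrite ler_pM2l ?(lt_le_trans _ (hh_ge1 s0)) // !(grn_sym _ _ i j).
apply: (grn_ratio p1 p1t); first exact: E_offj.
  exact: hh_ge1.
by rewrite !E_j hh_mul.
Qed.

(** The way back to unit resistances. The Green entry is now taken at [(s, t)], where the available
    bound is [(s * t)^(-1/2)]; it is kept, to be combined with [grn_sqr_le1] later. *)
Lemma cur_1_le s t : 0 < s -> 0 < t ->
  `|th (E 1 1) i| <= (1 + s) *
    (`|th (E s t) i| + `|t - 1| * (1 + t) * `|th (E s t) j| * `|G (E s t) i j|).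
Proof.
move=> s0 t0; have p1 := E_pos ltr01 ltr01; have ps1 := E_pos s0 ltr01.
have pst := E_pos s0 t0.
apply: (@le_trans _ _ ((1 + s) * `|th (E s 1) i|)).
  apply: (cur_ratio ps1 p1); first exact: E_offi.
    by rewrite lerDl ltW.
  by rewrite !E_i mulr1 lerDr ler01.
rewrite ler_pM2l ?addr_gt0 //.
have := cur_update rho pst ps1 (E_offj s t 1) i; rewrite !E_j => /eqP.
rewrite subr_eq addrC => /eqP ->; apply: (le_trans (ler_normD _ _)).
rewrite lerD2l !normrM normrN distrC (grn_sym _ _ j i) ler_wpM2r // -mulrA.
rewrite ler_wpM2l //; apply: (cur_ratio pst ps1); first exact: E_offj.
  by rewrite lerDl ltW.
by rewrite !E_j mulr1 lerDr ler01.
Qed.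

Lemma grn_1_le s t : 0 < s -> 0 < t ->
  `|G (E 1 1) i j| <= (1 + s) * ((1 + t) * `|G (E s t) i j|).
Proof.
move=> s0 t0; have p1 := E_pos ltr01 ltr01; have ps1 := E_pos s0 ltr01.
have pst := E_pos s0 t0.
apply: (@le_trans _ _ ((1 + s) * `|G (E s 1) i j|)).
  apply: (grn_ratio ps1 p1); first exact: E_offi.
    by rewrite lerDl ltW.
  by rewrite !E_i mulr1 lerDr ler01.
rewrite ler_pM2l ?addr_gt0 // !(grn_sym _ _ i j).
apply: (grn_ratio pst ps1); first exact: E_offj.
  by rewrite lerDl ltW.
by rewrite !E_j mulr1 lerDr ler01.
Qed.

End TwoCoordinates.

Local Notation E x i j s t := (update (update x i s) j t).

(* Independent of the coordinates [i] and [j] of [x], which are set to [1]. *)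
Definition interaction x i j : R :=
  G (E x i j 1 1) i j ^+ 2 *
  (th (E x i j 1 1) i ^+ 4 + th (E x i j 1 1) j ^+ 4).

(** Counterpart of [interaction] at the actual resistances: the weight [r i * r j * G r i j ^+ 2] is
    the one whose sum over [j] is at most [1]. *)
Definition coupling r i j : R :=
  r i * r j * G r i j ^+ 2 * (th r i ^+ 4 + th r j ^+ 4).

Lemma vv_gt0 s : 0 < s -> 0 < vv s.
Proof. by move=> s0; apply: lt_le_trans (vv_ge2 s0). Qed.

(** It separates the two variables in the mixed powers of [vv] met in [mixed_difference_le], at the
    price of the exponent [6]. *)
Lemma cube_mix (X Y : R) : 0 <= X -> 0 <= Y -> X ^+ 2 * Y <= X ^+ 3 + Y ^+ 3.
Proof.
move=> X0 Y0; have [YX|XY] := leP Y X.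
  have : 0 <= X ^+ 2 * (X - Y) by rewrite mulr_ge0 ?sqr_ge0 ?subr_ge0.
  have : 0 <= Y ^+ 3 by rewrite exprn_ge0.
  by rewrite !exprS !expr0; nra.
have : X ^+ 2 * Y <= Y ^+ 2 * Y by rewrite ler_wpM2r // lerXn2r // ltW.
have : 0 <= X ^+ 3 by rewrite exprn_ge0.
by rewrite !exprS !expr0; nra.
Qed.

Section TwoCoordinatesBounds.
Variables (x : I -> R) (i j : I).
Hypotheses (x0 : pos x) (ij : i != j).
Local Notation c := (`|th (E x i j 1 1) i| + `|th (E x i j 1 1) j|).
Local Notation q := `|G (E x i j 1 1) i j|.

Lemma cur_E_le2 s t : 0 < s -> 0 < t ->
  `|th (E x i j s t) i| <= 2 * vv s * vv t * c.
Proof.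
move=> s0 t0; apply: (le_trans (cur_E_le x0 ij s0 t0)).
rewrite -!mulrA [2 * _]mulrA; apply: ler_pM => //.
- by rewrite (le_trans ler01) // hh_ge1.
- by rewrite addr_ge0 // mulr_ge0 // ltW // vv_gt0.
- exact: hh_le_vv.
- rewrite mulrDr lerD2r ler_peMl //; apply: le_trans (vv_ge2 t0).
  by rewrite ler1n.
Qed.

Lemma grn_E_le2 s t : 0 < s -> 0 < t ->
  `|G (E x i j s t) i j| <= 4 * vv s * vv t * q.
Proof.
move=> s0 t0; apply: (le_trans (grn_E_le x0 ij s0 t0)).
have := hh_le_vv s0; have := hh_le_vv t0; have := hh_ge1 s0; have := hh_ge1 t0.
have := normr_ge0 (G (E x i j 1 1) i j).
move: (hh s) (hh t) (vv s) (vv t) q => hs ht vs vt g g0 h1 h2 h3 h4.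
rewrite mulrA ler_wpM2r //.
have -> : 4 * vs * vt = (2 * vs) * (2 * vt) by ring.
by apply: ler_pM => //; apply: le_trans ler01 _.
Qed.

End TwoCoordinatesBounds.

Section MixedDifference.
Variables (x : I -> R) (i j : I).
Hypotheses (x0 : pos x) (ij : i != j).
Local Notation c := (`|th (E x i j 1 1) i| + `|th (E x i j 1 1) j|).
Local Notation q := `|G (E x i j 1 1) i j|.

Lemma cur_E_le2' s t : 0 < s -> 0 < t ->
  `|th (E x i j s t) j| <= 2 * vv s * vv t * c.
Proof.
move=> s0 t0; have ji : j != i by rewrite eq_sym.
have := cur_E_le2 x0 ji t0 s0.
by rewrite -!(@updateC _ _ _ i j) // addrC -!mulrA [vv t * _]mulrCA.
Qed.

(** The update formula in [j] leaves a current times a Green entry; [8] is the product of their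
    constants [2] and [4]. *)
Lemma cur_diff_le s t t' : 0 < s -> 0 < t -> 0 < t' ->
  `|th (E x i j s t) i - th (E x i j s t') i| <=
  `|t - t'| * (8 * vv s ^+ 2 * vv t * vv t' * c * q).
Proof.
move=> s0 t0 t'0.
rewrite (cur_update rho (E_pos i j x0 s0 t'0) (E_pos i j x0 s0 t0) (@E_offj x i j s t' t)).
rewrite !E_j !normrM normrN -mulrA ler_wpM2l // (grn_sym _ _ j i).
have -> : 8 * vv s ^+ 2 * vv t * vv t' * c * q =
  (2 * vv s * vv t * c) * (4 * vv s * vv t' * q) by ring.
by apply: ler_pM => //; [exact: cur_E_le2'|exact: grn_E_le2].
Qed.

(** By [nrg_update] the difference in [s] is [s - s'] times a product of two currents at [i], and
    the difference in [t] falls on one factor at a time. The constant is [16 ^+ 2 * 8 * 4]: [16]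
    from a current difference times a current, [8] from the fourth power of a sum of two currents,
    [4] from the square of a sum of two mixed powers of [vv]. *)
Lemma mixed_difference_le s s' t t' : 0 < s -> 0 < s' -> 0 < t -> 0 < t' ->
  (Res (E x i j s t) - Res (E x i j s' t) - Res (E x i j s t')
     + Res (E x i j s' t')) ^+ 2 <=
  8192 * ((s - s') ^+ 2 * (vv s ^+ 6 + vv s' ^+ 6)) *
  ((t - t') ^+ 2 * (vv t ^+ 6 + vv t' ^+ 6)) * interaction x i j.
Proof.
move=> s0 s'0 t0 t'0.
have U tt : 0 < tt -> Res (E x i j s tt) - Res (E x i j s' tt) =
    (s - s') * th (E x i j s' tt) i * th (E x i j s tt) i.
  move=> tt0.
  rewrite (nrg_update rho (E_pos i j x0 s'0 tt0) (E_pos i j x0 s0 tt0) (@E_offi x i j s' s tt)).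
  by rewrite !E_i.
have -> : Res (E x i j s t) - Res (E x i j s' t) - Res (E x i j s t')
     + Res (E x i j s' t') = (s - s') *
   ((th (E x i j s t) i - th (E x i j s t') i) * th (E x i j s' t) i +
   th (E x i j s t') i * (th (E x i j s' t) i - th (E x i j s' t') i)).
  transitivity ((Res (E x i j s t) - Res (E x i j s' t)) -
    (Res (E x i j s t') - Res (E x i j s' t'))); first by ring.
  by rewrite !U //; ring.
have B1 := cur_diff_le s0 t0 t'0; have B2 := cur_diff_le s'0 t0 t'0.
have B3 := cur_E_le2 x0 ij s'0 t0; have B4 := cur_E_le2 x0 ij s0 t'0.
have c0 : 0 <= c by rewrite addr_ge0.
set z := (X in (s - s') * X).
set w1 := vv s ^+ 6 + vv s' ^+ 6; set w2 := vv t ^+ 6 + vv t' ^+ 6.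
suff main : z ^+ 2 <= (t - t') ^+ 2 * (8192 * (w1 * w2) * interaction x i j).
  rewrite exprMn; apply: (le_trans (ler_wpM2l (sqr_ge0 _) main)).
  by rewrite le_eqVlt; apply/orP; left; apply/eqP; ring.
have z1 : `|z| <= `|t - t'| * (16 * c ^+ 2 * q) *
   ((vv s ^+ 2 * vv s') * (vv t ^+ 2 * vv t') +
    (vv s' ^+ 2 * vv s) * (vv t' ^+ 2 * vv t)).
  apply: (le_trans (ler_normD _ _)); rewrite !normrM.
  apply: (le_trans (lerD (ler_pM _ _ B1 B3) (ler_pM _ _ B4 B2))) => //.
  by rewrite le_eqVlt; apply/orP; left; apply/eqP; ring.
have z2 : z ^+ 2 <= (`|t - t'| * (16 * c ^+ 2 * q) *
   ((vv s ^+ 2 * vv s') * (vv t ^+ 2 * vv t') +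
    (vv s' ^+ 2 * vv s) * (vv t' ^+ 2 * vv t))) ^+ 2.
  by rewrite -[z ^+ 2]real_normK ?num_real // lerXn2r // nnegrE (le_trans _ z1).
apply: (le_trans z2); rewrite exprMn exprMn real_normK ?num_real //.
rewrite -mulrA ler_wpM2l ?sqr_ge0 // /interaction.
have w10 : 0 <= w1 by rewrite addr_ge0 // exprn_ge0 // ltW // vv_gt0.
have w20 : 0 <= w2 by rewrite addr_ge0 // exprn_ge0 // ltW // vv_gt0.
have W a b : 0 < a -> 0 < b -> (vv a ^+ 2 * vv b) ^+ 2 <= vv a ^+ 6 + vv b ^+ 6.
  move=> a0 b0; have := cube_mix (sqr_ge0 (vv a)) (sqr_ge0 (vv b)).
  by rewrite -!exprM exprMn -exprM.
have P2 : (vv s ^+ 2 * vv s' * (vv t ^+ 2 * vv t') +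
    (vv s' ^+ 2 * vv s) * (vv t' ^+ 2 * vv t)) ^+ 2 <= 4 * (w1 * w2).
  have Q1 : (vv s ^+ 2 * vv s' * (vv t ^+ 2 * vv t')) ^+ 2 <= w1 * w2.
    by rewrite exprMn; apply: ler_pM; rewrite ?sqr_ge0 // W.
  have Q2 : (vv s' ^+ 2 * vv s * (vv t' ^+ 2 * vv t)) ^+ 2 <= w1 * w2.
    rewrite exprMn; apply: ler_pM; rewrite ?sqr_ge0 //.
      by rewrite /w1 addrC W.
    by rewrite /w2 addrC W.
  move: Q1 Q2; move: (_ * (vv t ^+ 2 * vv t')) (_ * (vv t' ^+ 2 * vv t)) => X Y.
  by have := sqr_ge0 (X - Y); rewrite !expr2; nra.
have C4 : c ^+ 4 <= 8 * (th (E x i j 1 1) i ^+ 4 + th (E x i j 1 1) j ^+ 4).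
  have e4 (y : R) : y ^+ 4 = (`|y| ^+ 2) ^+ 2.
    by rewrite real_normK ?num_real // -exprM.
  rewrite (e4 (th _ i)) (e4 (th _ j)) (_ : c ^+ 4 = (c ^+ 2) ^+ 2); last by rewrite -exprM.
  move: (`|th _ i|) (`|th _ j|) => a b.
  have h1 : (a + b) ^+ 2 <= 2 * (a ^+ 2 + b ^+ 2).
    by have := sqr_ge0 (a - b); rewrite !expr2; nra.
  have h2 : ((a + b) ^+ 2) ^+ 2 <= (2 * (a ^+ 2 + b ^+ 2)) ^+ 2.
    by rewrite lerXn2r // nnegrE ?sqr_ge0 // mulr_ge0 // addr_ge0 ?sqr_ge0.
  by apply: (le_trans h2); have := sqr_ge0 (a ^+ 2 - b ^+ 2); rewrite !expr2; nra.
apply: (@le_trans _ _ (256 * (8 * (th (E x i j 1 1) i ^+ 4 + th (E x i j 1 1) j ^+ 4)) *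
   G (E x i j 1 1) i j ^+ 2 * (4 * (w1 * w2)))).
  apply: ler_pM => //; rewrite ?sqr_ge0 //.
  rewrite exprMn real_normK ?num_real // ler_wpM2r ?sqr_ge0 //.
  by rewrite exprMn -exprM -natrX ler_wpM2l.
by rewrite le_eqVlt; apply/orP; left; apply/eqP; ring.
Qed.

End MixedDifference.

(** At the actual resistances [x i * x j * G x i j ^+ 2 <= 1] absorbs the Green entry left in
    [cur_1_le], so that only powers of [vv] remain. The exponent obtained is [7]; it is raised to
    [8] to match the weight of [cur_pow4_le]. *)
Lemma interaction_le x i j : pos x -> i != j ->
  interaction x i j <= 256 * vv (x i) ^+ 8 * vv (x j) ^+ 8 * coupling x i j.
Proof.
move=> x0 ij; have ji : j != i by rewrite eq_sym.
have Ex : E x i j (x i) (x j) = x by rewrite !update_id.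
have Ex' : E x j i (x j) (x i) = x by rewrite !update_id.
have A := cur_1_le x0 ij (x0 i) (x0 j); rewrite Ex in A.
have B := cur_1_le x0 ji (x0 j) (x0 i); rewrite Ex' in B.
have Q := grn_1_le x0 ij (x0 i) (x0 j); rewrite Ex in Q.
have E11 : E x j i 1 1 = E x i j 1 1 by rewrite updateC.
rewrite {}E11 (grn_sym _ _ j i) in B.
have H := grn_sqr_le1 i j x0.
rewrite /interaction /coupling.
have S2 := x0 i; have T2 := x0 j.
have sq (a b : R) : `|a| <= b -> a ^+ 2 <= b ^+ 2.
  move=> ab; rewrite -[a ^+ 2]real_normK ?num_real // lerXn2r // nnegrE.
  by rewrite (le_trans _ ab).
(* [a], [b] and [g] stand for the two currents and the Green entry at [(s, t)], and [a1] for a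
   current at [(1, 1)]; the second use exchanges [i] and [j]. *)
have cur_sq s t (a b g a1 : R) : 0 < s -> 0 < t -> s * t * g ^+ 2 <= 1 ->
    `|a1| <= (1 + s) * (`|a| + `|t - 1| * (1 + t) * `|b| * `|g|) ->
    a1 ^+ 2 <= 4 * vv s ^+ 3 * vv t ^+ 3 * (a ^+ 2 + b ^+ 2).
  move=> s0 t0 stg /sq; rewrite exprMn => K; apply: (le_trans K).
  have vs2 := vv_ge2 s0; have vt2 := vv_ge2 t0.
  have sV : s * s^-1 = 1 by rewrite divff ?gt_eqF.
  have tV : t * t^-1 = 1 by rewrite divff ?gt_eqF.
  have si : 0 < s^-1 by rewrite invr_gt0.
  have ti : 0 < t^-1 by rewrite invr_gt0.
  have K1 : (`|a| + `|t - 1| * (1 + t) * `|b| * `|g|) ^+ 2 <=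
      2 * (a ^+ 2 + ((t - 1) * (1 + t)) ^+ 2 * b ^+ 2 * g ^+ 2).
    have -> : ((t - 1) * (1 + t)) ^+ 2 * b ^+ 2 * g ^+ 2 =
        (`|t - 1| * (1 + t) * `|b| * `|g|) ^+ 2.
      by rewrite !exprMn !real_normK ?num_real.
    rewrite -[a ^+ 2]real_normK ?num_real //.
    move: (`|a|) (_ * `|g|) => y z; have := sqr_ge0 (y - z).
    by rewrite !expr2; nra.
  have K2 : g ^+ 2 <= s^-1 * t^-1.
    by rewrite -invfM -[leRHS]mul1r ler_pdivlMr ?mulr_gt0 // mulrC.
  have K3 : ((t - 1) * (1 + t)) ^+ 2 * t^-1 <= vv t ^+ 3.
    have -> : ((t - 1) * (1 + t)) ^+ 2 * t^-1 = t * (t - t^-1) ^+ 2.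
      by field; rewrite gt_eqF.
    rewrite exprS; apply: ler_pM; rewrite ?sqr_ge0 ?(ltW t0) //.
      by rewrite lerDl ltW.
    rewrite -subr_ge0.
    have -> : vv t ^+ 2 - (t - t^-1) ^+ 2 = 4 * (t * t^-1) by rewrite /vv; ring.
    by rewrite tV mulr1.
  have K4 : (1 + s) ^+ 2 * s^-1 <= 2 * vv s.
    have -> : (1 + s) ^+ 2 * s^-1 = vv s + 2 by rewrite /vv; field; rewrite gt_eqF.
    by lra.
  have K5 : (1 + s) ^+ 2 <= 2 * vv s ^+ 3.
    have : (1 + s) ^+ 2 <= 2 * vv s ^+ 2.
      have : 0 <= (1 - s) ^+ 2 by rewrite sqr_ge0.
      have : 0 <= s^-1 ^+ 2 by rewrite sqr_ge0.
      by rewrite /vv !expr2; nra.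
    by have : 0 <= vv s ^+ 2 by [rewrite sqr_ge0]; rewrite (exprS _ 2); nra.
  have t3 : 1 <= vv t ^+ 3 by rewrite exprn_ege1 // (le_trans _ vt2) // ler1n.
  have s3 : vv s <= vv s ^+ 3.
    by rewrite ler_eXnr // (le_trans _ vs2) // ler1n.
  have a2 := sqr_ge0 a; have b2 := sqr_ge0 b.
  apply: (le_trans (ler_wpM2l (sqr_ge0 _) K1)).
  have L1 : (1 + s) ^+ 2 * a ^+ 2 <= 2 * vv s ^+ 3 * vv t ^+ 3 * a ^+ 2.
    rewrite ler_wpM2r // (le_trans K5) // -[leLHS]mulr1 ler_wpM2l //.
    by rewrite mulr_ge0 // exprn_ge0 // (le_trans _ vs2).
  have L2 : (1 + s) ^+ 2 * (((t - 1) * (1 + t)) ^+ 2 * b ^+ 2 * g ^+ 2) <=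
      2 * vv s ^+ 3 * vv t ^+ 3 * b ^+ 2.
    apply: (@le_trans _ _ ((1 + s) ^+ 2 * (((t - 1) * (1 + t)) ^+ 2 * b ^+ 2 * (s^-1 * t^-1)))).
      by rewrite ler_wpM2l ?sqr_ge0 // ler_wpM2l // mulr_ge0 ?sqr_ge0.
    have -> : (1 + s) ^+ 2 * (((t - 1) * (1 + t)) ^+ 2 * b ^+ 2 * (s^-1 * t^-1)) =
      ((1 + s) ^+ 2 * s^-1) * (((t - 1) * (1 + t)) ^+ 2 * t^-1) * b ^+ 2 by ring.
    rewrite ler_wpM2r //; apply: ler_pM => //.
    - by rewrite mulr_ge0 ?sqr_ge0 // ltW.
    - by rewrite mulr_ge0 ?sqr_ge0 // ltW.
    - by apply: (le_trans K4); rewrite ler_wpM2l.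
  by lra.
have A2 := cur_sq _ _ _ _ _ _ (x0 i) (x0 j) H A.
have H' : x j * x i * G x i j ^+ 2 <= 1 by rewrite [x j * _]mulrC.
have B2 := cur_sq _ _ _ _ _ _ (x0 j) (x0 i) H' B.
have Q2 : G (E x i j 1 1) i j ^+ 2 <= 4 * vv (x i) * vv (x j) * (x i * x j * G x i j ^+ 2).
  have := sq _ _ Q; rewrite !exprMn real_normK ?num_real // => K; apply: (le_trans K).
  have k s : 0 < s -> (1 + s) ^+ 2 <= 2 * vv s * s.
    move=> s0; have := sqr_ge0 (1 - s); have -> : 2 * vv s * s = 2 * s ^+ 2 + 2.
      by rewrite /vv; field; rewrite gt_eqF.
    by rewrite !expr2; lra.
  have -> : 4 * vv (x i) * vv (x j) * (x i * x j * G x i j ^+ 2) =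
    (2 * vv (x i) * x i) * ((2 * vv (x j) * x j) * G x i j ^+ 2) by ring.
  apply: ler_pM (sqr_ge0 _) (mulr_ge0 (sqr_ge0 _) (sqr_ge0 _)) (k _ _) _ => //.
  by rewrite ler_wpM2r ?sqr_ge0 // k.
have vi := vv_gt0 (x0 i); have vj := vv_gt0 (x0 j).
have vi2 := vv_ge2 (x0 i); have vj2 := vv_ge2 (x0 j).
have four (y : R) : y ^+ 4 = (y ^+ 2) ^+ 2 by rewrite -exprM.
set u := th x i ^+ 2 + th x j ^+ 2 in A2.
have BB : th (E x i j 1 1) j ^+ 2 <= 4 * vv (x i) ^+ 3 * vv (x j) ^+ 3 * u.
  by apply: (le_trans B2); rewrite /u le_eqVlt; apply/orP; left; apply/eqP; ring.
have u2 : u ^+ 2 <= 2 * (th x i ^+ 4 + th x j ^+ 4).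
  rewrite /u !four; have := sqr_ge0 (th x i ^+ 2 - th x j ^+ 2).
  by move: (th x i ^+ 2) (th x j ^+ 2) => y z; rewrite !expr2; nra.
have S : th (E x i j 1 1) i ^+ 4 + th (E x i j 1 1) j ^+ 4 <=
   64 * vv (x i) ^+ 6 * vv (x j) ^+ 6 * (th x i ^+ 4 + th x j ^+ 4).
  have P y : 0 <= y -> y <= 4 * vv (x i) ^+ 3 * vv (x j) ^+ 3 * u ->
      y ^+ 2 <= 16 * vv (x i) ^+ 6 * vv (x j) ^+ 6 * u ^+ 2.
    move=> y0 yu; apply: (@le_trans _ _ ((4 * vv (x i) ^+ 3 * vv (x j) ^+ 3 * u) ^+ 2)).
      by rewrite lerXn2r // nnegrE (le_trans y0).
    by rewrite le_eqVlt; apply/orP; left; apply/eqP; ring.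
  have Pi := P _ (sqr_ge0 _) A2; have Pj := P _ (sqr_ge0 _) BB.
  have := ler_wpM2l (_ : 0 <= 16 * vv (x i) ^+ 6 * vv (x j) ^+ 6) u2.
  rewrite !four in Pi Pj *.
  move=> /(_ _) K; have {}K := K (mulr_ge0 (mulr_ge0 (ler0n _ _) (exprn_ge0 _ (ltW vi))) (exprn_ge0 _ (ltW vj))).
  by move: Pi Pj K; lra.
apply: (le_trans (ler_pM _ _ Q2 S)); rewrite ?sqr_ge0 //.
  by rewrite !four addr_ge0 ?sqr_ge0.
have Y0 : 0 <= x i * x j * G x i j ^+ 2 * (th x i ^+ 4 + th x j ^+ 4).
  by rewrite !four mulr_ge0 ?addr_ge0 ?sqr_ge0 // mulr_ge0 ?sqr_ge0 ?mulr_ge0 // ltW.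
have -> : 4 * vv (x i) * vv (x j) * (x i * x j * G x i j ^+ 2) *
    (64 * vv (x i) ^+ 6 * vv (x j) ^+ 6 * (th x i ^+ 4 + th x j ^+ 4)) =
  256 * vv (x i) ^+ 7 * vv (x j) ^+ 7 *
   (x i * x j * G x i j ^+ 2 * (th x i ^+ 4 + th x j ^+ 4)) by ring.
have E78 (y : R) : 2 <= y -> y ^+ 7 <= y ^+ 8.
  move=> y2; have y0 : 0 <= y by apply: le_trans y2.
  by rewrite [leRHS]exprS ler_peMl ?exprn_ge0 // (le_trans _ y2) // ler1n.
rewrite ler_wpM2r //.
apply: ler_pM; [|exact: exprn_ge0 (ltW vj)| |exact: E78].
  exact: mulr_ge0 (ler0n _ _) (exprn_ge0 _ (ltW vi)).
by apply: ler_wpM2l; [exact: ler0n|exact: E78].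
Qed.

End ResponseBounds.

(** * Sums of couplings and a lower bound for first differences *)

Section CouplingBounds.
Context (R : realType) (I : countType) (rho : response R I).
Implicit Types (r x : I -> R) (i j k l : I) (s t : R).
Local Notation G := (grn rho).
Local Notation th := (cur rho).
Local Notation Res := (nrg rho).
Local Notation pos r := (forall k, 0 < r k).

(** Each fourth power is summed over the index on which it does not depend, where the weights add up
    to at most [1]. Bounding [k i j] by both [d i] and [d j] lets the factor follow the index that
    remains. *)
Lemma sum_coupling_le r (d : I -> R) (k : I -> I -> R) : pos r ->
  (forall i j, 0 <= k i j /\ k i j <= d i /\ k i j <= d j) ->
  \sum_(i <- edges rho) \sum_(j <- edges rho) k i j * coupling rho r i j <=
  2 * \sum_(i <- edges rho) d i * th r i ^+ 4.
Proof.
move=> r0 kd.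
have four (y : R) : 0 <= y ^+ 4 by rewrite (_ : 4 = 2 * 2)%N // exprM sqr_ge0.
pose A i j := r i * r j * G r i j ^+ 2.
have A0 i j : 0 <= A i j by rewrite mulr_ge0 ?sqr_ge0 // mulr_ge0 // ltW.
have As i : \sum_(j <- edges rho) A i j <= 1.
  rewrite /A; under eq_bigr do rewrite -mulrA.
  by rewrite -mulr_sumr (grn_sum _ i r0) grn_diag_le.
have AC i j : A i j = A j i by rewrite /A (grn_sym _ _ i j) [r i * _]mulrC.
have D i : \sum_(j <- edges rho) A i j * (d i * th r i ^+ 4) <= d i * th r i ^+ 4.
  rewrite -mulr_suml ler_piMl // mulr_ge0 //.
  by have [k0 [k1 _]] := kd i i; apply: le_trans k1.
rewrite mulr_natl mulr2n; apply: (@le_trans _ _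
  (\sum_(i <- edges rho) \sum_(j <- edges rho) A i j * (d i * th r i ^+ 4) +
   \sum_(i <- edges rho) \sum_(j <- edges rho) A i j * (d j * th r j ^+ 4))).
  rewrite -big_split /=; apply: ler_sum => i _; rewrite -big_split /=.
  apply: ler_sum => j _; rewrite -mulrDr /coupling -/(A i j) mulrCA ler_wpM2l //.
  by have [k0 [k1 k2]] := kd i j; rewrite mulrDr lerD // ler_wpM2r.
apply: lerD; first by apply: ler_sum => i _; exact: D.
rewrite exchange_big /=; apply: ler_sum => i _.
by apply: le_trans (D i); apply: ler_sum => j _; rewrite AC.
Qed.

(** The ratio bound loses [hh <= 2 * vv <= vv ^+ 2], whose fourth power is [vv ^+ 8]. *)
Lemma cur_pow4_le x i : pos x ->
  th x i ^+ 4 <= vv (x i) ^+ 8 * th (update x i 1) i ^+ 4.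
Proof.
move=> x0; have p1 : pos (update x i 1) by exact: pos_update.
have four (y : R) : y ^+ 4 = `|y| ^+ 4.
  by rewrite -normrX ger0_norm // (_ : 4 = 2 * 2)%N // exprM sqr_ge0.
have := @cur_ratio _ _ rho _ _ i (hh (x i)) p1 x0 _ (hh_ge1 (x0 i)) _.
rewrite update_same hh_mul // => K.
have {}K : `|th x i| <= hh (x i) * `|th (update x i 1) i|.
  by apply: K => // k ki; rewrite update_other.
rewrite (four (th x i)) (four (th _ i)).
apply: (@le_trans _ _ ((hh (x i) * `|th (update x i 1) i|) ^+ 4)).
  by rewrite lerXn2r // nnegrE (le_trans _ K).
rewrite exprMn ler_wpM2r ?exprn_ge0 //.
have v2 := vv_ge2 (x0 i); have hv := hh_le_vv (x0 i); have h1 := hh_ge1 (x0 i).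
apply: (@le_trans _ _ ((vv (x i) ^+ 2) ^+ 4)); last by rewrite -exprM.
rewrite lerXn2r // ?nnegrE ?sqr_ge0 ?(le_trans ler01) //.
by apply: (le_trans hv); rewrite expr2 ler_wpM2r // (le_trans _ v2).
Qed.

(** When its resistance decreases from [s] to [s'], the current at [i] keeps its sign and grows in
    absolute value, so the product of the two currents is at least the square of the one at [s]; the
    ratio bound compares the latter with the current at [1]. *)
Lemma nrg_diff_ge_half x i s s' : pos x -> 0 < s' -> s' <= s ->
  (s - s') ^+ 2 * Num.min 1 (1 / s ^+ 4) * th (update x i 1) i ^+ 4 <=
  (Res (update x i s) - Res (update x i s')) ^+ 2.
Proof.
move=> x0 s'0 s's; have s0 : 0 < s by apply: lt_le_trans s's.
have p1 : pos (update x i 1) by exact: pos_update.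
have ps : pos (update x i s) by exact: pos_update.
have ps' : pos (update x i s') by exact: pos_update.
have off a b k : k != i -> update x i a k = update x i b k.
  by move=> ki; rewrite !update_other.
rewrite (nrg_update rho ps' ps (off s s')) !update_same.
suff main : Num.min 1 (1 / s ^+ 4) * th (update x i 1) i ^+ 4 <=
    (th (update x i s') i * th (update x i s) i) ^+ 2.
  rewrite -[X in _ <= X ^+ 2]mulrA.
  rewrite exprMn; apply: le_trans (ler_wpM2l (sqr_ge0 _) main).
  by rewrite [leRHS]mulrA.
have h1 : 1 <= Num.max 1 s by rewrite le_max lexx.
have := @cur_ratio _ _ rho _ _ i (Num.max 1 s) ps p1 (off 1 s) h1.
rewrite !update_same mulr1 le_max lexx orbT => /(_ isT) K.
have four (y : R) : y ^+ 4 = `|y| ^+ 4.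
  by rewrite -normrX ger0_norm // (_ : 4 = 2 * 2)%N // exprM sqr_ge0.
have T4 : Num.min 1 (1 / s ^+ 4) * th (update x i 1) i ^+ 4 <= th (update x i s) i ^+ 4.
  have m0 : 0 < Num.max 1 s by apply: lt_le_trans h1.
  apply: (@le_trans _ _ ((Num.max 1 s) ^- 4 * th (update x i 1) i ^+ 4)).
    rewrite ler_wpM2r //; first by rewrite four exprn_ge0.
    rewrite ge_min; have [s1|s1] := leP 1 s; first by rewrite div1r lexx orbT.
    by rewrite expr1n invr1 lexx.
  rewrite mulrC ler_pdivrMr ?exprn_gt0 // [leRHS]mulrC.
  rewrite (four (th _ i)) (four (th (update x i s) i)) -exprMn.
  by rewrite lerXn2r // nnegrE mulr_ge0 // ltW.
apply: (le_trans T4); set b := th (update x i s') i; set a := th (update x i s) i.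
have := cur_update rho ps ps' (off s' s) i; rewrite !update_same -/a -/b => U.
have g1 := grn_diag_le rho i ps; have g0 := grn_diag_ge0 rho i ps.
rewrite update_same in g1; set g := G _ i i in U g1 g0.
pose u := 1 + (s' - s) * g; have ua : a = b * u by rewrite /u; lra.
have u0 : 0 <= u.
  have : 0 <= s' * g by rewrite mulr_ge0 // ltW.
  by rewrite /u; lra.
have u1 : u <= 1 by rewrite /u; have : 0 <= (s - s') * g by [rewrite mulr_ge0 // subr_ge0]; lra.
have -> : a ^+ 4 = (a ^+ 2) ^+ 2 by rewrite -exprM.
rewrite lerXn2r // ?nnegrE ?sqr_ge0 // ua.
  by rewrite (_ : b * (b * u) = b ^+ 2 * u); [rewrite mulr_ge0 ?sqr_ge0|ring].
rewrite (_ : b * (b * u) = b ^+ 2 * u); last by ring.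
by rewrite exprMn ler_wpM2l ?sqr_ge0 // expr2 ler_piMl.
Qed.

Lemma nrg_diff_ge x i s s' : pos x -> 0 < s -> 0 < s' ->
  (Num.max 0 (s - s') ^+ 2 * Num.min 1 (1 / s ^+ 4) +
   Num.max 0 (s' - s) ^+ 2 * Num.min 1 (1 / s' ^+ 4)) *
   th (update x i 1) i ^+ 4 <=
  (Res (update x i s) - Res (update x i s')) ^+ 2.
Proof.
move=> x0 s0 s'0; have [s's|/ltW ss'] := leP s' s.
  rewrite [Num.max 0 (s - s')]max_r ?subr_ge0 //.
  rewrite [Num.max 0 (s' - s)]max_l ?subr_le0 //.
  by rewrite expr0n /= mul0r addr0 nrg_diff_ge_half.
rewrite [Num.max 0 (s - s')]max_l ?subr_le0 //.
rewrite [Num.max 0 (s' - s)]max_r ?subr_ge0 //.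
rewrite expr0n /= mul0r add0r -[leRHS]sqrrN opprB.
exact: nrg_diff_ge_half.
Qed.

End CouplingBounds.

(** * Exhaustion by finite networks *)

Section NetworkResponse.
Context (R : realType) (I : countType) (es : seq I) (es_uniq : uniq es).
Context (m : nat) (W : 'M[R]_(m, size es)) (Wfree : row_free W).
Context (phi : 'rV[R]_(size es)).
Implicit Types (r : I -> R) (i j : I).

Let ix i : option 'I_(size es) := insub (index i es).
Let el (k : 'I_(size es)) : I := tnth (in_tuple es) k.
Let res r (k : 'I_(size es)) : R := r (el k).

Lemma ix_el k : ix (el k) = Some k.
Proof.
rewrite /ix /el (tnth_nth (tnth (in_tuple es) k)) /= index_uniq //.
by rewrite insubT // => lt; congr Some; apply: val_inj.
Qed.

Lemma ix_out i : i \notin es -> ix i = None.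
Proof. by move=> iout; rewrite /ix insubN // index_mem. Qed.

Lemma elP i : i \in es -> exists k, i = el k.
Proof. by move=> /(@seq_tnthP _ es i)[k ->]; exists k. Qed.

Definition net_grn r i j : R :=
  oapp (fun k => oapp (fun l => green W (res r) k l) 0 (ix j)) 0 (ix i).
Definition net_cur r i : R :=
  oapp (fun k => current W phi (res r) 0 k) 0 (ix i).
Definition net_nrg r : R := min_energy W phi (res r).

Lemma net_grn_el r k l : net_grn r (el k) (el l) = green W (res r) k l.
Proof. by rewrite /net_grn !ix_el. Qed.

Lemma net_cur_el r k : net_cur r (el k) = current W phi (res r) 0 k.
Proof. by rewrite /net_cur ix_el. Qed.

Lemma net_grn_outr r i j : j \notin es -> net_grn r i j = 0.
Proof. by move=> jout; rewrite /net_grn (ix_out jout); case: (ix i). Qed.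

Lemma net_grn_outl r i j : i \notin es -> net_grn r i j = 0.
Proof. by move=> iout; rewrite /net_grn (ix_out iout). Qed.

Lemma net_cur_out r i : i \notin es -> net_cur r i = 0.
Proof. by move=> iout; rewrite /net_cur (ix_out iout). Qed.

Lemma net_grn_sym r i j : net_grn r i j = net_grn r j i.
Proof.
by rewrite /net_grn; case: (ix i) => [k|]; case: (ix j) => [l|] //=; rewrite green_sym.
Qed.

Lemma sum_es (f : I -> R) : \sum_(i <- es) f i = \sum_k f (el k).
Proof. by rewrite big_tnth. Qed.

Lemma net_grn_sum r i : (forall k, 0 < r k) ->
  \sum_(k <- es) r k * net_grn r i k ^+ 2 = net_grn r i i.
Proof.
move=> r0; have [/elP[k ->]|iout] := boolP (i \in es).
  rewrite sum_es net_grn_el -(sum_green_sqr Wfree) => [|l]; last exact: r0.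
  by apply: eq_bigr => l _; rewrite net_grn_el.
rewrite net_grn_outl // big1 // => l _.
by rewrite net_grn_outl // expr2 mulr0 mulr0.
Qed.

Section Update.
Variables (r r' : I -> R) (j : I).
Hypotheses (r0 : forall k, 0 < r k) (r'0 : forall k, 0 < r' k).
Hypothesis rr' : forall k, k != j -> r' k = r k.

Lemma res_out : j \notin es -> res r = res r'.
Proof.
move=> jout; apply/funext => k; rewrite /res rr' //.
by apply: contraNneq jout => <-; rewrite mem_tnth.
Qed.

Lemma net_grn_update k l :
  net_grn r k l - net_grn r' k l = (r' j - r j) * net_grn r k j * net_grn r' j l.
Proof.
have [/elP[jj jE]|jout] := boolP (j \in es); last first.
  by rewrite /net_grn res_out // subrr (ix_out jout) /= mulr0.
have [/elP[kk ->]|kout] := boolP (k \in es); last first.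
  by rewrite !(net_grn_outl _ _ kout) subrr mulr0 mul0r.
have [/elP[ll ->]|lout] := boolP (l \in es); last first.
  by rewrite !(net_grn_outr _ _ lout) subrr mulr0.
rewrite jE !net_grn_el; apply: (green_update Wfree); first by move=> ?; exact: r0.
- by move=> ?; exact: r'0.
- move=> i ij; apply: rr'; rewrite jE; apply: contra_neq ij => e.
  by have := ix_el i; rewrite e ix_el => -[].
Qed.

Lemma net_cur_update k :
  net_cur r' k - net_cur r k = - (r' j - r j) * net_cur r' j * net_grn r j k.
Proof.
have [/elP[jj jE]|jout] := boolP (j \in es); last first.
  by rewrite /net_cur /net_grn res_out // subrr (ix_out jout) /= mulr0.
have [/elP[kk ->]|kout] := boolP (k \in es); last first.
  by rewrite !(net_cur_out _ kout) !(net_grn_outr _ _ kout) subrr mulr0.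
rewrite jE !net_cur_el !net_grn_el; apply: (current_update _ Wfree).
- by move=> ?; exact: r0.
- by move=> ?; exact: r'0.
- move=> i ij; apply: rr'; rewrite jE; apply: contra_neq ij => e.
  by have := ix_el i; rewrite e ix_el => -[].
Qed.

Lemma net_nrg_update :
  net_nrg r' - net_nrg r = (r' j - r j) * net_cur r j * net_cur r' j.
Proof.
have [/elP[jj jE]|jout] := boolP (j \in es); last first.
  by rewrite /net_nrg res_out // subrr (net_cur_out _ jout) mulr0 mul0r.
rewrite jE !net_cur_el; apply: (min_energy_update _ Wfree).
- by move=> ?; exact: r0.
- by move=> ?; exact: r'0.
- move=> i ij; apply: rr'; rewrite jE; apply: contra_neq ij => e.
  by have := ix_el i; rewrite e ix_el => -[].
Qed.

End Update.

Definition network_response : response R I :=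
  Response es_uniq net_grn_outr net_cur_out net_grn_sym net_grn_sum
    net_grn_update net_cur_update net_nrg_update.

Lemma net_nrgE r (f : I -> R) : (forall k, 0 < r k) ->
  (exists c, \row_k f (el k) - phi = c *m W) ->
  \sum_(i <- es) r i * f i ^+ 2 =
  net_nrg r + \sum_(i <- es) r i * (f i - net_cur r i) ^+ 2.
Proof.
move=> r0 [c cE]; rewrite !sum_es.
have pr : forall k, 0 < res r k by move=> k; exact: r0.
have [c' c'E] := current_flow W phi (res r).
have [c'' H] : exists c, \row_k f (el k) - current W phi (res r) = c *m W.
  exists (c - c'); rewrite mulmxBl -cE -c'E; move: (current _ _ _) => u.
  by rewrite opprB addrA subrK.
have := min_energyE Wfree pr (ex_intro _ c'' H).
under eq_bigr do rewrite mxE; move=> ->; congr (_ + _).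
by apply: eq_bigr => k _; rewrite mxE net_cur_el.
Qed.

End NetworkResponse.

(** * Nested finite networks with constraints at finitely many vertices *)

Section LocalConstraints.
Context (R : realType) (I V : countType).
Context (inc : V -> seq I) (c : V -> I -> R).
Hypothesis inc_uniq : forall x, uniq (inc x).
Hypothesis c_out : forall x i, i \notin inc x -> c x i = 0.
Implicit Types (r f : I -> R) (n : nat).

(** Abstract form of [dstar] with one orientation per edge: [c x i] is the sign with which the edge
    [i] meets the vertex [x]. *)
Definition divg f x : R := \sum_(i <- inc x) c x i * f i.

Definition first (T : countType) n : seq T := pmap (@pickle_inv T) (iota 0 n).

Lemma mem_first (T : countType) n (x : T) : (x \in first T n) = (choice.pickle x < n)%N.
Proof.
rewrite mem_pmap; apply/mapP/idP => [[k]|xn].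
  rewrite mem_iota add0n => /andP[_ kn] /esym /= H.
  by have := @pickle_invK T k; rewrite H /= => ->.
by exists (choice.pickle x); rewrite ?mem_iota ?pickleK_inv.
Qed.

(** The edges at the first [n] vertices make the constraints at these vertices expressible inside
    the network; the first [n] edges make the networks exhaust [I]. *)
Definition net_edges n : seq I :=
  undup (first I n ++ flatten [seq inc x | x <- first V n]).

Lemma net_edges_uniq n : uniq (net_edges n).
Proof. exact: undup_uniq. Qed.

Lemma inc_net_edges n x : (choice.pickle x < n)%N -> {subset inc x <= net_edges n}.
Proof.
move=> xn i ix; rewrite mem_undup mem_cat; apply/orP; right.
by apply/flattenP; exists (inc x) => //; rewrite map_f // mem_first.
Qed.

Lemma pickle_net_edges n i : (choice.pickle i < n)%N -> i \in net_edges n.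
Proof. by move=> h; rewrite mem_undup mem_cat mem_first h. Qed.

Lemma divg_edges n f x : (choice.pickle x < n)%N ->
  divg f x = \sum_(i <- net_edges n) c x i * f i.
Proof.
move=> xn; rewrite [RHS](bigID (mem (inc x))) /= [X in _ + X]big1 ?addr0.
  rewrite -big_filter; apply: perm_big; apply: uniq_perm => //.
    by rewrite filter_uniq // net_edges_uniq.
  by move=> i; rewrite mem_filter /=; case: (boolP (i \in inc x)) => // /(inc_net_edges xn) ->.
by move=> i /c_out ->; rewrite mul0r.
Qed.

Variable phi : I -> R.

Definition net_el n (k : 'I_(size (net_edges n))) : I :=
  tnth (in_tuple (net_edges n)) k.

Definition constraint_mx n : 'M[R]_(size (net_edges n), size (first V n)) :=
  \matrix_(k, l) c (tnth (in_tuple (first V n)) l) (net_el k).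

(** A basis of the functions without divergence at the first [n] vertices; [row_base] provides the
    freeness of rows that makes the Gram matrix invertible. *)
Definition cycle_mx n := row_base (kermx (constraint_mx n)).

Lemma cycle_mxP n (z : 'rV_(size (net_edges n))) :
  z *m constraint_mx n = 0 -> exists d, z = d *m cycle_mx n.
Proof.
move=> zK; apply/submxP; rewrite eq_row_base; exact/sub_kermxP.
Qed.

Lemma cycle_mx_ker n : cycle_mx n *m constraint_mx n = 0.
Proof. by apply/sub_kermxP; rewrite eq_row_base. Qed.

(* Only the constraints at the first [n] vertices are imposed, so that the flow of
   [net n] may leave the network at the other ones. *)
Definition net n : response R I :=
  network_response (net_edges_uniq n) (row_base_free (kermx (constraint_mx n)))
    (\row_k phi (net_el k)).

Definition flow_upto n f := forall x, (choice.pickle x < n)%N -> divg f x = divg phi x.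

Lemma row_constraint n (f : I -> R) (l : 'I_(size (first V n))) :
  ((\row_k f (net_el k)) *m constraint_mx n) 0 l =
  divg f (tnth (in_tuple (first V n)) l).
Proof.
rewrite (@divg_edges n); last by rewrite -mem_first mem_tnth.
by rewrite mxE [RHS]big_tnth; apply: eq_bigr => k _; rewrite !mxE mulrC.
Qed.

Lemma flow_energyE n r f : (forall k, 0 < r k) -> flow_upto n f ->
  \sum_(i <- net_edges n) r i * f i ^+ 2 =
  nrg (net n) r + \sum_(i <- net_edges n) r i * (f i - cur (net n) r i) ^+ 2.
Proof.
move=> r0 fn.
apply: (net_nrgE (net_edges_uniq n) (row_base_free (kermx (constraint_mx n))) r0).
apply: cycle_mxP; rewrite mulmxBl; apply/rowP => l.
rewrite !mxE.
have := row_constraint f l; have := row_constraint phi l.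
rewrite !mxE => -> ->; rewrite fn ?subrr //.
by rewrite -mem_first mem_tnth.
Qed.

Lemma cur_flow n r : (forall k, 0 < r k) -> flow_upto n (cur (net n) r).
Proof.
move=> r0 x xn.
have /(@seq_tnthP _ (first V n) x)[l ->] : x \in first V n by rewrite mem_first.
rewrite -!row_constraint.
have -> : \row_k cur (net n) r (net_el k) =
    current (cycle_mx n) (\row_k phi (net_el k)) (fun k => r (net_el k)).
  apply/rowP => k; rewrite [LHS]mxE /=.
  exact: (net_cur_el (net_edges_uniq n)).
have [d /eqP] := current_flow (cycle_mx n) (\row_k phi (net_el k)) (fun k => r (net_el k)).
rewrite subr_eq => /eqP ->.
by rewrite mulmxDl -mulmxA cycle_mx_ker mulmx0 add0r.
Qed.

Lemma flow_uptoW n n' f : (n <= n')%N -> flow_upto n' f -> flow_upto n f.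
Proof. by move=> nn' H x xn; apply: H; apply: leq_trans nn'. Qed.

Lemma net_edgesW n n' : (n <= n')%N -> {subset net_edges n <= net_edges n'}.
Proof.
move=> nn' i; rewrite !mem_undup !mem_cat !mem_first => /orP[h|].
  by rewrite (leq_trans h).
move=> /flattenP[s /mapP[x]]; rewrite mem_first => xn -> ix.
apply/orP; right; apply/flattenP; exists (inc x) => //.
by rewrite map_f // mem_first (leq_trans xn).
Qed.

Lemma sum_subset (s t : seq I) (f : I -> R) : uniq s -> uniq t ->
  {subset s <= t} -> (forall i, 0 <= f i) ->
  \sum_(i <- s) f i <= \sum_(i <- t) f i.
Proof.
move=> us ut st f0; rewrite [leRHS](bigID (mem s)) /=.
rewrite -[X in _ <= X + _]big_filter.
have -> : \sum_(i <- [seq x <- t | x \in s]) f i = \sum_(i <- s) f i.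
  apply: perm_big; apply: uniq_perm => //; first by rewrite filter_uniq.
  move=> i; rewrite mem_filter.
  by case: (boolP (i \in s)) => // /st ->.
by rewrite lerDl sumr_ge0.
Qed.


Lemma nrgE n r : (forall k, 0 < r k) ->
  \sum_(i <- net_edges n) r i * cur (net n) r i ^+ 2 = nrg (net n) r.
Proof.
move=> r0; rewrite (flow_energyE r0 (cur_flow r0)) [X in _ + X]big1 ?addr0 //.
by move=> i _; rewrite subrr expr0n /= mulr0.
Qed.

Lemma nrg_ge0 n r : (forall k, 0 < r k) -> 0 <= nrg (net n) r.
Proof.
move=> r0; rewrite -nrgE //; apply: sumr_ge0 => i _.
by rewrite mulr_ge0 ?sqr_ge0 // ltW.
Qed.

Lemma nrg_le_flow n r f : (forall k, 0 < r k) -> flow_upto n f ->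
  nrg (net n) r <= \sum_(i <- net_edges n) r i * f i ^+ 2.
Proof.
move=> r0 fn; rewrite (flow_energyE r0 fn) lerDl; apply: sumr_ge0 => i _.
by rewrite mulr_ge0 ?sqr_ge0 // ltW.
Qed.

(** The current of the larger network is admissible in the smaller one, so by Pythagoras its
    distance to the smaller current is paid by the gain in energy. Monotonicity of the energies and
    the Cauchy property of the currents both follow. *)
Lemma nrg_diff_cur n n' r A : (forall k, 0 < r k) -> (n <= n')%N ->
  uniq A -> {subset A <= net_edges n} ->
  \sum_(i <- A) r i * (cur (net n') r i - cur (net n) r i) ^+ 2 <=
  nrg (net n') r - nrg (net n) r.
Proof.
move=> r0 nn' uA sA.
have fn : flow_upto n (cur (net n') r).
  by apply: flow_uptoW nn' _; exact: cur_flow.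
have p (f : I -> R) i : 0 <= r i * f i ^+ 2 by rewrite mulr_ge0 ?sqr_ge0 // ltW.
rewrite lerBrDl; apply: (@le_trans _ _
   (\sum_(i <- net_edges n) r i * cur (net n') r i ^+ 2)).
  rewrite (flow_energyE r0 fn) lerD2l.
  apply: sum_subset => //; first exact: net_edges_uniq.
  by move=> i; exact: (p (fun i => _ - _)).
rewrite -nrgE //; apply: sum_subset; rewrite ?net_edges_uniq //.
  exact: net_edgesW.
Qed.

Lemma nrg_net_le n n' r : (forall k, 0 < r k) -> (n <= n')%N ->
  nrg (net n) r <= nrg (net n') r.
Proof.
move=> r0 nn'; rewrite -subr_ge0.
by have := @nrg_diff_cur n n' r [::] r0 nn' isT (fun x h => False_ind _ (elimF idP (in_nil x) h)); rewrite big_nil.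
Qed.

Lemma cvg_sum_seq (A : seq I) (u : I -> nat -> R) (a : I -> R) :
  (forall i, u i n @[n --> \oo] --> a i) ->
  \sum_(i <- A) u i n @[n --> \oo] --> \sum_(i <- A) a i.
Proof.
move=> ua; elim: A => [|i A IH].
  rewrite big_nil (_ : (fun n => _) = cst 0); first exact: cvg_cst.
  by apply/funext => n; rewrite big_nil.
rewrite big_cons (_ : (fun n => _) = (u i \+ fun n => \sum_(j <- A) u j n)).
  exact: cvgD (ua i) IH.
by apply/funext => n; rewrite big_cons.
Qed.

(* Finite networks are exhausting: the energy of a flow may leak to infinity, but
   the increasing limit of the minimal energies is attained by the coordinatewise
   limit of the minimal flows, by Fatou. *)
Lemma nets_limit r (B : R) : (forall k, 0 < r k) ->
  (forall n, nrg (net n) r <= B) ->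
  exists l f, [/\ nrg (net n) r @[n --> \oo] --> l,
    (forall x, divg f x = divg phi x), 0 <= l &
    forall A, uniq A -> \sum_(i <- A) r i * f i ^+ 2 <= l].
Proof.
move=> r0 rB; pose u n := nrg (net n) r.
have und : nondecreasing_seq u by move=> n n' nn'; exact: nrg_net_le.
have ucvg : cvgn u.
  by apply: nondecreasing_is_cvgn => //; exists B => _ [n _ <-]; exact: rB.
pose l := limn u.
have ul n : u n <= l by exact: nondecreasing_cvgn_le.
have near_l (e : R) : 0 < e -> exists n, l - u n < e.
  move=> e0; have /cvgrPdist_lt /(_ e e0) [n _ /(_ n (leqnn n))] := ucvg.
  by rewrite ger0_norm ?subr_ge0 // => H; exists n.
have cc i : cvgn (fun n => cur (net n) r i).
  apply/cauchy_cvgP/cauchy_exP => e e0.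
  have [n0 n0l] := near_l (r i * e ^+ 2) (mulr_gt0 (r0 i) (exprn_gt0 2 e0)).
  (* The second argument puts the edge [i] into the network. *)
  pose n := maxn n0 (choice.pickle i).+1.
  exists (cur (net n) r i); exists n => // n' /= nn'.
  have := @nrg_diff_cur n n' r [:: i] r0 nn' isT.
  rewrite big_seq1 => H.
  have {}H := H _.
  have iin : {subset [:: i] <= net_edges n}.
    by move=> k; rewrite inE => /eqP ->; apply: pickle_net_edges; rewrite leq_maxr.
  have {}H := H iin.
  rewrite -ball_normE /= distrC -(@ltr_pXn2r _ 2) // ?nnegrE ?ltW //.
  rewrite real_normK ?num_real // -(ltr_pM2l (r0 i)).
  apply: le_lt_trans H (le_lt_trans _ n0l).
  by rewrite lerB // ?ul // und // leq_maxl.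
pose f i := limn (fun n => cur (net n) r i).
have cf i : cur (net n) r i @[n --> \oo] --> f i by exact: cc.
have l0 : 0 <= l by apply: le_trans (ul 0); exact: nrg_ge0.
exists l, f; split => //.
(* The divergence at [x] is a finite sum, hence continuous, and it is constant in [n] as soon as [x]
   is among the constrained vertices. *)
- move=> x; have : divg (cur (net n) r) x @[n --> \oo] --> divg f x.
    rewrite /divg; apply: cvg_sum_seq => i; apply: cvgM; first exact: cvg_cst.
    exact: cf.
  move=> /cvg_lim <- //; apply: lim_near_cst => //.
  exists (choice.pickle x).+1 => // n /= xn; exact: cur_flow.
- move=> A uA.
  have : \sum_(i <- A) r i * cur (net n) r i ^+ 2 @[n --> \oo] -->
      \sum_(i <- A) r i * f i ^+ 2.
    apply: cvg_sum_seq => i; apply: cvgM; first exact: cvg_cst.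
    exact: (cvgM (cf i) (cf i)).
  move=> /cvgr_to_le; apply; near=> n.
  apply: le_trans (ul n); rewrite /u -nrgE //; apply: sum_subset => //.
  + exact: net_edges_uniq.
  + move=> i iA; apply: pickle_net_edges.
    apply: (@leq_ltn_trans (\max_(i <- A) choice.pickle i)).
      by rewrite (big_rem i iA) /= leq_maxl.
    by near: n; exists (\max_(i <- A) choice.pickle i).+1.
  + by move=> i; rewrite mulr_ge0 ?sqr_ge0 // ltW.
Unshelve. all: by end_near. Qed.

End LocalConstraints.

(** * Resampling one coordinate of a product law *)

Section ProductSpace.
Context (R : realType) (I : countType).

Definition cylinder (A : {fset I}) (B : I -> set (measurableTypeR R)) :
  set (I -> R) := [set x | forall i, i \in A -> B i (x i)].

Definition cylinders : set (set (I -> R)) :=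
  [set S | exists A B, (forall i, measurable (B i)) /\ S = cylinder A B].

(** The finite-dimensional cylinders are stable under intersection and generate this sigma-algebra,
    so the product formula on cylinders determines the law. *)
Definition pspace := g_sigma_algebraType cylinders.

Lemma measurable_cylinder (A : {fset I}) (B : I -> set (measurableTypeR R)) :
  (forall i, measurable (B i)) -> measurable (cylinder A B : set pspace).
Proof. by move=> mB; apply: sub_sigma_algebra; exists A, B. Qed.

Lemma measurable_coord (i : I) :
  measurable_fun setT (fun x : pspace => (x i : measurableTypeR R)).
Proof.
move=> _ B mB; rewrite setTI.
have -> : (fun x : pspace => x i) @^-1` B = cylinder [fset i]%fset (fun _ => B).
  apply/seteqP; split => x /=; first by move=> Bx k /[!inE] /eqP ->.
  by apply; rewrite inE.
exact: measurable_cylinder.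
Qed.

Lemma measurable_into d (T : measurableType d) (f : T -> pspace) :
  (forall i, measurable_fun setT (fun t => (f t i : measurableTypeR R))) ->
  measurable_fun setT f.
Proof.
move=> mf; apply: (@measurability _ _ T pspace setT f cylinders (erefl _)) => _ [_ [A [B [mB ->]]] <-]; rewrite setTI.
have -> : f @^-1` cylinder A B =
    \bigcap_(i in [set` A]) ((fun t => f t i) @^-1` B i).
  by apply/seteqP; split => t.
apply: fin_bigcap_measurable => [|i _]; first exact: finite_fset.
by have := mf i measurableT _ (mB i); rewrite setTI.
Qed.

Lemma measurable_update_pair (i : I) :
  measurable_fun setT
    (fun z : pspace * measurableTypeR R => (update z.1 i z.2 : pspace)).
Proof.
apply: measurable_into => j; rewrite /update; case: eqVneq => _.
  exact: measurable_snd.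
exact: measurableT_comp (measurable_coord j) measurable_fst.
Qed.

Lemma measurable_update_l (i : I) (x : I -> R) :
  measurable_fun setT (fun s : measurableTypeR R => (update x i s : pspace)).
Proof.
apply: measurable_into => j; rewrite /update; case: eqVneq => _.
  exact: measurable_id.
exact: measurable_cst.
Qed.

Lemma measurable_update_r (i : I) (s : R) :
  measurable_fun setT (fun x : pspace => (update x i s : pspace)).
Proof.
apply: measurable_into => j; rewrite /update; case: eqVneq => _.
  exact: measurable_cst.
exact: measurable_coord.
Qed.

Lemma measurable_update2 (i j : I) (x : I -> R) :
  measurable_fun setT (fun z : measurableTypeR R * measurableTypeR R =>
    (update (update x i z.1) j z.2 : pspace)).
Proof.
apply: measurable_into => k; rewrite /update; case: eqVneq => _.
  exact: measurable_snd.
case: eqVneq => _; first exact: measurable_fst.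
exact: measurable_cst.
Qed.

Lemma setI_closed_cylinders : setI_closed cylinders.
Proof.
move=> _ _ [A [B [mB ->]]] [A' [B' [mB' ->]]].
exists (A `|` A')%fset.
exists (fun i => (if i \in A then B i else setT) `&` (if i \in A' then B' i else setT)).
split; first by move=> i; apply: measurableI; case: ifP.
apply/seteqP; split => x /=.
  by move=> [xA xA'] i _; split; case: ifP => // iA; [exact: xA|exact: xA'].
move=> H; split => i iA; have := H i; rewrite inE iA ?orbT => /(_ isT)[]//.
Qed.

Context (mu : I -> probability (measurableTypeR R) R).
Context (Q : probability pspace R).
Hypothesis QE : forall (A : {fset I}) (B : I -> set (measurableTypeR R)),
  (forall i, measurable (B i)) ->
  Q (cylinder A B) = (\prod_(i <- A) mu i (B i))%E.

Definition upd (i : I) (z : pspace * measurableTypeR R) : pspace :=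
  update z.1 i z.2.

(** Two measures that agree on cylinders are compared: replacing the coordinate [i] trades the
    factor of [i] in the product for the same factor carried by the new variable. *)
Lemma resample_measure (i : I) (S : set pspace) : measurable S ->
  pushforward (Q \x mu i)%E (upd i) S = Q S.
Proof.
move=> mS; pose m1 : {measure set pspace -> \bar R} := pushforward (Q \x mu i)%E (upd i).
rewrite -[LHS]/(m1 (measurable_update_pair i) S).
have mG : @measurable _ pspace = <<s cylinders >> by [].
apply: (@measure_unique _ R pspace cylinders (fun _ => setT) mG _ _ _ (m1 (measurable_update_pair i)) Q) => //.
- exact: setI_closed_cylinders.
- by move=> _; exists fset0, (fun=> setT); split => //; apply/seteqP; split.
- by rewrite bigcup_const //; exists 0.
- move=> _ [A [B [mB ->]]]; have E1 := QE A mB; rewrite /m1 /= /pushforward [RHS]E1.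
  have -> : upd i @^-1` cylinder A B =
      (cylinder (A `\ i)%fset B `*` (if i \in A then B i else setT)).
    apply/seteqP; split => [[x s]|[x s]] /=; rewrite /upd /update /=.
      move=> H; split => [k|]; last first.
        by case: ifP => // iA; have := H i iA; rewrite eqxx.
      by rewrite !inE => /andP[ki kA]; have := H k kA; rewrite (negbTE ki).
    move=> [xA sB] k kA; case: eqVneq => [ki|ki].
      by move: sB; rewrite -ki kA.
    by apply: xA; rewrite !inE ki.
  rewrite product_measure1E //; [|exact: measurable_cylinder|by case: ifP].
  have E2 := QE (A `\ i)%fset mB; rewrite [X in (X * _)%E]E2.
  case: ifPn => iA; last first.
    by rewrite mem_fsetD1 // [X in (_ * X)%E]probability_setT mule1.
  by rewrite [RHS](big_fsetD1 i) //= muleC.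
- move=> _; have H : ((Q \x mu i) setT < +oo)%E.
    rewrite -setXTT product_measure1E // [X in (X * _)%E]probability_setT mul1e.
    by rewrite [X in (X < _)%E]probability_setT ltry.
  exact: H.
Qed.

End ProductSpace.

Section Resampling.
Context (R : realType) (I : countType).
Context (mu : I -> probability (measurableTypeR R) R).
Context (Q : probability (pspace R I) R).
Hypothesis QE : forall (A : {fset I}) (B : I -> set (measurableTypeR R)),
  (forall i, measurable (B i)) ->
  Q (cylinder A B) = (\prod_(i <- A) mu i (B i))%E.
Implicit Types (i j : I) (A : seq I) (x : I -> R).
Local Notation X := (pspace R I).

(** Tonelli followed by [resample_measure]. Independence enters through this identity and its signed
    version [resample], so no infinite product measure has to be constructed. *)
Lemma ge0_resample i (h : X -> \bar R) : measurable_fun setT h ->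
  (forall x, (0 <= h x)%E) ->
  (\int[Q]_x \int[mu i]_s h (update x i s) = \int[Q]_x h x)%E.
Proof.
move=> mh h0.
pose f (z : X * measurableTypeR R) : \bar R := h (upd i z).
have mf : measurable_fun setT f.
  by apply: (measurableT_comp mh); exact: measurable_update_pair.
rewrite -(fubini_tonelli1 f mf (fun z => h0 _)).
rewrite -[LHS]/(\int[Q \x mu i]_(z in (@upd R I i) @^-1` setT) (h \o @upd R I i) z)%E.
rewrite -ge0_integral_pushforward //; last exact: measurable_update_pair.
apply: eq_measure_integral => [|mf' S mS _]; first exact: measurable_update_pair.
exact: (resample_measure QE).
Qed.

Hypothesis mom : forall i, (\int[mu i]_s ((s ^+ 2)%:E) < +oo)%E.

(** [A] is a list, possibly with repetitions, so that two bounds combine by concatenation. *)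
Definition bd A x : R := 1 + \sum_(k <- A) x k ^+ 2.

Lemma bd_ge1 A x : 1 <= bd A x.
Proof. by rewrite lerDl sumr_ge0 // => k _; rewrite sqr_ge0. Qed.

Lemma bd_ge0 A x : 0 <= bd A x.
Proof. by apply: le_trans (bd_ge1 A x). Qed.

Lemma bd_cat A B x : bd A x + bd B x <= 2 * bd (A ++ B) x.
Proof.
rewrite /bd big_cat /=.
have : 0 <= \sum_(k <- A) x k ^+ 2 by rewrite sumr_ge0 // => k _; rewrite sqr_ge0.
have : 0 <= \sum_(k <- B) x k ^+ 2 by rewrite sumr_ge0 // => k _; rewrite sqr_ge0.
lra.
Qed.

Lemma bd_update A x i s : bd A (update x i s) <= bd A x + (size A)%:R * s ^+ 2.
Proof.
rewrite /bd -addrA lerD2l; elim: A => [|k A IH].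
  by rewrite !big_nil mul0r addr0.
rewrite !big_cons /= -natr1 mulrDl mul1r.
have : update x i s k ^+ 2 <= x k ^+ 2 + s ^+ 2.
  by rewrite /update; case: ifP => _; rewrite ?lerDr ?lerDl sqr_ge0.
lra.
Qed.

Lemma measurable_coordR i : measurable_fun setT (fun x : X => x i : R).
Proof. exact: measurable_coord. Qed.

Lemma integrable_sqr i : (mu i).-integrable setT (fun s : R => (s ^+ 2)%:E).
Proof.
apply/integrableP; split.
  by apply/measurable_EFinP; apply: measurable_funX; exact: measurable_id.
by under eq_integral do rewrite gee0_abs ?lee_fin ?sqr_ge0 //; exact: mom.
Qed.

Lemma integrable_coord_sqr i : Q.-integrable setT (fun x : X => (x i ^+ 2)%:E).
Proof.
have m2 : measurable_fun setT (fun x : X => (x i ^+ 2)%:E).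
  by apply/measurable_EFinP; apply: measurable_funX; exact: measurable_coordR.
apply/integrableP; split => //.
under eq_integral do rewrite gee0_abs ?lee_fin ?sqr_ge0 //.
rewrite -(ge0_resample i m2) => [|x]; last by rewrite lee_fin sqr_ge0.
under eq_integral do under eq_integral do rewrite update_same.
rewrite (_ : (\int[Q]_x _)%E = (\int[mu i]_s ((s ^+ 2)%:E))%E) //.
rewrite (integral_cst Q measurableT (\int[mu i]_s ((s ^+ 2)%:E))%E).
by rewrite [X in (_ * X)%E]probability_setT mule1.
Qed.

Lemma integrable_bd A : Q.-integrable setT (EFin \o bd A).
Proof.
rewrite (_ : EFin \o bd A = (EFin \o cst 1) \+ (fun x : X => \sum_(k <- A) (x k ^+ 2)%:E)%E).
  apply: integrableD => //; first exact: finite_measure_integrable_cst.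
  by apply: integrable_sum => // k _; exact: integrable_coord_sqr.
by apply/funext => x /=; rewrite /bd EFinD sumEFin.
Qed.

(* Quadratic growth: a class of integrable functions stable under the
   integration of a coordinate, in which no exceptional null set appears. *)
Definition quad (h : X -> R) : Prop :=
  measurable_fun setT h /\ exists A c, forall x, `|h x| <= c * bd A x.

Lemma quad_bound (h : X -> R) A c : measurable_fun setT h ->
  (forall x, `|h x| <= c * bd A x) -> quad h.
Proof. by move=> mh hb; split => //; exists A, c. Qed.

Lemma quadP (h : X -> R) : quad h ->
  exists A c, 0 <= c /\ forall x, `|h x| <= c * bd A x.
Proof.
move=> [mh [A [c hc]]]; exists A, `|c|; split => // x.
by apply: le_trans (hc x) _; rewrite ler_wpM2r ?bd_ge0 ?ler_norm.
Qed.

Lemma quad_integrable h : quad h -> Q.-integrable setT (EFin \o h).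
Proof.
move=> qh; have [A [c [c0 hc]]] := quadP qh; case: qh => mh _.
apply: (le_integrable measurableT _ _ (integrableZl measurableT c (integrable_bd A))).
  exact/measurable_EFinP.
move=> x _ /=; rewrite lee_fin (le_trans (hc x)) // ger0_norm // mulr_ge0 //.
exact: bd_ge0.
Qed.

Lemma measurable_section (h : X -> R) i x : measurable_fun setT h ->
  measurable_fun setT (fun s : R => h (update x i s)).
Proof.
by move=> mh; apply: (measurableT_comp mh); exact: measurable_update_l.
Qed.

Lemma quad_integrable_section h i x : quad h ->
  (mu i).-integrable setT (fun s : R => (h (update x i s))%:E).
Proof.
move=> qh; have [A [c [c0 hc]]] := quadP qh; case: qh => mh _.
have H : (mu i).-integrable setT
   ((EFin \o cst (c * bd A x)) \+ (fun s : R => (c * (size A)%:R)%:E * (s ^+ 2)%:E)%E).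
  apply: integrableD => //; first exact: finite_measure_integrable_cst.
  by apply: integrableZl => //; exact: integrable_sqr.
apply: (le_integrable measurableT _ _ H).
  by apply/measurable_EFinP; exact: measurable_section.
move=> s _ /=; rewrite lee_fin (le_trans (hc _)) // ger0_norm.
  by rewrite -mulrA -mulrDr ler_wpM2l // bd_update.
by apply: addr_ge0; [exact: mulr_ge0 c0 (bd_ge0 _ _)|rewrite mulr_ge0 ?sqr_ge0 // mulr_ge0].
Qed.

Lemma quadD g h : quad g -> quad h -> quad (fun x => g x + h x).
Proof.
move=> qg qh; have [A [c [c0 gc]]] := quadP qg; have [B [e [e0 he]]] := quadP qh.
case: qg qh => mg _ [mh _].
apply: (@quad_bound _ (A ++ B) (2 * (c + e))) => [|x].
  exact: measurable_funD.
apply: (le_trans (ler_normD _ _)); apply: (le_trans (lerD (gc x) (he x))).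
have := bd_cat A B x; have := bd_ge0 A x; have := bd_ge0 B x.
move: (bd A x) (bd B x) (bd (A ++ B) x) => q p r p0 q0 pq.
have : c * q <= c * (2 * r) by rewrite ler_wpM2l //; lra.
have : e * p <= e * (2 * r) by rewrite ler_wpM2l //; lra.
lra.
Qed.

Lemma quadZ a h : quad h -> quad (fun x => a * h x).
Proof.
move=> [mh [A [c hc]]]; apply: (@quad_bound _ A (`|a| * c)) => [|x].
  exact: measurable_funM.
by rewrite normrM -mulrA ler_wpM2l.
Qed.

Lemma quad_cst (a : R) : quad (fun _ => a).
Proof.
apply: (@quad_bound _ [::] `|a|) => [|x]; first exact: measurable_cst.
by rewrite /bd big_nil addr0 mulr1.
Qed.

Definition avg i (h : X -> R) (x : X) : R := \int[mu i]_s h (update x i s).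

Lemma avgE i h x : quad h ->
  ((avg i h x)%:E = \int[mu i]_s (h (update x i s))%:E)%E.
Proof.
by move=> qh; rewrite fineK //; apply: integrable_fin_num => //; exact: quad_integrable_section.
Qed.

Lemma integrable_upd i h : quad h ->
  (Q \x mu i)%E.-integrable setT (EFin \o h \o upd i).
Proof.
move=> qh; have mh : measurable_fun setT (EFin \o h).
  by apply/measurable_EFinP; case: qh.
have mhu : measurable_fun setT (EFin \o h \o @upd R I i).
  by apply: (measurableT_comp mh); exact: measurable_update_pair.
apply/integrable12ltyP => //.
have mah : measurable_fun setT (abse \o (EFin \o h)).
  exact: measurableT_comp.
rewrite (ge0_resample i mah (fun x => abse_ge0 _)).
by have /integrableP[] := quad_integrable qh.
Qed.

Lemma measurable_avg i h : quad h -> measurable_fun setT (avg i h).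
Proof.
move=> qh; have mF := measurable_fubini_F (integrable_upd i qh).
have mfine : measurable_fun [set: \bar R] fine by [].
exact: (measurableT_comp mfine mF).
Qed.

(** Integration turns the square of the new coordinate into its second moment, a constant that the
    [1] in [bd] absorbs. *)
Lemma quad_avg i h : quad h -> quad (avg i h).
Proof.
move=> qh; have [A [c [c0 hc]]] := quadP qh.
pose m := \int[mu i]_s (s ^+ 2).
have m0 : 0 <= m by apply: Rintegral_ge0 => s _; exact: sqr_ge0.
apply: (@quad_bound _ A (c * (1 + (size A)%:R * m))); first exact: measurable_avg.
move=> x; rewrite /avg.
have ih := quad_integrable_section i x qh.
apply: (le_trans (le_normr_Rintegral measurableT ih)).
have H : (mu i).-integrable setT (fun s : R => (c * bd A x + (c * (size A)%:R) * s ^+ 2)%:E).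
  rewrite (_ : (fun s => _) = ((EFin \o cst (c * bd A x)) \+
     (fun s : R => (c * (size A)%:R)%:E * (s ^+ 2)%:E)%E)) //.
  apply: integrableD => //; first exact: finite_measure_integrable_cst.
  by apply: integrableZl => //; exact: integrable_sqr.
apply: (@le_trans _ _ (\int[mu i]_s (c * bd A x + (c * (size A)%:R) * s ^+ 2))).
  apply: le_Rintegral => //; first exact: integrable_norm.
  move=> s _; apply: (le_trans (hc _)).
  by rewrite -mulrA -mulrDr ler_wpM2l // bd_update.
rewrite RintegralD //; last 2 first.
- exact: finite_measure_integrable_cst.
- exact: (integrableZl measurableT (c * (size A)%:R) (integrable_sqr i)).
rewrite Rintegral_cst // [X in _ * fine X]probability_setT mulr1.
rewrite RintegralZl //; last exact: integrable_sqr.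
rewrite -/m.
have b1 := bd_ge1 A x.
have : 0 <= c * ((size A)%:R * m * (bd A x - 1)).
  by rewrite mulr_ge0 // mulr_ge0 ?subr_ge0 // mulr_ge0.
lra.
Qed.

Lemma resample i h : quad h -> \int[Q]_x avg i h x = \int[Q]_x h x.
Proof.
move=> qh; congr fine; have qa := quad_avg i qh.
under eq_integral do rewrite avgE //.
rewrite (integral12_prod_meas1 (integrable_upd i qh)).
rewrite -(preimage_setT (@upd R I i)) -integral_pushforward //; last 3 first.
- exact: measurable_update_pair.
- by apply/measurable_EFinP; case: qh.
- exact: integrable_upd.
apply: eq_measure_integral => [|mf' S mS _]; first exact: measurable_update_pair.
exact: (resample_measure QE).
Qed.

End Resampling.

(** * Efron-Stein inequalities *)

Section L2Operators.
Context (R : realType) (I : countType).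
Context (mu : I -> probability (measurableTypeR R) R).
Context (Q : probability (pspace R I) R).
Hypothesis QE : forall (A : {fset I}) (B : I -> set (measurableTypeR R)),
  (forall i, measurable (B i)) ->
  Q (cylinder A B) = (\prod_(i <- A) mu i (B i))%E.
Hypothesis mom : forall i, (\int[mu i]_s ((s ^+ 2)%:E) < +oo)%E.
Local Notation X := (pspace R I).
Implicit Types (i j : I) (A : seq I) (f g h : X -> R).
Local Notation avg := (avg mu).

(** Quadratic growth is asked of the square: products of two such functions are then integrable, and
    [avg i] preserves the class. *)
Definition quad2 f : Prop := measurable_fun setT f /\ quad (fun x => f x ^+ 2).

Definition ip f g : R := \int[Q]_x (f x * g x).
Definition sqn f : R := ip f f.
Definition dif i f : X -> R := fun x => f x - avg i f x.

Lemma quad_le g h : measurable_fun setT g -> quad h ->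
  (forall x, `|g x| <= h x) -> quad g.
Proof.
move=> mg [_ [A [c hc]]] gh; split => //; exists A, c => x.
by apply: le_trans (hc x); apply: le_trans (gh x) (ler_norm _).
Qed.

Lemma quad2_mul f g : quad2 f -> quad2 g -> quad (fun x => f x * g x).
Proof.
move=> [mf qf] [mg qg]; apply: (quad_le _ (quadD qf qg)); first exact: measurable_funM.
move=> x; rewrite normrM -[f x ^+ 2]real_normK ?num_real //.
rewrite -[g x ^+ 2]real_normK ?num_real //; move: (`|f x|) (`|g x|) => a b.
have := sqr_ge0 (a - b); have := sqr_ge0 (a + b); rewrite !expr2; nra.
Qed.

Lemma quad2_quad f : quad2 f -> quad f.
Proof.
move=> [mf qf]; apply: (quad_le _ (quadD (quad_cst I 1) qf)) => // x.
rewrite -[f x ^+ 2]real_normK ?num_real //; move: (`|f x|) => a.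
have := sqr_ge0 (a - 1); rewrite !expr2; nra.
Qed.

Lemma quad2D f g : quad2 f -> quad2 g -> quad2 (fun x => f x + g x).
Proof.
move=> [mf qf] [mg qg]; split; first exact: measurable_funD.
apply: (quad_le _ (quadZ 2 (quadD qf qg))).
  by apply: measurable_funX; exact: measurable_funD.
move=> x; rewrite ger0_norm ?sqr_ge0 //.
have := sqr_ge0 (f x - g x); rewrite !expr2; nra.
Qed.

Lemma quad2Z (a : R) f : quad2 f -> quad2 (fun x => a * f x).
Proof.
move=> [mf qf]; split; first exact: measurable_funM.
by have := quadZ (a ^+ 2) qf; under [X in _ -> quad X]eq_fun do rewrite exprMn.
Qed.

Lemma quad2_cst (a : R) : quad2 (fun _ => a).
Proof. by split; [exact: measurable_cst|exact: quad_cst]. Qed.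

Lemma quad2B f g : quad2 f -> quad2 g -> quad2 (fun x => f x - g x).
Proof.
move=> qf qg; have := quad2D qf (quad2Z (-1) qg).
by under eq_fun do rewrite mulN1r.
Qed.

Lemma quad2_sum (T : Type) (s : seq T) (h : T -> X -> R) :
  (forall t, quad2 (h t)) -> quad2 (fun x => \sum_(t <- s) h t x).
Proof.
move=> qh; elim: s => [|k s IH].
  by under eq_fun do rewrite big_nil; exact: quad2_cst.
by under eq_fun do rewrite big_cons; exact: quad2D.
Qed.

Lemma avgD i g h x : quad g -> quad h ->
  avg i (fun y => g y + h y) x = avg i g x + avg i h x.
Proof. by move=> qg qh; apply: RintegralD => //; exact: quad_integrable_section. Qed.

Lemma avgB i g h x : quad g -> quad h ->
  avg i (fun y => g y - h y) x = avg i g x - avg i h x.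
Proof. by move=> qg qh; apply: RintegralB => //; exact: quad_integrable_section. Qed.

Lemma avg_indepM i g h x : quad h -> (forall s, g (update x i s) = g x) ->
  avg i (fun y => g y * h y) x = g x * avg i h x.
Proof.
move=> qh gi; rewrite /avg -RintegralZl //; last exact: quad_integrable_section.
by apply: eq_Rintegral => s _; rewrite gi.
Qed.

Lemma avg_update i h x s : avg i h (update x i s) = avg i h x.
Proof. by apply: eq_Rintegral => t _; rewrite update_update. Qed.

Lemma avg_indep i g x : (forall s, g (update x i s) = g x) -> avg i g x = g x.
Proof.
move=> gi; rewrite /avg; under eq_Rintegral do rewrite gi.
by rewrite Rintegral_cst // [X in _ * fine X]probability_setT mulr1.
Qed.

Lemma avg_avg i h : avg i (avg i h) = avg i h.
Proof. by apply/funext => x; rewrite avg_indep // => s; rewrite avg_update. Qed.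

(** Nonnegativity of the variance in the coordinate [i]. *)
Lemma avg_sqr_le i f x : quad2 f -> avg i f x ^+ 2 <= avg i (fun y => f y ^+ 2) x.
Proof.
move=> qf; have q1 := quad2_quad qf; have [mf q2] := qf.
pose m := avg i f x.
have : 0 <= avg i (fun y => (f y - m) ^+ 2) x.
  by apply: Rintegral_ge0 => s _; exact: sqr_ge0.
have -> : (fun y => (f y - m) ^+ 2) = (fun y => (f y ^+ 2 + (- (2 * m)) * f y) + m ^+ 2).
  by apply/funext => y; ring.
have qm := quad_cst I (- (2 * m)).
rewrite avgD ?avgD //; [|exact: quadZ|exact: quadD q2 (quadZ _ q1)|exact: quad_cst].
rewrite (avg_indepM (g := fun=> - (2 * m)) (h := f)) // (avg_indep (g := fun=> m ^+ 2)) // -/m => H.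
by rewrite -subr_ge0; move: H; congr (_ <= _); ring.
Qed.

Lemma quad2_avg i f : quad2 f -> quad2 (avg i f).
Proof.
move=> qf; have [mf q2] := qf; have q1 := quad2_quad qf.
split; first exact: (measurable_avg QE).
apply: (quad_le _ (quad_avg QE mom i q2)).
  by apply: measurable_funX; exact: (measurable_avg QE).
by move=> x; rewrite ger0_norm ?sqr_ge0 // avg_sqr_le.
Qed.

Lemma quad2_dif i f : quad2 f -> quad2 (dif i f).
Proof. by move=> qf; apply: quad2B => //; exact: quad2_avg. Qed.

(** Fubini. As [h] grows at most quadratically, it is dominated by [b s + b t] on the product of the
    two laws, which is integrable by the second moments. *)
Lemma avgC i j h : quad h -> avg i (avg j h) = avg j (avg i h).
Proof.
have [->//|ij] := eqVneq i j; move=> qh; apply/funext => x; congr fine.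
under eq_integral do rewrite (avgE mom) //.
under [RHS]eq_integral do rewrite (avgE mom) //.
pose F (z : measurableTypeR R * measurableTypeR R) : \bar R :=
  (h (update (update x i z.1) j z.2))%:E.
transitivity (\int[mu i]_s \int[mu j]_t F (s, t))%E => //.
transitivity (\int[mu j]_t \int[mu i]_s F (s, t))%E; last first.
  apply: eq_integral => t _; apply: eq_integral => s _.
  by rewrite /F /= updateC.
apply: Fubini.
have [A [c [c0 hc]]] := quadP qh; case: (qh) => mh _.
have mF : measurable_fun setT F.
  by apply/measurable_EFinP; apply: (measurableT_comp mh); exact: measurable_update2.
apply/integrable12ltyP => //.
pose b (s : R) : \bar R := (c * (bd A x + (size A)%:R * s ^+ 2))%:E.
have ib k : (mu k).-integrable setT b.
  rewrite (_ : b = (EFin \o cst (c * bd A x)) \+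
     (fun s : R => (c * (size A)%:R)%:E * (s ^+ 2)%:E)%E); last first.
    by apply/funext => s /=; rewrite /b mulrDr mulrA.
  apply: integrableD => //; first exact: finite_measure_integrable_cst.
  by apply: integrableZl => //; exact: integrable_sqr.
have b0 s : (0 <= b s)%E by rewrite lee_fin mulr_ge0 // addr_ge0 ?bd_ge0 // mulr_ge0 ?sqr_ge0.
have lb k : (\int[mu k]_s b s < +oo)%E.
  have /integrableP[_] := ib k; apply: le_lt_trans.
  by rewrite le_eqVlt; apply/orP; left; apply/eqP; apply: eq_integral => s _; rewrite gee0_abs.
have mb : measurable_fun setT b by have /integrableP[] := ib i.
have maF : measurable_fun setT (abse \o F) by exact: measurableT_comp.
apply: (@le_lt_trans _ _ (\int[mu i]_s (b s + \int[mu j]_t b t))%E).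
  apply: ge0_le_integral => //.
  - by move=> s _; exact: integral_ge0.
  - exact: (measurable_fun_fubini_tonelli_F _ maF (fun z => abse_ge0 _)).
  - by apply: emeasurable_funD => //; exact: mb.
  move=> s _; apply: (@le_trans _ _ (\int[mu j]_t (b s + b t))%E).
    apply: ge0_le_integral => //.
    - apply: measurableT_comp => //; apply: (measurableT_comp mF).
      exact: pair1_measurable.
    - by apply: emeasurable_funD => //; exact: mb.
    move=> t _; rewrite /F /= lee_fin (le_trans (hc _)) // -mulrDr ler_wpM2l //.
    apply: (le_trans (bd_update _ _ _ _)).
    have := bd_update A x i s; have := bd_ge0 A x; lra.
  rewrite ge0_integralD //.
  rewrite (integral_cst (mu j) measurableT (b s)).
  by rewrite [X in (_ * X)%E]probability_setT mule1.
rewrite ge0_integralD //; last by move=> s _; exact: integral_ge0.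
rewrite (integral_cst (mu i) measurableT) [X in (_ * X)%E]probability_setT mule1.
by rewrite lte_add_pinfty ?lb.
Qed.

Lemma ipC f g : ip f g = ip g f.
Proof. by apply: eq_Rintegral => x _; rewrite mulrC. Qed.

Lemma sqn_ge0 f : 0 <= sqn f.
Proof. by apply: Rintegral_ge0 => x _; rewrite -expr2 sqr_ge0. Qed.

Lemma ip_integrable f g : quad2 f -> quad2 g ->
  Q.-integrable setT (EFin \o (fun x => f x * g x)).
Proof. by move=> qf qg; apply: (quad_integrable QE mom); exact: quad2_mul. Qed.

Lemma ipDr f g h : quad2 f -> quad2 g -> quad2 h ->
  ip f (fun x => g x + h x) = ip f g + ip f h.
Proof.
move=> qf qg qh; rewrite /ip; under eq_Rintegral do rewrite mulrDr.
by apply: RintegralD => //; exact: ip_integrable.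
Qed.

Lemma ipBr f g h : quad2 f -> quad2 g -> quad2 h ->
  ip f (fun x => g x - h x) = ip f g - ip f h.
Proof.
move=> qf qg qh; rewrite /ip; under eq_Rintegral do rewrite mulrBr.
by apply: RintegralB => //; exact: ip_integrable.
Qed.

Lemma ipZr f g (a : R) : quad2 f -> quad2 g -> ip f (fun x => a * g x) = a * ip f g.
Proof.
move=> qf qg; rewrite /ip; under eq_Rintegral do rewrite mulrCA.
by apply: RintegralZl => //; exact: ip_integrable.
Qed.

Lemma ip0r f : ip f (fun=> 0) = 0.
Proof.
rewrite /ip; under eq_Rintegral do rewrite mulr0.
by rewrite Rintegral_cst // mul0r.
Qed.

Lemma ip_sumr (T : Type) (s : seq T) (h : T -> X -> R) f : quad2 f ->
  (forall t, quad2 (h t)) ->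
  ip f (fun x => \sum_(t <- s) h t x) = \sum_(t <- s) ip f (h t).
Proof.
move=> qf qh; elim: s => [|k s IH].
  by under eq_fun do rewrite big_nil; rewrite ip0r big_nil.
under eq_fun do rewrite big_cons; rewrite big_cons ipDr ?IH //.
exact: quad2_sum.
Qed.

Lemma sqnD f g : quad2 f -> quad2 g ->
  sqn (fun x => f x + g x) = sqn f + 2 * ip f g + sqn g.
Proof.
move=> qf qg; have qfg := quad2D qf qg.
rewrite /sqn ipDr // (ipC _ f) (ipC _ g) !ipDr // (ipC g f); ring.
Qed.

(** [avg i f] ignores the coordinate [i], so integrating this coordinate averages [g] alone. From
    this follows that [avg i] and [dif i] are complementary orthogonal projections. *)
Lemma ip_avg i f g : quad2 f -> quad2 g -> ip (avg i f) g = ip (avg i f) (avg i g).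
Proof.
move=> qf qg; have qaf := quad2_avg i qf.
rewrite /ip -(resample QE mom i (quad2_mul qaf qg)).
apply: eq_Rintegral => x _; rewrite avg_indepM //; first exact: quad2_quad.
by move=> s; rewrite avg_update.
Qed.

Lemma ip_difl i f g : quad2 f -> quad2 g -> ip (dif i f) g = ip f (dif i g).
Proof.
move=> qf qg; have qaf := quad2_avg i qf; have qag := quad2_avg i qg.
have -> : ip (dif i f) g = ip f g - ip (avg i f) g.
  by rewrite (ipC (dif i f) g) (ipBr qg qf qaf) (ipC g f) (ipC g (avg i f)).
rewrite (ipBr qf qg qag) (ip_avg i qf qg) (ipC f (avg i g)) (ip_avg i qg qf).
by rewrite (ipC (avg i g) (avg i f)).
Qed.

Lemma dif_dif i f : quad2 f -> dif i (dif i f) = dif i f.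
Proof.
move=> qf; apply/funext => x; have q1 := quad2_quad qf.
have q2 := quad2_quad (quad2_avg i qf).
by rewrite {1}/dif [X in _ - X]avgB // avg_avg subrr subr0.
Qed.

Lemma difC i j f : quad2 f -> dif i (dif j f) = dif j (dif i f).
Proof.
move=> qf; apply/funext => x; have q1 := quad2_quad qf.
have qi := quad2_quad (quad2_avg i qf); have qj := quad2_quad (quad2_avg j qf).
rewrite /dif !avgB // (avgC i j q1); ring.
Qed.

Lemma ip_dif_avg i f g : quad2 f -> quad2 g -> ip (dif i f) (avg i g) = 0.
Proof.
move=> qf qg; rewrite (ip_difl i qf (quad2_avg i qg)).
have -> : dif i (avg i g) = fun=> 0 by apply/funext => x; rewrite /dif avg_avg subrr.
exact: ip0r.
Qed.

(** The [dif i] are commuting orthogonal projections, so both sides equal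
    [ip f (dif i (dif j f))]. *)
Lemma ip_dif_dif i j f : quad2 f -> ip (dif i f) (dif j f) = sqn (dif i (dif j f)).
Proof.
move=> qf; have qi := quad2_dif i qf; have qj := quad2_dif j qf.
have qij := quad2_dif i qj.
have e : dif i (dif j f) = dif j (dif i (dif j f)).
  by rewrite (difC j i qj) (dif_dif j qf).
have -> : ip (dif i f) (dif j f) = ip (dif i f) (dif i (dif j f)).
  by rewrite -(ip_difl i qi qj) (dif_dif i qf).
by rewrite {1}e -(ip_difl j qi qij) (difC j i qf).
Qed.

Lemma sqn_avg_le i f : quad2 f -> sqn (avg i f) <= sqn f.
Proof.
move=> qf; have qa := quad2_avg i qf; have qd := quad2_dif i qf.
have -> : f = (fun x => dif i f x + avg i f x).
  by apply/funext => x; rewrite /dif subrK.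
rewrite sqnD // ip_dif_avg // mulr0 addr0.
rewrite (_ : avg i (fun x => _) = avg i f) ?lerDr ?sqn_ge0 //.
by congr avg; apply/funext => x; rewrite /dif subrK.
Qed.

Lemma sqn_dif_le i f : quad2 f -> sqn (dif i f) <= sqn f.
Proof.
move=> qf; have qa := quad2_avg i qf; have qd := quad2_dif i qf.
have E : f = (fun x => dif i f x + avg i f x).
  by apply/funext => x; rewrite /dif subrK.
rewrite [X in _ <= sqn X]E sqnD // ip_dif_avg // mulr0 addr0.
by rewrite lerDl sqn_ge0.
Qed.

Definition avgs A f := foldr avg f A.

Lemma quad2_avgs A f : quad2 f -> quad2 (avgs A f).
Proof. by move=> qf; elim: A => //= i A IH; exact: quad2_avg. Qed.

Lemma avgsB A f g : quad2 f -> quad2 g ->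
  avgs A (fun x => f x - g x) = (fun x => avgs A f x - avgs A g x).
Proof.
move=> qf qg; elim: A => //= i A ->; apply/funext => x.
by rewrite avgB //; apply: quad2_quad; exact: quad2_avgs.
Qed.

Lemma sqn_avgs_le A f : quad2 f -> sqn (avgs A f) <= sqn f.
Proof.
move=> qf; elim: A => //= i A IH; apply: le_trans IH.
by apply: sqn_avg_le; exact: quad2_avgs.
Qed.

Definition depends_on A f := forall x y : X, (forall i, i \in A -> x i = y i) -> f x = f y.

Lemma avgs_dep A f : depends_on A f -> exists c, avgs A f = fun=> c.
Proof.
have H B : depends_on (A ++ B) f -> depends_on B (avgs A f).
  elim: A B => //= i A IH B fAB x y xy; apply: eq_Rintegral => s _.
  have D : depends_on (i :: B) (avgs A f).
    apply: IH => x' y' H; apply: fAB => k; rewrite inE mem_cat => kAB; apply: H.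
    by rewrite mem_cat inE orbCA.
  apply: D => k; rewrite inE /update; case: eqVneq => //= _; exact: xy.
move=> fA; exists (avgs A f (fun=> 0)); apply/funext => x.
by apply: (H [::]); rewrite ?cats0.
Qed.

(* The increments of [f - avgs A f] along the list [A] are orthogonal. *)
Lemma efron_stein A f : quad2 f ->
  sqn (fun x => f x - avgs A f x) <= \sum_(i <- A) sqn (dif i f).
Proof.
move=> qf; elim: A => [|i A IH] /=.
  under eq_fun do rewrite subrr.
  by rewrite big_nil /sqn ip0r.
have qA := quad2_avgs A qf; have qd := quad2B qf qA.
have -> : (fun x => f x - avg i (avgs A f) x) =
    (fun x => dif i f x + avg i (fun y => f y - avgs A f y) x).
  apply/funext => x; rewrite avgB; [|exact: quad2_quad|exact: quad2_quad].
  by rewrite /dif; ring.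
rewrite sqnD; [|exact: quad2_dif|exact: quad2_avg].
rewrite ip_dif_avg // mulr0 addr0 big_cons lerD2l.
by apply: le_trans (sqn_avg_le _ _) IH.
Qed.

(** Young's inequality, from [0 <= sqn (e * f - g)] divided by [e]. *)
Lemma sqnD_le (e : R) f g : 0 < e -> quad2 f -> quad2 g ->
  sqn (fun x => f x + g x) <= (1 + e) * sqn f + (1 + e^-1) * sqn g.
Proof.
move=> e0 qf qg; rewrite sqnD //.
have := sqn_ge0 (fun x => e * f x + (-1) * g x).
rewrite sqnD; [|exact: quad2Z|exact: quad2Z].
rewrite /sqn !ipZr ?(ipC (fun x => _ * f x)) ?(ipC (fun x => _ * g x)) ?ipZr //; try exact: quad2Z.
move=> H; have ei : e * e^-1 = 1 by rewrite divff ?gt_eqF.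
have e'0 : 0 < e^-1 by rewrite invr_gt0.
have := mulr_ge0 (ltW e'0) H; rewrite -subr_ge0 => H2.
rewrite -subr_ge0; move: H2; congr (_ <= _).
rewrite (ipC g f); set a := ip f f; set b := ip f g; set c := ip g g.
transitivity ((e * e^-1) * (e * a - 2 * b) + e^-1 * c); first by ring.
by rewrite ei; ring.
Qed.

(** [avgs A] makes [g] constant and is a contraction, so a function of infinitely many coordinates
    is handled up to its distance to [g]. A small [e] keeps the factor of the sum close to [1]. *)
Lemma efron_stein_approx A f g (e : R) : 0 < e -> quad2 f -> quad2 g ->
  depends_on A g -> exists c, sqn (fun x => f x - c) <=
   (1 + e) * \sum_(i <- A) sqn (dif i f) + (1 + e^-1) * sqn (fun x => f x - g x).
Proof.
move=> e0 qf qg gA; have [c gc] := avgs_dep gA; exists c.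
have qA := quad2_avgs A qf; have qd := quad2B qf qg.
have -> : (fun x => f x - c) =
    (fun x => (f x - avgs A f x) + avgs A (fun y => f y - g y) x).
  by apply/funext => x; rewrite avgsB // gc; ring.
apply: (le_trans (sqnD_le e0 _ _)); [exact: quad2B|exact: quad2_avgs|].
apply: lerD; rewrite ler_wpM2l ?addr_ge0 ?invr_ge0 ?(ltW e0) //.
  exact: efron_stein.
exact: sqn_avgs_le.
Qed.

(* With [L f] the sum of the [dif i f], one has [ip f (L f) = S] and
   [sqn (L f) = S + off-diagonal terms], where [S] is the left-hand side. *)
Lemma reverse_efron_stein A f (K : R) : 0 <= K -> uniq A -> quad2 f ->
  \sum_(i <- A) \sum_(j <- A | j != i) sqn (dif i (dif j f)) <=
    K * \sum_(i <- A) sqn (dif i f) ->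
  \sum_(i <- A) sqn (dif i f) <= (1 + K) * sqn f.
Proof.
move=> K0 uA qf offd; set S := \sum_(i <- A) sqn (dif i f).
pose L x := \sum_(i <- A) dif i f x.
have qd i := quad2_dif i qf.
have qL : quad2 L by exact: quad2_sum.
have fL : ip f L = S.
  rewrite ip_sumr //; apply: eq_bigr => i _.
  by rewrite -{1}(dif_dif i qf) -(ip_difl i qf (qd i)).
have LL : sqn L <= (1 + K) * S.
  rewrite /sqn ip_sumr // (eq_bigr (fun i => \sum_(j <- A) sqn (dif i (dif j f)))).
    rewrite mulrDl mul1r; apply: le_trans (lerD (lexx S) offd).
    rewrite -big_split /= le_eqVlt; apply/orP; left; apply/eqP.
    rewrite big_seq_cond [RHS]big_seq_cond; apply: eq_bigr => i.
    rewrite andbT => iA; rewrite [LHS](bigD1_seq i iA uA).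
    by rewrite (dif_dif i qf).
  move=> i _; rewrite (ipC L (dif i f)) (ip_sumr A (qd i) qd).
  by apply: eq_bigr => j _; exact: ip_dif_dif.
have K1 : 0 < 1 + K by rewrite ltr_pwDl.
(* Expanding [0 <= sqn (f - t * L)] plays the role of Cauchy-Schwarz: with this [t] the last term is
   at most [t * S], which leaves [t * S <= sqn f]. *)
pose t := (1 + K)^-1.
have t0 : 0 < t by rewrite invr_gt0.
have tK : (1 + K) * t = 1 by rewrite divff ?gt_eqF.
have := sqn_ge0 (fun x => f x + (- t) * L x).
rewrite sqnD //; last exact: quad2Z.
rewrite [X in _ + X]/sqn !ipZr //; last exact: quad2Z.
rewrite (ipC (fun x => _ * L x)) ipZr // fL -/(sqn L) => H.
have LL2 : t * (t * sqn L) <= t * S.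
  rewrite ler_pM2l // -(ler_pM2l K1) mulrA tK mul1r; exact: LL.
have : 0 <= sqn f - t * S by move: H LL2; lra.
move=> /(mulr_ge0 (ltW K1)); rewrite mulrBr mulrA tK mul1r subr_ge0 //.
Qed.

End L2Operators.

(** * Measurability of the responses *)

Section MeasurableMatrices.
Context (R : realType) d (T : measurableType d).

Lemma measurable_inv : measurable_fun setT (@GRing.inv R).
Proof.
rewrite -(setvU [set (0 : R)]); apply/measurable_funU => //.
  exact: measurableC.
split; last exact: measurable_fun_set1.
apply: open_continuous_measurable_fun.
  exact: (closed_openC (@closed_eq R 0)).
by move=> x /set_mem /= /eqP x0; exact: inv_continuous.
Qed.

Lemma measurable_funV (f : T -> R) : measurable_fun setT f ->
  measurable_fun setT (fun x => (f x)^-1).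
Proof. by move=> mf; exact: (measurableT_comp measurable_inv). Qed.

Definition measurable_mx m n (A : T -> 'M[R]_(m, n)) :=
  forall i j, measurable_fun setT (fun x => A x i j).

Lemma measurable_mulmx m n k (A : T -> 'M[R]_(m, n)) (B : T -> 'M[R]_(n, k)) :
  measurable_mx A -> measurable_mx B -> measurable_mx (fun x => A x *m B x).
Proof.
move=> mA mB i j; under eq_fun do rewrite mxE.
by apply: measurable_sum => l; exact: measurable_funM.
Qed.

Lemma measurable_cst_mx m n (A : 'M[R]_(m, n)) : measurable_mx (fun=> A).
Proof. by move=> i j; exact: measurable_cst. Qed.

Lemma measurable_det n (A : T -> 'M[R]_n) : measurable_mx A ->
  measurable_fun setT (fun x => \det (A x)).
Proof.
move=> mA; apply: measurable_sum => s; apply: measurable_funM => //.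
by apply: measurable_prod => i _; exact: mA.
Qed.

(** Cramer's rule: the entries are quotients of determinants, and determinants are polynomials in
    the entries. *)
Lemma measurable_invmx n (A : T -> 'M[R]_n) : measurable_mx A ->
  (forall x, A x \in unitmx) -> measurable_mx (fun x => invmx (A x)).
Proof.
move=> mA uA i j.
have E x : invmx (A x) i j =
    (\det (A x))^-1 * ((-1) ^+ (j + i) * \det (row' j (col' i (A x)))).
  by rewrite /invmx uA !mxE.
under eq_fun do rewrite E; apply: measurable_funM.
  by apply: measurable_funV; exact: measurable_det.
apply: measurable_funM => //; apply: measurable_det => k l.
by under eq_fun do rewrite !mxE; exact: mA.
Qed.

Section Network.
Context m N (W : 'M[R]_(m, N)) (phi : 'rV[R]_N) (r : T -> 'I_N -> R).
Hypotheses (Wfree : row_free W) (r0 : forall x k, 0 < r x k).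
Hypothesis mr : forall k, measurable_fun setT (fun x => r x k).

Lemma measurable_resist_mx : measurable_mx (fun x => resist_mx (r x)).
Proof.
move=> i j; have E x : resist_mx (r x) i j = if i == j then r x i else 0.
  by rewrite !mxE; case: eqP.
by under eq_fun do rewrite E; case: eqP => _; [exact: mr|exact: measurable_cst].
Qed.

Lemma measurable_green : measurable_mx (fun x => green W (r x)).
Proof.
apply: measurable_mulmx; last exact: measurable_cst_mx.
apply: measurable_mulmx; first exact: measurable_cst_mx.
apply: measurable_invmx => [|x]; last exact: gram_unit.
apply: measurable_mulmx; last exact: measurable_cst_mx.
apply: measurable_mulmx; first exact: measurable_cst_mx.
exact: measurable_resist_mx.
Qed.

Lemma measurable_current k : measurable_fun setT (fun x => current W phi (r x) 0 k).
Proof.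
under eq_fun do rewrite mxE; apply: measurable_funD => //.
under eq_fun do rewrite mxE; apply: measurableT_comp => //.
apply: (measurable_mulmx _ measurable_green).
apply: measurable_mulmx; first exact: measurable_cst_mx.
exact: measurable_resist_mx.
Qed.

Lemma measurable_min_energy : measurable_fun setT (fun x => min_energy W phi (r x)).
Proof.
apply: measurable_sum => k; apply: measurable_funM => //.
by apply: measurable_funX; exact: measurable_current.
Qed.

End Network.
End MeasurableMatrices.

Section PositivePart.
Context (R : realType).

(* Resistances are read through [pos_or_one], so that the energies are defined,
   positive and measurable on the whole of [I -> R]. *)
Definition pos_or_one (s : R) : R := if 0 < s then s else 1.

Lemma pos_or_one_gt0 s : 0 < pos_or_one s.
Proof. by rewrite /pos_or_one; case: ifP. Qed.

Lemma pos_or_one_id s : 0 < s -> pos_or_one s = s.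
Proof. by rewrite /pos_or_one => ->. Qed.

Lemma measurable_pos_or_one : measurable_fun setT pos_or_one.
Proof.
apply: measurable_fun_ifT => //.
by apply: measurable_fun_ltr => //; exact: measurable_cst.
Qed.

Lemma pos_or_one_sqr_le s : pos_or_one s ^+ 2 <= 1 + s ^+ 2.
Proof.
rewrite /pos_or_one; case: ifP => _; first by rewrite lerDr ler01.
by rewrite expr1n lerDl sqr_ge0.
Qed.

Context (I : countType).

Definition posf (x : I -> R) : I -> R := fun i => pos_or_one (x i).

Lemma posf_gt0 x i : 0 < posf x i.
Proof. exact: pos_or_one_gt0. Qed.

Lemma posf_id x : (forall i, 0 < x i) -> posf x = x.
Proof. by move=> x0; apply/funext => i; exact: pos_or_one_id. Qed.

Lemma posf_update x i s : posf (update x i s) = update (posf x) i (pos_or_one s).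
Proof. by apply/funext => j; rewrite /posf /update; case: ifP. Qed.

Lemma measurable_posf_coord i :
  measurable_fun setT (fun x : pspace R I => posf x i).
Proof.
apply: (measurableT_comp measurable_pos_or_one).
exact: measurable_coordR.
Qed.

Definition measurable_response (rho : response R I) :=
  [/\ forall i j, measurable_fun setT (fun x : pspace R I => grn rho (posf x) i j),
      forall i, measurable_fun setT (fun x : pspace R I => cur rho (posf x) i) &
      measurable_fun setT (fun x : pspace R I => nrg rho (posf x))].

Lemma measurable_network_response es (ues : uniq es) m (W : 'M[R]_(m, size es))
    (Wfree : row_free W) phi :
  measurable_response (network_response ues Wfree phi).
Proof.
have r0 (x : pspace R I) k : 0 < posf x (tnth (in_tuple es) k) by exact: posf_gt0.
have mr k : measurable_fun setT (fun x : pspace R I => posf x (tnth (in_tuple es) k)).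
  exact: measurable_posf_coord.
split=> [i j|i|].
- rewrite /= /net_grn; case: insub => [k|] /=; last exact: measurable_cst.
  case: insub => [l|] /=; last exact: measurable_cst.
  exact: (measurable_green Wfree r0 mr).
- rewrite /= /net_cur; case: insub => [k|] /=; last exact: measurable_cst.
  exact: (measurable_current phi Wfree r0 mr).
- exact: (measurable_min_energy phi Wfree r0 mr).
Qed.

End PositivePart.

(** * Second differences of the minimal energy *)

Section SecondDifferences.
Context (R : realType) (I : countType).
Context (mu : I -> probability (measurableTypeR R) R).
Context (Q : probability (pspace R I) R).
Hypothesis QE : forall (A : {fset I}) (B : I -> set (measurableTypeR R)),
  (forall i, measurable (B i)) ->
  Q (cylinder A B) = (\prod_(i <- A) mu i (B i))%E.
Hypothesis mom : forall i, (\int[mu i]_s ((s ^+ 2)%:E) < +oo)%E.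
Local Notation X := (pspace R I).
Implicit Types (i j : I) (A : seq I) (f g h : X -> R) (x : X).
Local Notation avg := (avg mu).
Local Notation dif := (dif mu).
Local Notation sqn := (sqn Q).
Local Notation p := (@pos_or_one R).

Lemma indep_integral i (G : X -> \bar R) (b : R -> \bar R) :
  measurable_fun setT G -> (forall x, (0 <= G x)%E) ->
  (forall x s, G (update x i s) = G x) ->
  measurable_fun setT b -> (forall s, (0 <= b s)%E) ->
  (\int[Q]_x (G x * b (x i)) = (\int[Q]_x G x) * \int[mu i]_s b s)%E.
Proof.
move=> mG G0 Gi mb b0.
have mbi : measurable_fun setT (fun x : X => b (x i)).
  by apply: (measurableT_comp mb); exact: measurable_coordR.
rewrite -(ge0_resample QE i (h := fun x => (G x * b (x i))%E)); last 2 first.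
- exact: emeasurable_funM.
- by move=> x; exact: mule_ge0.
under eq_integral do under eq_integral do rewrite Gi update_same.
rewrite (eq_integral (fun x => G x * \int[mu i]_s b s)%E); last first.
  by move=> x _; rewrite ge0_integralZl.
by rewrite ge0_integralZr //; exact: integral_ge0.
Qed.

Lemma sqnE f : quad2 f -> ((sqn f)%:E = \int[Q]_x ((f x ^+ 2)%:E))%E.
Proof.
move=> qf; rewrite /sqn /ip fineK //; apply: integrable_fin_num => //.
exact: (ip_integrable QE mom qf qf).
Qed.

Lemma quad2_update i s f : quad2 f -> quad2 (fun x => f (update x i s)).
Proof.
move=> [mf qf]; have mu' : measurable_fun setT (fun x : X => f (update x i s)).
  by apply: (measurableT_comp mf); exact: measurable_update_r.
split => //; have [A [c [c0 hc]]] := quadP qf.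
apply: (@quad_bound _ _ _ A (c * (1 + (size A)%:R * s ^+ 2))).
  exact: measurable_funX.
move=> x; apply: (le_trans (hc _)); rewrite -mulrA ler_wpM2l //.
apply: (le_trans (bd_update _ _ _ _)); have b1 := bd_ge1 A x.
have : 0 <= (size A)%:R * s ^+ 2 * (bd A x - 1).
  by rewrite mulr_ge0 ?subr_ge0 // mulr_ge0 ?sqr_ge0.
lra.
Qed.

(** [dif i f x] is the mean of [f x - f (update x i s)] over [s]. *)
Lemma jensen_dif i f x : quad2 f ->
  (((dif i f x) ^+ 2)%:E <= \int[mu i]_s (((f x - f (update x i s)) ^+ 2)%:E))%E.
Proof.
move=> qf; have qh : quad2 (fun y => f x - f y) := quad2B (quad2_cst I (f x)) qf.
rewrite -(avgE mom i (h := fun y => (f x - f y) ^+ 2)); last by case: qh.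
rewrite lee_fin; apply: le_trans (avg_sqr_le mom i x qh).
have -> // : dif i f x = avg i (fun y => f x - f y) x.
rewrite (avgB mom) //; [|exact: quad_cst|exact: quad2_quad].
by rewrite avg_indep.
Qed.

Section Response.
Context (rho : response R I) (mrho : measurable_response rho).
Local Notation th := (cur rho).
Local Notation res := (fun x : X => nrg rho (posf x)).
Hypothesis qres : quad2 res.

(** [wt] is the weight of one coordinate in [mixed_difference_le], [beta] its mean over an
    independent copy, and [phi4] the integrand in the denominator of the constant, all read through
    [pos_or_one]. *)
Definition wt (s s' : R) : R :=
  (p s - p s') ^+ 2 * (vv (p s) ^+ 6 + vv (p s') ^+ 6).
Definition beta i (s : R) : \bar R := (\int[mu i]_s' (wt s s')%:E)%E.
Definition phi4 (s s' : R) : R :=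
  Num.max 0 (p s - p s') ^+ 2 * Num.min 1 (1 / p s ^+ 4).

Lemma measurable_vv d (T : measurableType d) (f : T -> R) :
  measurable_fun setT f -> measurable_fun setT (fun y => vv (f y)).
Proof. by move=> mf; apply: measurable_funD => //; exact: measurable_funV. Qed.

Lemma measurable_wt d (T : measurableType d) (f g : T -> R) :
  measurable_fun setT f -> measurable_fun setT g ->
  measurable_fun setT (fun y => wt (f y) (g y)).
Proof.
move=> mf mg.
have mpf : measurable_fun setT (fun y => p (f y)).
  exact: (measurableT_comp (@measurable_pos_or_one R) mf).
have mpg : measurable_fun setT (fun y => p (g y)).
  exact: (measurableT_comp (@measurable_pos_or_one R) mg).
apply: measurable_funM; first by apply: measurable_funX; exact: measurable_funB.
by apply: measurable_funD; apply: measurable_funX; exact: measurable_vv.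
Qed.

Lemma wt_ge0 s s' : 0 <= wt s s'.
Proof.
by rewrite mulr_ge0 ?sqr_ge0 // addr_ge0 // exprn_ge0 // ltW // vv_gt0 // pos_or_one_gt0.
Qed.

Lemma beta_ge0 i s : (0 <= beta i s)%E.
Proof. by apply: integral_ge0 => s' _; rewrite lee_fin wt_ge0. Qed.

Lemma measurable_beta i : measurable_fun setT (beta i).
Proof.
pose F (z : measurableTypeR R * measurableTypeR R) : \bar R := (wt z.1 z.2)%:E.
apply: (measurable_fun_fubini_tonelli_F F) => [|z].
  by apply/measurable_EFinP; exact: measurable_wt measurable_fst measurable_snd.
by rewrite lee_fin wt_ge0.
Qed.

Let xi i j x : R := interaction rho (posf x) i j.

Lemma p1 : p 1 = 1. Proof. exact: pos_or_one_id. Qed.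

Lemma interactionE i j x :
  xi i j x = grn rho (posf (update (update x i 1) j 1)) i j ^+ 2 *
   (th (posf (update (update x i 1) j 1)) i ^+ 4 +
    th (posf (update (update x i 1) j 1)) j ^+ 4).
Proof. by rewrite /xi /interaction !posf_update p1. Qed.

Lemma pow4_ge0 (y : R) : 0 <= y ^+ 4.
Proof. by rewrite (_ : 4 = 2 * 2)%N // exprM sqr_ge0. Qed.

Lemma xi_ge0 i j x : 0 <= xi i j x.
Proof. by rewrite /xi /interaction mulr_ge0 ?sqr_ge0 // addr_ge0 // pow4_ge0. Qed.

Lemma measurable_xi i j : measurable_fun setT (xi i j).
Proof.
have [mG mth _] := mrho.
have mU : measurable_fun setT (fun x : X => (update (update x i 1) j 1 : X)).
  apply: (measurableT_comp (measurable_update_r j 1)).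
  exact: measurable_update_r.
apply: (eq_measurable_fun (fun x : X =>
    grn rho (posf (update (update x i 1) j 1)) i j ^+ 2 *
   (th (posf (update (update x i 1) j 1)) i ^+ 4 +
    th (posf (update (update x i 1) j 1)) j ^+ 4))).
  by move=> x _; rewrite -interactionE.
apply: measurable_funM.
  apply: measurable_funX; exact: (measurableT_comp (mG i j) mU).
by apply: measurable_funD; apply: measurable_funX;
  [exact: (measurableT_comp (mth i) mU)|exact: (measurableT_comp (mth j) mU)].
Qed.

Lemma xi_update_j i j x s : xi i j (update x j s) = xi i j x.
Proof.
have [<-|ij] := eqVneq i j; rewrite /xi /interaction posf_update.
  by rewrite !update_update.
by rewrite -(updateC (posf x) 1 (p s) ij) update_update.
Qed.

Lemma xi_update_i i j x s : xi i j (update x i s) = xi i j x.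
Proof. by rewrite /xi /interaction posf_update update_update. Qed.

(** Jensen in both coordinates turns the two operators into means of the mixed difference over
    independent copies, and the bound on the latter splits into one weight per coordinate and a
    kernel free of [x i] and [x j]. *)
Lemma second_difference_le i j x : i != j ->
  (((dif i (dif j res) x) ^+ 2)%:E <=
   (8192 * xi i j x)%:E * (beta i (x i) * beta j (x j)))%E.
Proof.
move=> ij; have qj := quad2_dif QE mom j qres.
apply: (le_trans (jensen_dif i x qj)).
have [_ _ mres] := mrho.
have xx : x = update (update x i (x i)) j (x j) by rewrite !update_id.
have D s' t' : ((res x - res (update x i s') -
     (res (update x j t') - res (update (update x j t') i s'))) ^+ 2 <=
    8192 * xi i j x * wt (x i) s' * wt (x j) t').
  have := mixed_difference_le rho (posf_gt0 x) ij (posf_gt0 x i)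
    (pos_or_one_gt0 s') (posf_gt0 x j) (pos_or_one_gt0 t').
  rewrite -/(xi i j x) !update_id -!posf_update.
  rewrite (_ : update (update x i s') j (x j) = update x i s'); last first.
    have {1}<- : update x i s' j = x j by rewrite update_other // eq_sym.
    by rewrite update_id.
  rewrite -(updateC x s' t' ij) => H; apply: le_trans (le_trans H _).
    have E (a b c d : R) : a - b - (c - d) = a - b - c + d by ring.
    by rewrite E.
  rewrite /wt -/(posf x i) -/(posf x j).
  by move: (xi i j x) => z; rewrite le_eqVlt; apply/orP; left; apply/eqP; ring.
have K00 : 0 <= 8192 :> R by rewrite ler0n.
move: D K00; move: (8192 : R) => K0 D K00.
have xi0 := xi_ge0 i j x; move: (xi i j x) xi0 D => z z0 D.
apply: (@le_trans _ _ (\int[mu i]_s'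
   ((K0 * z * wt (x i) s')%:E * beta j (x j)))%E).
  apply: ge0_le_integral => //.
  - by move=> s' _; rewrite lee_fin sqr_ge0.
  - apply/measurable_EFinP; apply: measurable_funX; apply: measurable_funB => //.
    by apply: measurable_section; case: qj.
  - apply: emeasurable_funM; last exact: measurable_cst.
    apply/measurable_EFinP; apply: measurable_funM; first exact: measurable_cst.
    by apply: measurable_wt; [exact: measurable_cst|exact: measurable_id].
  move=> s' _; pose h (y : X) := res y - res (update y i s').
  have qu := quad2_update i s' qres.
  have qh : quad2 h by exact: quad2B qres qu.
  have -> : dif j res x - dif j res (update x i s') = dif j h x.
    rewrite /dif /h (avgB mom); [|exact: quad2_quad|exact: quad2_quad qu].
    have -> : avg j res (update x i s') = avg j (fun y => res (update y i s')) x.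
      by apply: eq_Rintegral => t _; rewrite (updateC _ _ _ ij).
    by ring.
  apply: (le_trans (jensen_dif j x qh)).
  have k0 : 0 <= K0 * z * wt (x i) s'.
    by rewrite mulr_ge0 ?wt_ge0 // mulr_ge0.
  have mw : measurable_fun setT (fun t' : R => (wt (x j) t')%:E).
    by apply/measurable_EFinP; apply: measurable_wt; [exact: measurable_cst|exact: measurable_id].
  rewrite /beta -ge0_integralZl //; last first.
    by move=> t' _; rewrite lee_fin wt_ge0.
  apply: ge0_le_integral => //.
  - by move=> t' _; rewrite lee_fin sqr_ge0.
  - apply/measurable_EFinP; apply: measurable_funX; apply: measurable_funB => //.
    by apply: measurable_section; case: qh.
  - by apply: emeasurable_funM.
  by move=> t' _; rewrite -EFinM lee_fin; exact: D.
have mw : measurable_fun setT (fun s' : R => (wt (x i) s')%:E).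
  by apply/measurable_EFinP; apply: measurable_wt; [exact: measurable_cst|exact: measurable_id].
under eq_integral do rewrite EFinM -muleA.
rewrite ge0_integralZl //; last 3 first.
- by apply: emeasurable_funM.
- by move=> s' _; rewrite mule_ge0 ?beta_ge0 ?lee_fin ?wt_ge0.
- by rewrite lee_fin mulr_ge0.
rewrite ge0_integralZr //; last by exact: beta_ge0.
by move=> s' _; rewrite lee_fin wt_ge0.
Qed.

End Response.
End SecondDifferences.

(** * Averages of the off-diagonal and of the first-order terms *)

Section InverseMean.
Context (R : realType) (m : probability (measurableTypeR R) R).

(* Jensen for the convex function [1/V], through its tangent line at [c]. *)
Lemma inv_mean_ge (V : R -> R) (c : R) : 0 < c -> measurable_fun setT V ->
  (forall s, 1 <= V s) -> (\int[m]_s (V s)%:E <= c%:E)%E ->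
  ((c^-1)%:E <= \int[m]_s ((V s)^-1)%:E)%E.
Proof.
move=> c0 mV V1 Vc.
have V0 s : 0 < V s by apply: lt_le_trans (V1 s).
have iV : m.-integrable setT (EFin \o V).
  apply/integrableP; split; first exact/measurable_EFinP.
  apply: (@le_lt_trans _ _ c%:E); last by rewrite ltry.
  by under eq_integral do rewrite gee0_abs ?lee_fin ?ltW //.
have mVi : measurable_fun setT (fun s => (V s)^-1) by exact: measurable_funV.
have i1 := finite_measure_integrable_cst m (1 : R) measurableT.
have iVi : m.-integrable setT (EFin \o (fun s => (V s)^-1)).
  apply: (le_integrable measurableT _ _ i1); first exact/measurable_EFinP.
  move=> s _ /=; have Vi : 0 <= (V s)^-1 by rewrite invr_ge0 ltW.
  by rewrite lee_fin normr1 ger0_norm // invf_le1.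
have key : \int[m]_s (2 * c^-1 - c^-1 ^+ 2 * V s) <= \int[m]_s (V s)^-1.
  apply: le_Rintegral => //.
    have i2 := finite_measure_integrable_cst m (2 * c^-1) measurableT.
    exact: (integrableB measurableT i2 (integrableZl measurableT (c^-1 ^+ 2) iV)).
  move=> s _; have : 0 <= (c^-1 - (V s)^-1) ^+ 2 * V s.
    by rewrite mulr_ge0 ?sqr_ge0 ?ltW.
  have -> : (c^-1 - (V s)^-1) ^+ 2 * V s =
      (V s)^-1 - (2 * c^-1 - c^-1 ^+ 2 * V s).
    by field; rewrite !gt_eqF.
  by rewrite subr_ge0.
have E : ((\int[m]_s (V s)^-1)%:E = \int[m]_s ((V s)^-1)%:E)%E.
  by rewrite fineK //; exact: integrable_fin_num.
rewrite -E lee_fin; apply: le_trans key.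
rewrite RintegralB //; last 2 first.
- exact: finite_measure_integrable_cst.
- exact: (integrableZl measurableT (c^-1 ^+ 2) iV).
rewrite Rintegral_cst // [X in _ * fine X]probability_setT mulr1 RintegralZl //.
have Vc' : \int[m]_s V s <= c.
  by rewrite -lee_fin fineK //; exact: integrable_fin_num.
have : c^-1 ^+ 2 * \int[m]_s V s <= c^-1 ^+ 2 * c by rewrite ler_wpM2l ?sqr_ge0.
have -> : c^-1 ^+ 2 * c = c^-1 by rewrite expr2 -mulrA mulVf ?mulr1 ?gt_eqF.
lra.
Qed.

End InverseMean.

Section OffDiagonal.
Context (R : realType) (I : countType).
Context (mu : I -> probability (measurableTypeR R) R).
Context (Q : probability (pspace R I) R).
Hypothesis QE : forall (A : {fset I}) (B : I -> set (measurableTypeR R)),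
  (forall i, measurable (B i)) ->
  Q (cylinder A B) = (\prod_(i <- A) mu i (B i))%E.
Hypothesis mom : forall i, (\int[mu i]_s ((s ^+ 2)%:E) < +oo)%E.
Local Notation X := (pspace R I).
Implicit Types (i j : I) (A : seq I) (f g h : X -> R) (x : X).
Local Notation avg := (avg mu).
Local Notation dif := (dif mu).
Local Notation sqn := (sqn Q).
Local Notation p := (@pos_or_one R).
Context (rho : response R I) (mrho : measurable_response rho).
Local Notation th := (cur rho).
Local Notation res := (fun x : X => nrg rho (posf x)).
Hypothesis qres : quad2 res.
Local Notation xi i j x := (interaction rho (posf x) i j).
Local Notation yc i j x := (coupling rho (posf x) i j).

Definition vv8 (s : R) : R := vv (p s) ^+ 8.

Lemma vv8_ge1 s : 1 <= vv8 s.
Proof.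
apply: exprn_ege1; apply: le_trans (vv_ge2 (pos_or_one_gt0 s)).
by rewrite ler1n.
Qed.

Lemma vv8_gt0 s : 0 < vv8 s.
Proof. by apply: lt_le_trans (vv8_ge1 s). Qed.

Lemma measurable_vv8 : measurable_fun setT vv8.
Proof.
by apply: measurable_funX; apply: measurable_vv; exact: measurable_pos_or_one.
Qed.

Lemma measurable_coupling i j : measurable_fun setT (fun x : X => yc i j x).
Proof.
have [mG mth _] := mrho; apply: measurable_funM.
  apply: measurable_funM; first apply: measurable_funM.
  - exact: measurable_posf_coord.
  - exact: measurable_posf_coord.
  by apply: measurable_funX; exact: mG.
by apply: measurable_funD; apply: measurable_funX; exact: mth.
Qed.

Lemma coupling_ge0 i j x : 0 <= yc i j x.
Proof.
rewrite /coupling mulr_ge0 ?addr_ge0 ?pow4_ge0 // mulr_ge0 ?sqr_ge0 //.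
by rewrite mulr_ge0 // ltW // posf_gt0.
Qed.

Definition wmean i : \bar R := (\int[mu i]_s beta mu i s)%E.

(** The kernel does not depend on the coordinates [i] and [j], so the two weights are integrated out
    one after the other. *)
Lemma sqn_second_difference_le i j : i != j ->
  ((sqn (dif i (dif j res)))%:E <=
   8192%:E * ((\int[Q]_x (xi i j x)%:E) * (wmean i * wmean j)))%E.
Proof.
move=> ij; have qj := quad2_dif QE mom j qres.
rewrite (sqnE QE mom (quad2_dif QE mom i qj)).
have H x := second_difference_le QE mom mrho qres x ij.
have K00 : 0 <= 8192 :> R by rewrite ler0n.
move: H K00; move: (8192 : R) => K0 H K00.
have mxi : measurable_fun setT (fun x : X => (xi i j x)%:E).
  by apply/measurable_EFinP; exact: measurable_xi.
have mb k : measurable_fun setT (fun x : X => beta mu k (x k)).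
  apply: (measurableT_comp (measurable_beta mu k)); exact: measurable_coordR.
have xi0 x : (0 <= (xi i j x)%:E)%E by rewrite lee_fin; exact: xi_ge0.
apply: (@le_trans _ _ (\int[Q]_x (K0%:E * (xi i j x)%:E * beta mu i (x i) * beta mu j (x j)))%E).
  apply: ge0_le_integral.
  - exact: measurableT.
  - by move=> x _; rewrite lee_fin sqr_ge0.
  - apply/measurable_EFinP; apply: measurable_funX.
    by case: (quad2_dif QE mom i qj).
  - apply: emeasurable_funM (mb j); apply: emeasurable_funM (mb i).
    exact: measurable_funeM.
  - by move=> x _; rewrite -muleA -EFinM; exact: H.
rewrite (indep_integral QE (G := fun x => (K0%:E * (xi i j x)%:E * beta mu i (x i))%E)); last 5 first.
- apply: emeasurable_funM (mb i); exact: measurable_funeM.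
- by move=> x; rewrite !mule_ge0 ?beta_ge0.
- by move=> x s; rewrite xi_update_j // update_other.
- exact: measurable_beta.
- exact: beta_ge0.
rewrite (indep_integral QE (G := fun x => (K0%:E * (xi i j x)%:E)%E)); last 5 first.
- exact: measurable_funeM.
- by move=> x; rewrite mule_ge0.
- by move=> x s; rewrite xi_update_i.
- exact: measurable_beta.
- exact: beta_ge0.
rewrite ge0_integralZl //.
by rewrite -/(wmean i) -/(wmean j) !muleA.
Qed.

Context (c : R) (c0 : 0 < c).
Hypothesis vv8_mean : forall i, (\int[mu i]_s (vv8 s)%:E <= c%:E)%E.

(** The coupling depends on [x i] and [x j], so the weights of [interaction_le] cannot be averaged
    beside it. They are moved as inverses to the side of the kernel, which is independent of them,
    and [inv_mean_ge] bounds the mean of each inverse below by [c^-1]. *)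
Lemma interaction_mean_le i j : i != j ->
  (\int[Q]_x (xi i j x)%:E <= (256 * c ^+ 2)%:E * \int[Q]_x (yc i j x)%:E)%E.
Proof.
move=> ij; have mxi : measurable_fun setT (fun x : X => (xi i j x)%:E).
  by apply/measurable_EFinP; exact: measurable_xi.
have xi0 x : (0 <= (xi i j x)%:E)%E by rewrite lee_fin; exact: xi_ge0.
have vi0 s : (0 <= ((vv8 s)^-1)%:E)%E by rewrite lee_fin invr_ge0 ltW // vv8_gt0.
have mvi : measurable_fun setT (fun s : R => ((vv8 s)^-1)%:E).
  by apply/measurable_EFinP; apply: measurable_funV; exact: measurable_vv8.
have mvk k : measurable_fun setT (fun x : X => ((vv8 (x k))^-1)%:E).
  apply: (measurableT_comp mvi); exact: measurable_coordR.
have J k : ((c^-1)%:E <= \int[mu k]_s ((vv8 s)^-1)%:E)%E.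
  exact: inv_mean_ge c0 measurable_vv8 vv8_ge1 (vv8_mean k).
have yc0 x : (0 <= (yc i j x)%:E)%E by rewrite lee_fin coupling_ge0.
have L : ((\int[Q]_x (xi i j x)%:E) * (\int[mu i]_s ((vv8 s)^-1)%:E) *
    (\int[mu j]_s ((vv8 s)^-1)%:E) <= 256%:E * \int[Q]_x (yc i j x)%:E)%E.
  have myc : measurable_fun setT (fun x : X => (yc i j x)%:E).
    by apply/measurable_EFinP; exact: measurable_coupling.
  rewrite -(indep_integral QE mxi xi0 _ mvi vi0); last first.
    by move=> x s; rewrite xi_update_i.
  rewrite -(indep_integral QE (G := fun x => ((xi i j x)%:E * ((vv8 (x i))^-1)%:E)%E) _ _ _ mvi vi0);
    last 3 first.
  - exact: emeasurable_funM.
  - by move=> x; rewrite mule_ge0.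
  - by move=> x s; rewrite xi_update_j // update_other.
  rewrite -ge0_integralZl //.
  apply: ge0_le_integral.
  - exact: measurableT.
  - by move=> x _; rewrite !mule_ge0.
  - by apply: emeasurable_funM (mvk j); exact: emeasurable_funM.
  - exact: measurable_funeM.
  move=> x _; rewrite -!EFinM lee_fin.
  have := interaction_le rho (posf_gt0 x) ij; rewrite -!/(vv8 _).
  rewrite !ler_pdivrMr ?vv8_gt0 // => H; apply: (le_trans H).
  by rewrite le_eqVlt; apply/orP; left; apply/eqP; ring.
have c1 : ((c^-1)%:E * (c^-1)%:E * (c ^+ 2)%:E = 1)%E.
  by rewrite -!EFinM; congr EFin; field; rewrite gt_eqF.
rewrite EFinM [leRHS]muleAC -[leLHS]mule1 -c1 !muleA lee_wpmul2r ?lee_fin ?sqr_ge0 //.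
apply: le_trans L.
have I0 : (0 <= \int[Q]_x (xi i j x)%:E)%E by exact: integral_ge0.
have ci : (0 <= (c^-1)%:E)%E by rewrite lee_fin invr_ge0 ltW.
apply: lee_pmul => //; first exact: mule_ge0.
by apply: lee_pmul.
Qed.

(** Once the resistance of [i] is set to [1], the current is independent of [x i], and the weight of
    [cur_pow4_le] averages to at most [c]. *)
Lemma cur4_mean_le i :
  (\int[Q]_x (th (posf x) i ^+ 4)%:E <=
   c%:E * \int[Q]_x (th (update (posf x) i 1) i ^+ 4)%:E)%E.
Proof.
have [_ mth _] := mrho.
have mT : measurable_fun setT (fun x : X => (th (update (posf x) i 1) i ^+ 4)%:E).
  apply/measurable_EFinP; apply: measurable_funX.
  apply: (eq_measurable_fun (fun x : X => th (posf (update x i 1)) i)).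
    by move=> x _; rewrite posf_update p1.
  apply: (measurableT_comp (mth i)); exact: measurable_update_r.
have T0 x : (0 <= (th (update (posf x) i 1) i ^+ 4)%:E)%E by rewrite lee_fin pow4_ge0.
have mv : measurable_fun setT (fun s : R => (vv8 s)%:E).
  by apply/measurable_EFinP; exact: measurable_vv8.
have v0 s : (0 <= (vv8 s)%:E)%E by rewrite lee_fin ltW // vv8_gt0.
apply: (@le_trans _ _ (\int[Q]_x ((th (update (posf x) i 1) i ^+ 4)%:E * (vv8 (x i))%:E))%E).
  apply: ge0_le_integral.
  - exact: measurableT.
  - by move=> x _; rewrite lee_fin pow4_ge0.
  - by apply/measurable_EFinP; apply: measurable_funX; exact: mth.
  - apply: emeasurable_funM mT _; apply: (measurableT_comp mv).
    exact: measurable_coordR.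
  - move=> x _; rewrite -EFinM lee_fin mulrC.
    exact: (cur_pow4_le rho i (posf_gt0 x)).
rewrite (indep_integral QE mT T0 _ mv v0); last first.
  by move=> x s; rewrite posf_update update_update.
rewrite muleC lee_wpmul2r //; exact: integral_ge0.
Qed.

Lemma phi4_ge0 s s' : 0 <= @phi4 R s s'.
Proof.
rewrite /phi4 mulr_ge0 ?sqr_ge0 // le_min ler01 /= div1r invr_ge0.
by rewrite exprn_ge0 // ltW // pos_or_one_gt0.
Qed.

Lemma measurable_phi4 :
  measurable_fun setT (fun z : measurableTypeR R * measurableTypeR R => phi4 z.1 z.2).
Proof.
have m1 : measurable_fun setT (fun z : measurableTypeR R * measurableTypeR R => p z.1).
  exact: (measurableT_comp (@measurable_pos_or_one R) measurable_fst).
have m2 : measurable_fun setT (fun z : measurableTypeR R * measurableTypeR R => p z.2).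
  exact: (measurableT_comp (@measurable_pos_or_one R) measurable_snd).
apply: measurable_funM.
  apply: measurable_funX; apply: measurable_maxr; first exact: measurable_cst.
  exact: measurable_funB.
apply: measurable_minr; first exact: measurable_cst.
apply: measurable_funM; first exact: measurable_cst.
by apply: measurable_funV; exact: measurable_funX.
Qed.

Lemma measurable_res_section i x :
  measurable_fun setT (fun s : R => res (update x i s)).
Proof. by apply: measurable_section; case: qres. Qed.

(** Twice the variance is the mean squared difference of two independent copies; here for the
    coordinate [i] with the others frozen. *)
Lemma section_variance i x :
  (\int[mu i]_s \int[mu i]_s' (((res (update x i s) - res (update x i s')) ^+ 2)%:E) =
   (2 * avg i (fun y => dif i res y ^+ 2) x)%:E)%E.
Proof.
pose m := avg i res x; pose F (y : X) := res y - m.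
have qF : quad2 F by exact: quad2B qres (quad2_cst I m).
have [mF qF2] := qF.
have F0 : avg i F x = 0.
  rewrite (avgB mom); [|exact: quad2_quad|exact: quad_cst].
  by rewrite (avg_indep mu (g := fun=> m)) // subrr.
pose V := avg i (fun y => F y ^+ 2) x.
have VE : avg i (fun y => dif i res y ^+ 2) x = V.
  by apply: eq_Rintegral => s _; rewrite /dif avg_update.
have E s : (\int[mu i]_s' (((res (update x i s) - res (update x i s')) ^+ 2)%:E) =
    (F (update x i s) ^+ 2)%:E + V%:E)%E.
  set a := F (update x i s).
  have H : avg i (fun y => (a - F y) ^+ 2) x = a ^+ 2 + V.
    have qaF : quad (fun y => (- (2 * a)) * F y) by apply: quadZ; exact: quad2_quad.
    have -> : (fun y => (a - F y) ^+ 2) = (fun y => (F y ^+ 2 + (- (2 * a)) * F y) + a ^+ 2).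
      by apply/funext => y; ring.
    rewrite (avgD mom i x (quadD qF2 qaF) (quad_cst I (a ^+ 2))) (avgD mom i x qF2 qaF).
    rewrite (avg_indepM mom (g := fun=> - (2 * a)) (quad2_quad qF) (fun=> erefl)).
    rewrite (avg_indep mu (g := fun=> a ^+ 2) (fun=> erefl)).
    by rewrite F0 mulr0 addr0 addrC.
  rewrite -EFinD -H (avgE mom); last first.
    by case: (quad2B (quad2_cst I a) qF).
  apply: eq_integral => s' _; congr EFin; congr (_ ^+ 2).
  by rewrite /a /F; ring.
under eq_integral do rewrite E.
have qi := quad_integrable_section mom i x qF2.
rewrite (integralD measurableT qi); last exact: finite_measure_integrable_cst.
rewrite -(avgE mom i x qF2) (integral_cst (mu i) measurableT V%:E).
by rewrite [X in (_ * X)%E]probability_setT mule1 -EFinD VE mulr_natl mulr2n.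
Qed.

(** [nrg_diff_ge] is integrated over two independent copies. Its two terms, one for each order of
    the copies, have the same mean [d], which matches the factor [2] of [section_variance]. *)
Lemma dif_mean_ge i (d : R) :
  (\int[mu i]_s \int[mu i]_s' (phi4 s s')%:E = d%:E)%E ->
  (d%:E * \int[Q]_x (th (update (posf x) i 1) i ^+ 4)%:E <= (sqn (dif i res))%:E)%E.
Proof.
move=> dE; have [_ mth _] := mrho.
have qd := quad2_dif QE mom i qres; have [md qd2] := qd.
have d0 : (0 <= d%:E)%E.
  rewrite -dE; apply: integral_ge0 => s _; apply: integral_ge0 => s' _.
  by rewrite lee_fin phi4_ge0.
have mT : measurable_fun setT (fun x : X => (th (update (posf x) i 1) i ^+ 4)%:E).
  apply/measurable_EFinP; apply: measurable_funX.
  apply: (eq_measurable_fun (fun x : X => th (posf (update x i 1)) i)).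
    by move=> x _; rewrite posf_update p1.
  apply: (measurableT_comp (mth i)); exact: measurable_update_r.
have T0 x : (0 <= (th (update (posf x) i 1) i ^+ 4)%:E)%E by rewrite lee_fin pow4_ge0.
have -> : (sqn (dif i res))%:E = (\int[Q]_x (avg i (fun y => dif i res y ^+ 2) x)%:E)%E.
  have h := resample QE mom i qd2.
  have qa := quad_avg QE mom i qd2.
  rewrite -[RHS]fineK; last first.
    by apply: integrable_fin_num => //; exact: (quad_integrable QE mom qa).
  congr EFin; exact: esym h.
rewrite -ge0_integralZl //.
apply: ge0_le_integral.
- exact: measurableT.
- by move=> x _; rewrite mule_ge0.
- exact: measurable_funeM.
- by apply/measurable_EFinP; exact: (measurable_avg QE).
move=> x _; rewrite -(@lee_pmul2l _ 2%:E) // -[leRHS]EFinM -section_variance.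
set T := th _ i ^+ 4.
have T00 : 0 <= T by rewrite pow4_ge0.
pose Fp (z : measurableTypeR R * measurableTypeR R) : \bar R := (phi4 z.1 z.2)%:E.
pose Fs (z : measurableTypeR R * measurableTypeR R) : \bar R := (phi4 z.2 z.1)%:E.
have mFp : measurable_fun setT Fp by apply/measurable_EFinP; exact: measurable_phi4.
have mFs : measurable_fun setT Fs.
  apply/measurable_EFinP.
  exact: (measurableT_comp measurable_phi4 (@measurable_swap _ _ _ _)).
have Fp0 z : (0 <= Fp z)%E by rewrite lee_fin phi4_ge0.
have Fs0 z : (0 <= Fs z)%E by rewrite lee_fin phi4_ge0.
have dE' : (\int[mu i]_s \int[mu i]_s' Fs (s, s') = d%:E)%E.
  by rewrite (fubini_tonelli Fs mFs Fs0) -dE.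
have sF z : measurable_fun setT (fun s' : measurableTypeR R => Fp (z, s')).
  by apply: (measurableT_comp mFp); exact: pair1_measurable.
have sFs z : measurable_fun setT (fun s' : measurableTypeR R => Fs (z, s')).
  by apply: (measurableT_comp mFs); exact: pair1_measurable.
have -> : (2%:E * (d%:E * T%:E) =
   \int[mu i]_s \int[mu i]_s' (T%:E * (Fp (s, s') + Fs (s, s'))))%E.
  transitivity (\int[mu i]_s (T%:E * (fubini_F (mu i) Fp s + fubini_F (mu i) Fs s)))%E; last first.
    apply: eq_integral => s _; rewrite ge0_integralZl //; last 2 first.
    - exact: emeasurable_funD.
    - by move=> s' _; rewrite adde_ge0.
    by rewrite ge0_integralD.
  have mf1 := measurable_fun_fubini_tonelli_F (m2 := mu i) Fp mFp Fp0.
  have mf2 := measurable_fun_fubini_tonelli_F (m2 := mu i) Fs mFs Fs0.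
  have f10 s : (0 <= fubini_F (mu i) Fp s)%E by exact: integral_ge0.
  have f20 s : (0 <= fubini_F (mu i) Fs s)%E by exact: integral_ge0.
  rewrite ge0_integralZl //; last 2 first.
  - exact: emeasurable_funD.
  - by move=> s _; rewrite adde_ge0.
  rewrite ge0_integralD // /fubini_F dE dE' -EFinD -!EFinM; congr EFin; ring.
pose D (z : measurableTypeR R * measurableTypeR R) : \bar R :=
  ((res (update x i z.1) - res (update x i z.2)) ^+ 2)%:E.
have mD : measurable_fun setT D.
  apply/measurable_EFinP; apply: measurable_funX; apply: measurable_funB.
    exact: (measurableT_comp (measurable_res_section i x) measurable_fst).
  exact: (measurableT_comp (measurable_res_section i x) measurable_snd).
have D0 z : (0 <= D z)%E by rewrite lee_fin sqr_ge0.
pose E (z : measurableTypeR R * measurableTypeR R) : \bar R := (T%:E * (Fp z + Fs z))%E.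
have mE : measurable_fun setT E by apply: measurable_funeM; exact: emeasurable_funD.
have E0 z : (0 <= E z)%E by rewrite mule_ge0 ?adde_ge0 ?Fp0 ?Fs0 ?lee_fin.
apply: ge0_le_integral.
- exact: measurableT.
- by move=> s _; apply: integral_ge0 => s' _; exact: (E0 (s, s')).
- exact: (measurable_fun_fubini_tonelli_F E mE E0).
- exact: (measurable_fun_fubini_tonelli_F D mD D0).
move=> s _; apply: ge0_le_integral.
- exact: measurableT.
- by move=> s' _; exact: (E0 (s, s')).
- by apply: (measurableT_comp mE); exact: pair1_measurable.
- have mDs : measurable_fun setT (fun s' : measurableTypeR R => D (s, s')).
    by apply: (measurableT_comp mD); exact: pair1_measurable.
  exact: mDs.
move=> s' _; rewrite /Fp /Fs /= -EFinD -EFinM lee_fin mulrC !posf_update.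
exact: (nrg_diff_ge rho i (posf_gt0 x) (pos_or_one_gt0 s) (pos_or_one_gt0 s')).
Qed.

End OffDiagonal.

Section ReverseInequality.
Context (R : realType) (I : countType).
Context (mu : I -> probability (measurableTypeR R) R).
Context (Q : probability (pspace R I) R).
Hypothesis QE : forall (A : {fset I}) (B : I -> set (measurableTypeR R)),
  (forall i, measurable (B i)) ->
  Q (cylinder A B) = (\prod_(i <- A) mu i (B i))%E.
Hypothesis mom : forall i, (\int[mu i]_s ((s ^+ 2)%:E) < +oo)%E.
Local Notation X := (pspace R I).
Implicit Types (i j : I) (A : seq I) (f g h : X -> R) (x : X).
Local Notation dif := (dif mu).
Local Notation sqn := (sqn Q).
Context (rho : response R I) (mrho : measurable_response rho).
Local Notation th := (cur rho).
Local Notation res := (fun x : X => nrg rho (posf x)).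
Hypothesis qres : quad2 res.
Context (c : R) (c0 : 0 < c).
Hypothesis vv8_mean : forall i, (\int[mu i]_s (vv8 s)%:E <= c%:E)%E.
Context (w d : I -> R) (B r : R).
Hypotheses (B0 : 0 <= B) (r0 : 0 <= r) (w0 : forall i, 0 <= w i).
Hypotheses (wB : forall i, w i <= B) (wd : forall i, w i <= r * d i).
Hypothesis wE : forall i, wmean mu i = (w i)%:E.
Hypothesis dE : forall i,
  (\int[mu i]_s \int[mu i]_s' (phi4 s s')%:E = (d i)%:E)%E.

(* By independence an off-diagonal term is at most [w i * w j] times the mean of the
   coupling of [i] and [j]; summation over one index spends the projection identity
   [grn_sum], and what is left is a first-order term, that is [sqn (dif i res)]. *)
Lemma off_diagonal_le :
  \sum_(i <- edges rho) \sum_(j <- edges rho | j != i) sqn (dif i (dif j res)) <=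
  8192 * (256 * c ^+ 2) * (2 * (B * r) * c) *
  \sum_(i <- edges rho) sqn (dif i res).
Proof.
have S i j : i != j -> _ := @sqn_second_difference_le _ _ _ _ QE mom _ mrho qres i j.
have M' i j : i != j -> _ := @interaction_mean_le _ _ _ _ QE _ mrho _ c0 vv8_mean i j.
have a10 : 0 <= 8192 :> R by exact: ler0n.
have a20 : 0 <= 256 :> R by exact: ler0n.
(* The numerals are generalized: unary computations would not end. *)
move: a10 a20 S M'; move: (8192 : R) (256 : R) => a1 a2 a10 a20 S M'.
have K0 : 0 <= a1 * (a2 * c ^+ 2) by rewrite mulr_ge0 // mulr_ge0 ?sqr_ge0.
have T1 i j : i != j -> ((sqn (dif i (dif j res)))%:E <=
    (a1 * (a2 * c ^+ 2))%:E *
    \int[Q]_x (w i * w j * coupling rho (posf x) i j)%:E)%E.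
  move=> ij; apply: le_trans (S _ _ ij) _.
  rewrite !wE EFinM -muleA lee_wpmul2l ?lee_fin //.
  have -> : (\int[Q]_x (w i * w j * coupling rho (posf x) i j)%:E =
      (w i * w j)%:E * \int[Q]_x (coupling rho (posf x) i j)%:E)%E.
    rewrite -ge0_integralZl //.
    - by apply/measurable_EFinP; exact: measurable_coupling.
    - by move=> x _; rewrite lee_fin coupling_ge0.
    - by rewrite lee_fin mulr_ge0.
  rewrite [leRHS]muleCA -EFinM [leLHS]muleC lee_wpmul2l ?lee_fin ?mulr_ge0 //.
  exact: M'.
move: K0 T1; move: (a1 * (a2 * c ^+ 2)) => K K0 T1.
have mcp i j : measurable_fun setT
    (fun x : X => (w i * w j * coupling rho (posf x) i j)%:E).
  apply/measurable_EFinP; apply: measurable_funM; first exact: measurable_cst.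
  exact: measurable_coupling.
have cp0 i j x : (0 <= (w i * w j * coupling rho (posf x) i j)%:E)%E.
  by rewrite lee_fin mulr_ge0 ?coupling_ge0 // mulr_ge0.
rewrite -lee_fin EFinM -!sumEFin.
under eq_bigr do rewrite -sumEFin.
apply: (@le_trans _ _ (\sum_(i <- edges rho) \sum_(j <- edges rho)
   K%:E * \int[Q]_x (w i * w j * coupling rho (posf x) i j)%:E)%E).
  apply: lee_sum => i _; rewrite big_mkcond /=; apply: lee_sum => j _.
  case: ifPn => ji; first by apply: T1; rewrite eq_sym.
  by rewrite mule_ge0 ?lee_fin //; apply: integral_ge0.
have -> : (\sum_(i <- edges rho) \sum_(j <- edges rho)
   K%:E * \int[Q]_x (w i * w j * coupling rho (posf x) i j)%:E =
   K%:E * \int[Q]_x (\sum_(i <- edges rho) \sum_(j <- edges rho)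
     w i * w j * coupling rho (posf x) i j)%:E)%E.
  rewrite (eq_integral (fun x => \sum_(i <- edges rho) \sum_(j <- edges rho)
     (w i * w j * coupling rho (posf x) i j)%:E)%E); last first.
    by move=> x _; rewrite -sumEFin; apply: eq_bigr => i _; rewrite -sumEFin.
  rewrite ge0_integral_sum //; last 2 first.
  - by move=> i; apply: emeasurable_sum => j; exact: mcp.
  - by move=> i x _; apply: sume_ge0 => j _; exact: cp0.
  rewrite ge0_sume_distrr; last first.
    by move=> i _; apply: integral_ge0 => x _; apply: sume_ge0 => j _; exact: cp0.
  apply: eq_bigr => i _; rewrite ge0_integral_sum // ge0_sume_distrr //.
  by move=> j _; exact: integral_ge0.
have [_ mth _] := mrho.
have d0 i : 0 <= d i.
  rewrite -lee_fin -dE; apply: integral_ge0 => s _; apply: integral_ge0 => s' _.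
  by rewrite lee_fin phi4_ge0.
have Br0 : 0 <= B * r by rewrite mulr_ge0.
have mth4 i : measurable_fun setT (fun x : X => (th (posf x) i ^+ 4)%:E).
  by apply/measurable_EFinP; apply: measurable_funX; exact: mth.
have th40 i x : (0 <= (th (posf x) i ^+ 4)%:E)%E by rewrite lee_fin pow4_ge0.
have H : (\int[Q]_x (\sum_(i <- edges rho) \sum_(j <- edges rho)
     w i * w j * coupling rho (posf x) i j)%:E <=
  \sum_(i <- edges rho) (2 * (B * r * d i))%:E * \int[Q]_x (th (posf x) i ^+ 4)%:E)%E.
  apply: (@le_trans _ _ (\int[Q]_x \sum_(i <- edges rho)
     ((2 * (B * r * d i))%:E * (th (posf x) i ^+ 4)%:E))%E); last first.
    rewrite ge0_integral_sum //; last 2 first.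
    - by move=> i; exact: measurable_funeM.
    - move=> i x _; apply: mule_ge0; last exact: th40.
      by rewrite lee_fin mulr_ge0 // mulr_ge0.
    apply: lee_sum => i _; rewrite ge0_integralZl // lee_fin.
    by rewrite mulr_ge0 // mulr_ge0.
  apply: ge0_le_integral.
  - exact: measurableT.
  - move=> x _; rewrite lee_fin; apply: sumr_ge0 => i _; apply: sumr_ge0 => j _.
    by rewrite -lee_fin; exact: cp0.
  - apply/measurable_EFinP; apply: measurable_sum => i; apply: measurable_sum => j.
    by apply/measurable_EFinP; exact: mcp.
  - by apply: emeasurable_sum => i; exact: measurable_funeM.
  move=> x _; under [X in (_ <= X)%E]eq_bigr do rewrite -EFinM.
  rewrite sumEFin lee_fin.
  (* In [w i * w j] either factor can be bounded by [B] and the other by [r] times the first-order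
     mean of its own index. *)
  apply: (le_trans (sum_coupling_le rho (d := fun i => B * r * d i)
    (k := fun i j => w i * w j) (posf_gt0 x) _)).
    move=> i j; split; first exact: mulr_ge0.
    split; last by rewrite -mulrA ler_pM.
    by rewrite mulrC -mulrA ler_pM.
  by rewrite mulr_sumr le_eqVlt; apply/orP; left; apply/eqP; apply: eq_bigr => i _; rewrite mulrA.
have M i : ((2 * (B * r * d i))%:E * \int[Q]_x (th (posf x) i ^+ 4)%:E <=
    (2 * (B * r) * c)%:E * (sqn (dif i res))%:E)%E.
  have D := dif_mean_ge QE mom mrho qres (dE i).
  have C4 := cur4_mean_le QE mrho vv8_mean i.
  apply: (@le_trans _ _ ((2 * (B * r * d i))%:E * (c%:E *
     \int[Q]_x (th (update (posf x) i 1) i ^+ 4)%:E)))%E.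
    by rewrite lee_wpmul2l // lee_fin !mulr_ge0.
  have -> : 2 * (B * r * d i) = 2 * (B * r) * d i by ring.
  have E (t u v : R) (T : \bar R) :
      ((t * u)%:E * (v%:E * T) = (t * v)%:E * (u%:E * T))%E.
    by rewrite !muleA -!EFinM mulrAC.
  rewrite E lee_wpmul2l // lee_fin; apply: mulr_ge0 (ltW c0).
  exact: mulr_ge0.
rewrite EFinM -muleA lee_wpmul2l ?lee_fin //; apply: (le_trans H).
rewrite ge0_sume_distrr; last by move=> i _; rewrite lee_fin sqn_ge0.
by apply: lee_sum => i _; exact: M.
Qed.

(** Subtracting a constant changes none of the differences, so [sqn] may be taken around any [a], in
    particular around the mean of the limit. *)
Lemma reverse_bound (a : R) :
  \sum_(i <- edges rho) sqn (dif i res) <=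
  (1 + 8192 * (256 * c ^+ 2) * (2 * (B * r) * c)) * sqn (fun x => res x - a).
Proof.
have qa : quad2 (fun x => res x - a) by exact: quad2B qres (quad2_cst I a).
have E i : dif i (fun x => res x - a) = dif i res.
  apply/funext => x; rewrite /dif (avgB mom) ?(avg_indep mu (g := fun=> a)) //.
  - by ring.
  - exact: quad2_quad.
  - exact: quad_cst.
have K0 : 0 <= 8192 * (256 * c ^+ 2) * (2 * (B * r) * c).
  apply: mulr_ge0; first exact: mulr_ge0 (ler0n _ _) (mulr_ge0 (ler0n _ _) (sqr_ge0 _)).
  by rewrite mulr_ge0 ?(ltW c0) // mulr_ge0 // mulr_ge0.
have S1 : \sum_(i <- edges rho) sqn (dif i (fun x => res x - a)) =
    \sum_(i <- edges rho) sqn (dif i res) by apply: eq_bigr => i _; rewrite E.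
have S2 : \sum_(i <- edges rho) \sum_(j <- edges rho | j != i)
      sqn (dif i (dif j (fun x => res x - a))) =
    \sum_(i <- edges rho) \sum_(j <- edges rho | j != i) sqn (dif i (dif j res)).
  by apply: eq_bigr => i _; apply: eq_bigr => j _; rewrite E.
have := reverse_efron_stein QE mom K0 (edges_uniq rho) qa; rewrite S1 S2.
by apply; exact: off_diagonal_le.
Qed.

End ReverseInequality.

(** * Passage to the limit *)

Lemma le_eps_lin (R : realFieldType) (x y z : R) : 0 <= z ->
  (forall e, 0 < e -> e <= 1 -> x <= y + e * z) -> x <= y.
Proof.
move=> z0 H; rewrite leNgt; apply/negP => yx.
pose e := Num.min 1 ((x - y) / (2 * (z + 1))).
have z1 : 0 < 2 * (z + 1) by rewrite mulr_gt0 // ltr_wpDl.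
have xy : 0 < x - y by rewrite subr_gt0.
have e0 : 0 < e by rewrite lt_min ltr01 divr_gt0.
have := H e e0; rewrite ge_min lexx => /(_ isT) Hx.
have : e * (2 * (z + 1)) <= x - y by rewrite -ler_pdivlMr // ge_min lexx orbT.
have : e * z <= e * (z + 1) by rewrite ler_pM2l // lerDl ler01.
lra.
Qed.

Section Limit.
Context (R : realType) (I : countType).
Context (mu : I -> probability (measurableTypeR R) R).
Context (Q : probability (pspace R I) R).
Hypothesis QE : forall (A : {fset I}) (B : I -> set (measurableTypeR R)),
  (forall i, measurable (B i)) ->
  Q (cylinder A B) = (\prod_(i <- A) mu i (B i))%E.
Hypothesis mom : forall i, (\int[mu i]_s ((s ^+ 2)%:E) < +oo)%E.
Local Notation X := (pspace R I).
Implicit Types (i j : I) (A : seq I) (x : X).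
Local Notation dif := (dif mu).
Local Notation sqn := (sqn Q).
Context (f : X -> R) (u : nat -> X -> R) (E : nat -> seq I).
Hypotheses (qf : quad2 f) (mu_ : forall n, measurable_fun setT (u n)).
Hypotheses (u0 : forall n x, 0 <= u n x) (uf : forall n x, u n x <= f x).
Hypothesis ucvg : forall x, u n x @[n --> \oo] --> f x.
Hypothesis udep : forall n, depends_on (E n) (u n).
Hypothesis Euniq : forall n, uniq (E n).
Hypothesis Ecover : forall i, exists n0, forall n, (n0 <= n)%N -> i \in E n.

Lemma quad2_u n : quad2 (u n).
Proof.
have [mf q2] := qf; split => //.
apply: (quad_le _ q2); first exact: measurable_funX.
by move=> x; rewrite ger0_norm ?sqr_ge0 // lerXn2r // nnegrE // (le_trans (u0 n x)).
Qed.

(** Dominated convergence, with [f ^+ 2] as the dominating function since [0 <= u n <= f]. *)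
Lemma sqn_cvg (e : R) : 0 < e ->
  exists n0, forall n, (n0 <= n)%N -> sqn (fun x => f x - u n x) < e.
Proof.
move=> e0; pose g n x : \bar R := ((f x - u n x) ^+ 2)%:E.
have qd n : quad2 (fun x => f x - u n x) by exact: quad2B qf (quad2_u n).
have f0 x : 0 <= f x by exact: le_trans (u0 0 x) (uf 0 x).
have mg n : measurable_fun setT (g n).
  by apply/measurable_EFinP; apply: measurable_funX; case: (qd n).
have if2 : Q.-integrable setT (fun x => (f x ^+ 2)%:E).
  by have [_ q2] := qf; exact: (quad_integrable QE mom q2).
have gcvg : {ae Q, forall x, setT x -> g n x @[n --> \oo] --> (cst 0%E : X -> \bar R) x}.
  apply/aeW => x _ /=; apply: cvg_EFin; first by near=> n.
  have : (f x - u n x) * (f x - u n x) @[n --> \oo] --> (f x - f x) * (f x - f x).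
    by apply: cvgM; apply: cvgB; [exact: cvg_cst|exact: ucvg|exact: cvg_cst|exact: ucvg].
  by rewrite subrr mulr0.
have gle : {ae Q, forall x n, setT x -> (`|g n x| <= (f x ^+ 2)%:E)%E}.
  apply/aeW => x n _; rewrite gee0_abs ?lee_fin ?sqr_ge0 //.
  rewrite lerXn2r ?nnegrE ?subr_ge0 ?f0 ?uf //.
  by rewrite lerBlDr lerDl.
have [_ _ H] := dominated_convergence (measurableT) mg (measurable_cst 0%E) gcvg if2 gle.
move: H; rewrite integral0 => H.
have /fine_cvgP[_] : (\int[Q]_x g n x)%E @[n --> \oo] --> 0%:E by exact: H.
move=> /cvgrPdist_lt /(_ e e0)[n0 _ Hn]; exists n0 => n nn0.
have := Hn n nn0; rewrite /= sub0r normrN ger0_norm; last first.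
  by apply: fine_ge0; apply: integral_ge0 => x _; rewrite lee_fin sqr_ge0.
by rewrite -[X in X < _ -> _]/(sqn _).
Unshelve. all: by end_near. Qed.

Lemma sqn_center (a : R) : sqn (fun x => f x - \int[Q]_x f x) <= sqn (fun x => f x - a).
Proof.
set m := \int[Q]_x f x.
have q1 : quad2 (fun x => f x - m) by exact: quad2B qf (quad2_cst I m).
have q2 := quad2_cst I (m - a).
have -> : (fun x => f x - a) = (fun x => (f x - m) + (m - a)).
  by apply/funext => x; ring.
rewrite (sqnD QE mom q1 q2).
have -> : ip Q (fun x => f x - m) (fun=> m - a) = 0.
  rewrite /ip RintegralZr //; last first.
    exact: (quad_integrable QE mom (quad2_quad q1)).
  rewrite RintegralB //; last 2 first.
  - exact: (quad_integrable QE mom (quad2_quad qf)).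
  - exact: finite_measure_integrable_cst.
  by rewrite Rintegral_cst // [X in _ * fine X]probability_setT mulr1 subrr mul0r.
by rewrite mulr0 addr0 lerDl sqn_ge0.
Qed.

(** [u n] depends on finitely many coordinates and serves as the approximation of [f]; [n] is chosen
    after [e], so that the factor [1 + e^-1] is beaten by the convergence. *)
Lemma variance_le (S : R) :
  (forall A, uniq A -> \sum_(i <- A) sqn (dif i f) <= S) ->
  sqn (fun x => f x - \int[Q]_x f x) <= S.
Proof.
move=> HS; have S0 : 0 <= S by have := HS [::] isT; rewrite big_nil.
apply: (@le_eps_lin _ _ _ (S + 1)); first by rewrite addr_ge0.
move=> e e0 e1; have ei : 0 < 1 + e^-1 by rewrite addr_gt0 // invr_gt0.
have [n0 Hn] := sqn_cvg (divr_gt0 e0 ei).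
have [c Hc] := efron_stein_approx QE mom e0 qf (quad2_u n0) (@udep n0).
apply: (le_trans (sqn_center c)); apply: (le_trans Hc).
have H1 := HS _ (Euniq n0).
have H2 : (1 + e^-1) * sqn (fun x => f x - u n0 x) <= e.
  by rewrite -ler_pdivlMl // mulrC ltW // Hn.
have : (1 + e) * \sum_(i <- E n0) sqn (dif i f) <= (1 + e) * S.
  by rewrite ler_wpM2l // addr_ge0 // ltW.
lra.
Qed.

Lemma E_large A : exists n0, forall n, (n0 <= n)%N -> {subset A <= E n}.
Proof.
elim: A => [|i A [n1 H1]]; first by exists 0.
have [n2 H2] := Ecover i; exists (maxn n1 n2) => n; rewrite geq_max => /andP[h1 h2] k.
by rewrite inE => /predU1P[->|kA]; [exact: H2|exact: H1].
Qed.

(** The list [A] is fixed and eventually contained in [E n]. Replacing [f] by [u n] costs a factor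
    [1 + e] and a term [e], once for each index of [A] and once in the variance. *)
Lemma reverse_limit (K a : R) : 0 <= K ->
  (forall n, \sum_(i <- E n) sqn (dif i (u n)) <= K * sqn (fun x => u n x - a)) ->
  forall A, uniq A -> \sum_(i <- A) sqn (dif i f) <= K * sqn (fun x => f x - a).
Proof.
move=> K0 HK A uA; set V := sqn (fun x => f x - a).
have V0 : 0 <= V by exact: sqn_ge0.
(* For [e <= 1] one has [(1 + e) ^+ 2 <= 1 + 3 * e] and [(1 + e) * e <= 2 * e]; the size of [A]
   counts the errors of the single indices. *)
apply: (@le_eps_lin _ _ _ (K * (3 * V + 2) + (size A)%:R)).
  by rewrite addr_ge0 // mulr_ge0 // addr_ge0 // mulr_ge0.
move=> e e0 e1; have ei : 0 < 1 + e^-1 by rewrite addr_gt0 // invr_gt0.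
have [n1 Hn1] := sqn_cvg (divr_gt0 e0 ei); have [n2 Hn2] := E_large A.
pose n := maxn n1 n2.
have qd : quad2 (fun x => f x - u n x) by exact: quad2B qf (quad2_u n).
have H2 : (1 + e^-1) * sqn (fun x => f x - u n x) <= e.
  by rewrite -ler_pdivlMl // mulrC ltW // Hn1 // leq_maxl.
have D i : sqn (dif i f) <= (1 + e) * sqn (dif i (u n)) + e.
  have -> : dif i f = (fun x => dif i (u n) x + dif i (fun y => f y - u n y) x).
    apply/funext => x; rewrite /dif (avgB mom); [|exact: quad2_quad qf|exact: quad2_quad (quad2_u n)].
    by ring.
  apply: (le_trans (sqnD_le QE mom e0 (quad2_dif QE mom i (quad2_u n)) (quad2_dif QE mom i qd))).
  rewrite lerD2l (le_trans _ H2) // ler_wpM2l ?(ltW ei) //.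
  exact: (sqn_dif_le QE mom).
have F : sqn (fun x => u n x - a) <= (1 + e) * V + e.
  have -> : (fun x => u n x - a) = (fun x => (f x - a) + (-1) * (f x - u n x)).
    by apply/funext => x; ring.
  have qa : quad2 (fun x => f x - a) by exact: quad2B qf (quad2_cst I a).
  apply: (le_trans (sqnD_le QE mom e0 qa (quad2Z (-1) qd))).
  rewrite lerD2l (le_trans _ H2) // le_eqVlt; apply/orP; left; apply/eqP.
  by congr (_ * _); apply: eq_Rintegral => x _; ring.
have G : \sum_(i <- A) sqn (dif i (u n)) <= \sum_(i <- E n) sqn (dif i (u n)).
  apply: sum_subset => //; first by apply: Hn2; rewrite leq_maxr.
  by move=> i; exact: sqn_ge0.
apply: (@le_trans _ _ (\sum_(i <- A) ((1 + e) * sqn (dif i (u n)) + e))).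
  by apply: ler_sum => i _; exact: D.
rewrite big_split /= -mulr_sumr big_const_seq count_predT iter_addr_0 -[e *+ _]mulr_natr.
have G2 : (1 + e) * \sum_(i <- A) sqn (dif i (u n)) <= (1 + e) * (K * ((1 + e) * V + e)).
  rewrite ler_wpM2l ?addr_ge0 ?(ltW e0) //.
  by apply: (le_trans G); apply: (le_trans (HK n)); rewrite ler_wpM2l.
apply: (le_trans (lerD G2 (lexx _))).
have eV : 0 <= (1 - e) * e * (K * V) by rewrite !mulr_ge0 ?subr_ge0 // ltW.
have eK : 0 <= (1 - e) * e * K by rewrite !mulr_ge0 ?subr_ge0 // ltW.
have : 0 <= (1 - e) * e * (K * V) + (1 - e) * e * K by rewrite addr_ge0.
rewrite -subr_ge0 => H; rewrite -subr_ge0; move: H; congr (_ <= _); ring.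
Qed.

End Limit.

(** * Flows on the graph *)

Section EsumSeq.
Context (R : realType) (T : choiceType) (a : T -> \bar R).

Lemma sum_le_esum (s : seq T) : uniq s ->
  (\sum_(t <- s) a t <= \esum_(t in [set: T]) a t)%E.
Proof.
move=> us; apply: esum_ge; exists [set` s].
  by split=> //; exact: finite_seq.
by rewrite fsbig_seq.
Qed.

Lemma esum_le (l : \bar R) :
  (forall s, uniq s -> \sum_(t <- s) a t <= l)%E ->
  (\esum_(t in [set: T]) a t <= l)%E.
Proof.
move=> H; apply: ge_ereal_sup => _ [F [finF _] <-].
by rewrite fsbig_finite //; apply: H; exact: fset_uniq.
Qed.

End EsumSeq.

Section GraphFlows.
Context (R : realType) (G : graph) (half : pred (edge G)).
Hypothesis orient : is_orientation half.
Local Notation I := (half_edge half).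
Local Notation head := (@Defs.head G).
Local Notation tail := (@Defs.tail G).
Implicit Types (x y u v : G) (e : edge G) (i : I) (f : I -> R) (theta : edge G -> R).

Lemma rev_edgeK : involutive (@rev_edge G).
Proof. by move=> [[a b] h]; exact: val_inj. Qed.

Lemma tail_rev e : tail (rev_edge e) = head e. Proof. by []. Qed.
Lemma head_rev e : head (rev_edge e) = tail e. Proof. by []. Qed.

(** The antisymmetric extension that [ell2_minus] requires. *)
Definition extend f e : R :=
  match insub e : option I, insub (rev_edge e) : option I with
  | Some i, _ => f i
  | None, Some i => - f i
  | None, None => 0
  end.

Lemma extend_val f i : extend f (val i) = f i.
Proof. by rewrite /extend valK. Qed.

Lemma extend_in f e (he : half e) : extend f e = f (Sub e he).
Proof. by rewrite /extend insubT. Qed.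

Lemma extend_out f e (he : half (rev_edge e)) :
  extend f e = - f (Sub (rev_edge e) he).
Proof.
have hn : ~~ half e by rewrite -orient.
by rewrite /extend insubN //= insubT.
Qed.

Lemma extend_rev f e : extend f (rev_edge e) = - extend f e.
Proof.
have [he|he] := boolP (half e).
  have hr : half (rev_edge (rev_edge e)) by rewrite rev_edgeK.
  rewrite (extend_in _ he) (extend_out _ hr); congr (- f _).
  by apply: val_inj; rewrite !SubK rev_edgeK.
have hr : half (rev_edge e) by rewrite orient.
by rewrite (extend_in _ hr) (extend_out _ hr) opprK.
Qed.

Lemma finite_tail x : finite_set [set e : edge G | tail e = x].
Proof.
have [[e0 he0]|none] := pselect (exists e : edge G, tail e = x); last first.
  apply: (sub_finite_set _ (finite_set0 _)) => e /= ex; apply: none; by exists e.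
apply: (sub_finite_set _ (finite_image
  (fun y => odflt e0 (insub (x, y) : option (edge G))) (adj_locally_finite x))) => e /= ex.
have exy : (x, head e) = val e by rewrite -ex /Defs.tail /Defs.head; case: (val e).
exists (head e); first by rewrite -ex; exact: (valP e).
by rewrite exy valK.
Qed.

Lemma finite_incident x :
  finite_set [set i : I | tail (val i) = x \/ head (val i) = x].
Proof.
have H : finite_set ([set e : edge G | tail e = x] `|`
    (@rev_edge G) @` [set e : edge G | tail e = x]).
  by rewrite finite_setU; split; [exact: finite_tail|apply: finite_image; exact: finite_tail].
have vi : {in (val : I -> edge G) @^-1` ([set e : edge G | tail e = x] `|`
    (@rev_edge G) @` [set e : edge G | tail e = x]) &, injective (val : I -> edge G)}.
  by move=> i j _ _; exact: val_inj.
apply: (sub_finite_set _ (finite_preimage vi H)) => i /= [ix|ix]; [by left|right].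
by exists (rev_edge (val i)); rewrite ?rev_edgeK.
Qed.

Definition incident x : seq I := fset_set [set i : I | tail (val i) = x \/ head (val i) = x].

Definition incidence x i : R := (tail (val i) == x)%:R - (head (val i) == x)%:R.

Lemma incident_uniq x : uniq (incident x).
Proof. exact: fset_uniq. Qed.

Lemma mem_incident x i :
  (i \in incident x) = (tail (val i) == x) || (head (val i) == x).
Proof.
rewrite in_fset_set; last exact: finite_incident.
by apply/idP/orP; rewrite inE /= => -[/eqP|/eqP]; by [left|right].
Qed.

Lemma incidence_out x i : i \notin incident x -> incidence x i = 0.
Proof.
by rewrite mem_incident negb_or /incidence => /andP[/negbTE -> /negbTE ->]; rewrite subrr.
Qed.

Local Notation divg := (divg incident incidence).

(** An edge leaving [x] is either an oriented one with tail [x] or the reversal of an oriented one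
    with head [x]; antisymmetry gives the latter its sign. *)
Lemma dstarE theta x : (forall e, theta (rev_edge e) = - theta e) ->
  dstar theta x = divg (fun i => theta (val i)) x.
Proof.
move=> ath; rewrite /dstar fsbig_finite; last exact: finite_tail.
set s : seq (edge G) := fset_set _.
have us : uniq s by exact: fset_uniq.
have ms e : (e \in s) = (tail e == x).
  rewrite in_fset_set; last exact: finite_tail.
  by apply/idP/eqP; rewrite inE.
rewrite (bigID half) /= /divg.
have -> : \sum_(i <- incident x) incidence x i * theta (val i) =
    \sum_(i <- incident x | tail (val i) == x) theta (val i) +
    \sum_(i <- incident x | head (val i) == x) theta (rev_edge (val i)).
  rewrite [X in _ = X + _]big_mkcond [X in _ = _ + X]big_mkcond -big_split /=.
  apply: eq_bigr => i _; rewrite /incidence ath.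
  by case: eqP => _; case: eqP => _ /=; ring.
congr (_ + _).
- rewrite -[LHS]big_filter -[RHS]big_filter -(big_map val xpredT theta).
  apply: perm_big; apply: uniq_perm.
  + by rewrite filter_uniq.
  + by rewrite map_inj_uniq ?filter_uniq ?incident_uniq //; exact: val_inj.
  move=> e; rewrite mem_filter ms; apply/andP/mapP => [[he ex]|[i]].
    exists (Sub e he : I); last by rewrite SubK.
    by rewrite mem_filter mem_incident SubK ex.
  rewrite mem_filter => /andP[ix _] ->; split=> //; exact: (valP i).
- rewrite -[LHS]big_filter -[RHS]big_filter.
  rewrite -(big_map (fun i : I => rev_edge (val i)) xpredT theta).
  apply: perm_big; apply: uniq_perm.
  + by rewrite filter_uniq.
  + rewrite map_inj_uniq ?filter_uniq ?incident_uniq //.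
    by move=> i j /(can_inj rev_edgeK); exact: val_inj.
  move=> e; rewrite mem_filter ms; apply/andP/mapP => [[he ex]|[i]].
    have hr : half (rev_edge e) by rewrite orient.
    exists (Sub (rev_edge e) hr : I); last by rewrite SubK rev_edgeK.
    by rewrite mem_filter mem_incident SubK head_rev ex orbT.
  rewrite mem_filter => /andP[ix _] ->; rewrite orient tail_rev negbK; split=> //.
  exact: (valP i).
Qed.

Lemma divgD f g x : divg (fun i => f i + g i) x = divg f x + divg g x.
Proof. by rewrite /divg -big_split /=; apply: eq_bigr => i _; rewrite mulrDr. Qed.

Lemma divgN f x : divg (fun i => - f i) x = - divg f x.
Proof. by rewrite /divg -sumrN; apply: eq_bigr => i _; rewrite mulrN. Qed.

Lemma divg_delta i0 x : divg (fun i => (i == i0)%:R) x = incidence x i0.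
Proof.
rewrite /divg; have [ix|ix] := boolP (i0 \in incident x); last first.
  rewrite (incidence_out ix) big_seq big1 // => i iin.
  by case: eqP => [e|_]; rewrite ?mulr0 //; move: ix; rewrite -e iin.
rewrite (bigD1_seq i0) ?incident_uniq //= eqxx mulr1 big1 ?addr0 // => i /negbTE ->.
by rewrite mulr0.
Qed.

(** Superposition of the unit flows along the steps of the path; an edge met several times just adds
    up. *)
Lemma path_flow x (p : seq G) : path (@adj G) x p ->
  exists f (A : seq I), (forall i, i \notin A -> f i = 0) /\
    forall y, divg f y = (x == y)%:R - (last x p == y)%:R.
Proof.
elim: p x => [x _|z p IH x /= /andP[xz /IH[f [A [fA fd]]]]].
  exists (fun=> 0), [::]; split=> // y; rewrite subrr /divg big1 // => i _.
  by rewrite mulr0.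
pose e : edge G := exist (fun e : G * G => adj e.1 e.2) (x, z) xz.
have [i [sg [sgE]]] : exists i sg, (sg = 1 \/ sg = -1) /\
    forall y, divg (fun k => sg * (k == i)%:R) y = (x == y)%:R - (z == y)%:R :> R.
  have [he|he] := boolP (half e).
    exists (Sub e he : I), 1; split=> [|y]; first by left.
    under [X in divg X]eq_fun do rewrite mul1r.
    by rewrite divg_delta /incidence SubK.
  have hr : half (rev_edge e) by rewrite orient.
  exists (Sub (rev_edge e) hr : I), (-1); split=> [|y]; first by right.
  under [X in divg X]eq_fun do rewrite mulN1r.
  by rewrite divgN divg_delta /incidence SubK /= opprB.
move=> id; exists (fun k => sg * (k == i)%:R + f k), (i :: A); split=> [k|y].
  rewrite inE negb_or => /andP[/negbTE -> kA]; rewrite mulr0 add0r; exact: fA.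
by rewrite divgD id fd addrA subrK.
Qed.

Variables (u v : G).

Lemma unit_flow_exists : exists f (A : seq I),
  (forall i, i \notin A -> f i = 0) /\
  forall y, divg f y = (y == u)%:R - (y == v)%:R.
Proof.
have [p [up pv]] := adj_connected u v; have [f [A [fA fd]]] := path_flow up.
by exists f, A; split=> // y; rewrite fd pv !(eq_sym y).
Qed.

(** Every unit flow is admissible in each finite network, so the energies stay below the infimum;
    conversely the flow of [nets_limit] extends to a unit flow whose energy is at most their limit.
    The finitely supported [phi] provides the uniform bound that [nets_limit] needs. *)
Lemma resistance_limit (phi : I -> R) (A : seq I) (r : I -> R) : uniq A ->
  (forall i, i \notin A -> phi i = 0) ->
  (forall y, divg phi y = (y == u)%:R - (y == v)%:R) ->
  (forall i, 0 < r i) ->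
  [/\ nrg (net incident incidence phi n) r @[n --> \oo] --> resistance u v r,
    forall n, nrg (net incident incidence phi n) r <= resistance u v r &
    resistance u v r <= \sum_(i <- A) r i * phi i ^+ 2].
Proof.
move=> uA phiA phid r0; set B := \sum_(i <- A) r i * phi i ^+ 2.
have t0 (f : I -> R) i : 0 <= r i * f i ^+ 2 by rewrite mulr_ge0 ?sqr_ge0 // ltW.
have sB (s : seq I) : uniq s -> \sum_(i <- s) r i * phi i ^+ 2 <= B.
  move=> us; rewrite (bigID (mem A)) /= [X in _ + X]big1 ?addr0; last first.
    by move=> i /phiA ->; rewrite expr0n mulr0.
  rewrite -big_filter; apply: sum_subset => //; first exact: filter_uniq.
  by move=> i; rewrite mem_filter => /andP[].
have nB n : nrg (net incident incidence phi n) r <= B.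
  apply: le_trans (sB _ (net_edges_uniq incident n)).
  exact: (nrg_le_flow incident_uniq incidence_out r0).
have [l [f [lcvg fd l0 fl]]] := nets_limit incident_uniq incidence_out r0 nB.
have nl theta : unit_flow r u v theta -> forall n,
    ((nrg (net incident incidence phi n) r)%:E <= energy r theta)%E.
  move=> [[ath _] dth] n.
  apply: (le_trans _ (sum_le_esum (fun i : I => (r i * theta (val i) ^+ 2)%:E)
    (net_edges_uniq incident n))).
  rewrite sumEFin lee_fin.
  apply: (nrg_le_flow incident_uniq incidence_out (f := fun i => theta (val i)) r0).
  by move=> y _; rewrite -dstarE // dth phid.
have fE : unit_flow r u v (extend f).
  split; first split.
  - exact: extend_rev.
  - apply: (@le_lt_trans _ _ l%:E); last by rewrite ltry.
    apply: esum_le => s us; rewrite sumEFin lee_fin.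
    by under eq_bigr do rewrite extend_val; exact: fl.
  - move=> y; rewrite dstarE; last exact: extend_rev.
    by rewrite -phid -fd; apply: eq_bigr => i _; rewrite extend_val.
have inf : ereal_inf [set energy r theta | theta in unit_flow r u v] = l%:E.
  apply/eqP; rewrite eq_le; apply/andP; split.
    apply: ereal_inf_le; exists (energy r (extend f)); first by exists (extend f).
    apply: esum_le => s us; rewrite sumEFin lee_fin.
    by under eq_bigr do rewrite extend_val; exact: fl.
  apply: le_ereal_inf_tmp => _ [theta th <-].
  have := nl theta th; case: (energy r theta) => [z| |] H.
  - rewrite lee_fin; apply: (cvgr_to_le lcvg); near=> n.
    by rewrite -lee_fin.
  - exact: leey.
  - by have := H 0.
have rl : resistance u v r = l by rewrite /resistance inf.
rewrite rl; split => //.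
- move=> n; rewrite -lee_fin -inf; apply: le_ereal_inf_tmp => _ [theta th <-].
  exact: nl.
- by apply: (cvgr_to_le lcvg); near=> n.
Unshelve. all: by end_near. Qed.

End GraphFlows.

(** * Moments of laws on the positive half-line *)

Section PositiveLaw.
Context (R : realType) (m : probability (measurableTypeR R) R).
Hypothesis m0 : carried_by_pos m.
Local Notation p := (@pos_or_one R).
Local Notation pos := ([set` `]0%R, +oo[] : set (measurableTypeR R)).

Lemma measurable_pos : measurable (pos : set (measurableTypeR R)).
Proof. exact: measurable_itv. Qed.

Lemma pos_gt0 (s : R) : pos s -> 0 < s.
Proof. by rewrite /= in_itv /= andbT. Qed.

Lemma null_nonpos : m (~` pos) = 0%E.
Proof.
by rewrite probability_setC ?m0 ?subee //; exact: measurable_pos.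
Qed.

Lemma integral_pos (g : R -> \bar R) : measurable_fun setT g ->
  (forall s, (0 <= g s)%E) ->
  (\int[m]_(s in pos) g s = \int[m]_s g s)%E.
Proof.
move=> mg g0; rewrite [RHS](ge0_negligible_integral (N := ~` pos)) //.
- by rewrite setTD setCK.
- by apply: measurableC; exact: measurable_pos.
- exact: null_nonpos.
Qed.

Lemma expect_lawE (g : R -> R) : measurable_fun setT (fun s => g (p s)) ->
  (forall s, 0 < s -> 0 <= g s) ->
  (expect_law m g = \int[m]_s (g (p s))%:E)%E.
Proof.
move=> mg g0; rewrite -integral_pos.
- by apply: eq_integral => s /set_mem /pos_gt0 /pos_or_one_id ->.
- exact/measurable_EFinP.
- by move=> s; rewrite lee_fin g0 // pos_or_one_gt0.
Qed.

Lemma expect_law2E (g : R -> R -> R) :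
  measurable_fun setT (fun z : measurableTypeR R * measurableTypeR R =>
    g (p z.1) (p z.2)) ->
  (forall s s', 0 < s -> 0 < s' -> 0 <= g s s') ->
  (expect_law2 m g = \int[m]_s \int[m]_s' (g (p s) (p s'))%:E)%E.
Proof.
move=> mg g0.
pose F (z : measurableTypeR R * measurableTypeR R) : \bar R :=
  (g (p z.1) (p z.2))%:E.
have mF : measurable_fun setT F by exact/measurable_EFinP.
have F0 z : (0 <= F z)%E by rewrite lee_fin g0 // pos_or_one_gt0.
have mP : measurable (pos `*` pos : set (measurableTypeR R * measurableTypeR R)).
  by apply: measurableX; exact: measurable_pos.
rewrite -[RHS](fubini_tonelli1 F mF F0) /expect_law2.
transitivity (\int[(m \x m)%E]_(z in pos `*` pos) F z)%E.
  apply: eq_integral => z /set_mem[/pos_gt0/pos_or_one_id z1 /pos_gt0/pos_or_one_id z2].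
  by rewrite /F z1 z2.
rewrite [RHS](ge0_negligible_integral (N := ~` (pos `*` pos))) //.
- by rewrite setTD setCK.
- exact: measurableC.
- have E : (m \x m)%E (pos `*` pos) = 1%E.
    transitivity (m pos * m pos)%E.
      by apply: product_measure1E; exact: measurable_pos.
    by rewrite m0 mule1.
  pose mm : probability (measurableTypeR R * measurableTypeR R)%type R := (m \x m)%E.
  rewrite -[LHS]/(mm (~` (pos `*` pos))) probability_setC //.
  by rewrite -[mm _]/((m \x m)%E (pos `*` pos)) E subee.
Qed.

(** A nonnegative function of null integral vanishes almost everywhere for the product law, and this
    passes from [a] to [b]. It serves for deterministic resistances. *)
Lemma iterated_integral0 (a b : R -> R -> R) :
  measurable_fun setT (fun z : measurableTypeR R * measurableTypeR R => a z.1 z.2) ->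
  measurable_fun setT (fun z : measurableTypeR R * measurableTypeR R => b z.1 z.2) ->
  (forall s s', 0 <= a s s') -> (forall s s', 0 <= b s s') ->
  (forall s s', a s s' = 0 -> b s s' = 0) ->
  (\int[m]_s \int[m]_s' (a s s')%:E = 0)%E ->
  (\int[m]_s \int[m]_s' (b s s')%:E = 0)%E.
Proof.
move=> ma mb a0 b0 ab.
pose A (z : measurableTypeR R * measurableTypeR R) : \bar R := (a z.1 z.2)%:E.
pose B (z : measurableTypeR R * measurableTypeR R) : \bar R := (b z.1 z.2)%:E.
have mA : measurable_fun setT A by exact/measurable_EFinP.
have mB : measurable_fun setT B by exact/measurable_EFinP.
rewrite -[X in X = _ -> _](fubini_tonelli1 A mA); last by move=> z; rewrite lee_fin.
rewrite -[X in _ -> X = _](fubini_tonelli1 B mB); last by move=> z; rewrite lee_fin.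
have absA : (\int[(m \x m)%E]_z A z = \int[(m \x m)%E]_z `|A z|)%E.
  by apply: eq_integral => z _; rewrite gee0_abs // lee_fin.
have absB : (\int[(m \x m)%E]_z B z = \int[(m \x m)%E]_z `|B z|)%E.
  by apply: eq_integral => z _; rewrite gee0_abs // lee_fin.
rewrite absA absB => /(ae_eq_integral_abs _ measurableT mA) H.
apply/(ae_eq_integral_abs _ measurableT mB); apply: filterS H => z /= H _.
by have /eqP := H I; rewrite eqe => /eqP /ab; rewrite /B => ->.
Qed.

Definition moment8 (s : R) : R := p s ^+ 8 + p s ^- 8.

Definition spread (s s' : R) : R :=
  (p s - p s') ^+ 2 * (1 / p s ^+ 6 + p s ^+ 6).

Lemma measurable_p_pow k : measurable_fun setT (fun s : R => p s ^+ k).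
Proof. by apply: measurable_funX; exact: measurable_pos_or_one. Qed.

Lemma measurable_p_powN k : measurable_fun setT (fun s : R => p s ^- k).
Proof. by apply: measurable_funV; exact: measurable_p_pow. Qed.

Lemma measurable_spread :
  measurable_fun setT (fun z : measurableTypeR R * measurableTypeR R => spread z.1 z.2).
Proof.
have m1 : measurable_fun setT (fun z : measurableTypeR R * measurableTypeR R => p z.1).
  exact: (measurableT_comp (@measurable_pos_or_one R) measurable_fst).
have m2 : measurable_fun setT (fun z : measurableTypeR R * measurableTypeR R => p z.2).
  exact: (measurableT_comp (@measurable_pos_or_one R) measurable_snd).
apply: measurable_funM; first by apply: measurable_funX; exact: measurable_funB.
apply: measurable_funD; last exact: measurable_funX.
under eq_fun do rewrite div1r; apply: measurable_funV; exact: measurable_funX.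
Qed.

Lemma spread_ge0 s s' : 0 <= spread s s'.
Proof.
have q := exprn_ge0 6 (ltW (pos_or_one_gt0 s)).
by rewrite mulr_ge0 ?sqr_ge0 // addr_ge0 // div1r invr_ge0.
Qed.

Lemma moment8E :
  (expect_law m (fun s => s ^+ 8)%R + expect_law m (fun s => s ^- 8)%R =
   \int[m]_s (moment8 s)%:E)%E.
Proof.
rewrite !expect_lawE.
- rewrite -ge0_integralD //.
  + by move=> s _; rewrite lee_fin exprn_ge0 // ltW // pos_or_one_gt0.
  + by apply/measurable_EFinP; exact: measurable_p_pow.
  + by move=> s _; rewrite lee_fin invr_ge0 exprn_ge0 // ltW // pos_or_one_gt0.
  + by apply/measurable_EFinP; exact: measurable_p_powN.
- exact: measurable_p_powN.
- by move=> s s0; rewrite invr_ge0 exprn_ge0 // ltW.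
- exact: measurable_p_pow.
- by move=> s s0; rewrite exprn_ge0 // ltW.
Qed.

Lemma spreadE :
  (expect_law2 m (fun s s' => (s - s') ^+ 2 * (1 / s ^+ 6 + s ^+ 6))%R =
   \int[m]_s \int[m]_s' (spread s s')%:E)%E.
Proof.
apply: expect_law2E; first exact: measurable_spread.
move=> s s' s0 s'0; have q := exprn_ge0 6 (ltW s0).
by rewrite mulr_ge0 ?sqr_ge0 // addr_ge0 // div1r invr_ge0.
Qed.

Lemma phi4E :
  (expect_law2 m (fun s s' => Num.max 0 (s - s') ^+ 2 * Num.min 1 (1 / s ^+ 4))%R =
   \int[m]_s \int[m]_s' (phi4 s s')%:E)%E.
Proof.
apply: expect_law2E; first exact: measurable_phi4.
move=> s s' s0 s'0; rewrite mulr_ge0 ?sqr_ge0 // le_min ler01 div1r invr_ge0.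
by rewrite exprn_ge0 // ltW.
Qed.

Lemma second_momentE :
  (expect_law m (fun s => s ^+ 2)%R = \int[m]_s (s ^+ 2)%:E)%E.
Proof.
rewrite -integral_pos //; last by move=> s; rewrite lee_fin sqr_ge0.
by apply/measurable_EFinP; apply: measurable_funX; exact: measurable_id.
Qed.

Lemma moment8_ge2 s : 2 <= moment8 s.
Proof.
have s0 := pos_or_one_gt0 s; rewrite /moment8.
exact: (vv_ge2 (exprn_gt0 8 s0)).
Qed.

Lemma moment8_ge0 s : 0 <= moment8 s.
Proof. by apply: le_trans (moment8_ge2 s). Qed.

Lemma measurable_moment8 : measurable_fun setT moment8.
Proof. by apply: measurable_funD; [exact: measurable_p_pow|exact: measurable_p_powN]. Qed.

Lemma sum_inv_ge2 (x : R) : 0 < x -> 2 <= x^-1 + x.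
Proof. by move=> x0; rewrite addrC; exact: vv_ge2. Qed.

(** Consequently each quotient in the constant is at least [1] or has a null numerator. *)
Lemma phi4_le_spread s s' : phi4 s s' <= spread s s'.
Proof.
have s0 := pos_or_one_gt0 s; rewrite /phi4 /spread; apply: ler_pM.
- exact: sqr_ge0.
- by rewrite le_min ler01 div1r invr_ge0 exprn_ge0 // ltW.
- have [h|h] := leP 0 (p s - p s'); first by [].
  by rewrite expr0n sqr_ge0.
- apply: (@le_trans _ _ 1); first by rewrite ge_min lexx.
  rewrite div1r; apply: le_trans (sum_inv_ge2 (exprn_gt0 6 s0)).
  by rewrite ler1n.
Qed.

(** It makes the denominator of the constant finite from the second moment. *)
Lemma phi4_le_sqr s s' : phi4 s s' <= p s ^+ 2.
Proof.
have s0 := pos_or_one_gt0 s; have s'0 := pos_or_one_gt0 s'.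
rewrite /phi4 -[leRHS]mulr1; apply: ler_pM.
- exact: sqr_ge0.
- by rewrite le_min ler01 div1r invr_ge0 exprn_ge0 // ltW.
- apply: lerXn2r; rewrite ?nnegrE ?le_max ?lexx // ?(ltW s0) //.
  by rewrite ge_max (ltW s0) /= lerBlDr lerDl ltW.
- by rewrite ge_min lexx.
Qed.

(** The cube of a sum costs [4] and the square that follows [2]: [32 = 4 ^+ 2 * 2]. *)
Lemma vv6_le (s : R) : 0 < s -> vv s ^+ 6 <= 32 * (1 / s ^+ 6 + s ^+ 6).
Proof.
move=> s0; rewrite div1r -exprVn /vv.
have := invr_ge0 s; rewrite (ltW s0); move: (s^-1) (ltW s0) => t s1 t0.
have sq (a b : R) : 0 <= a -> 0 <= b -> (a + b) ^+ 2 <= 2 * (a ^+ 2 + b ^+ 2).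
  by move=> _ _; have := sqr_ge0 (a - b); rewrite !expr2; lra.
have cu (a b : R) : 0 <= a -> 0 <= b -> (a + b) ^+ 3 <= 4 * (a ^+ 3 + b ^+ 3).
  move=> a0 b0; have : 0 <= (a + b) * (a - b) ^+ 2.
    by rewrite mulr_ge0 ?sqr_ge0 // addr_ge0.
  by rewrite !exprS !expr0; nra.
have e6 (a : R) : a ^+ 6 = (a ^+ 3) ^+ 2 by rewrite -exprM.
rewrite !e6; have := cu s t s1 t0; set A := s ^+ 3; set B := t ^+ 3 => H.
have A0 : 0 <= A by exact: exprn_ge0.
have B0 : 0 <= B by exact: exprn_ge0.
apply: (@le_trans _ _ ((4 * (A + B)) ^+ 2)).
  by rewrite lerXn2r // nnegrE ?exprn_ge0 ?addr_ge0 ?mulr_ge0 ?addr_ge0.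
have := sqr_ge0 (A - B); rewrite !expr2; lra.
Qed.

(** Three squarings, each costing a factor [2]: the constants are [2], [2 * 2 ^+ 2 = 8] and
    [2 * 8 ^+ 2 = 128]. *)
Lemma vv8_le s : vv8 s <= 128 * moment8 s.
Proof.
have s0 := pos_or_one_gt0 s; rewrite /vv8 /moment8 /vv -exprVn.
move: (p s) s0 => {}s s0.
have sq (a b : R) : (a + b) ^+ 2 <= 2 * (a ^+ 2 + b ^+ 2).
  by have := sqr_ge0 (a - b); rewrite !expr2; lra.
have e8 (a : R) : a ^+ 8 = ((a ^+ 2) ^+ 2) ^+ 2 by rewrite -!exprM.
rewrite !e8; set a := s ^+ 2; set b := s^-1 ^+ 2.
have a0 : 0 <= a by exact: sqr_ge0.
have b0 : 0 <= b by exact: sqr_ge0.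
have h1 : (s + s^-1) ^+ 2 <= 2 * (a + b) by exact: sq.
have h2 : ((s + s^-1) ^+ 2) ^+ 2 <= 8 * (a ^+ 2 + b ^+ 2).
  apply: (@le_trans _ _ ((2 * (a + b)) ^+ 2)).
    by rewrite lerXn2r // nnegrE ?sqr_ge0 ?mulr_ge0 ?addr_ge0.
  by have := sq a b; rewrite !expr2; lra.
apply: (@le_trans _ _ ((8 * (a ^+ 2 + b ^+ 2)) ^+ 2)).
  by rewrite lerXn2r // nnegrE ?sqr_ge0 ?mulr_ge0 ?addr_ge0 ?sqr_ge0.
have := sq (a ^+ 2) (b ^+ 2); set A := a ^+ 2; set B := b ^+ 2; rewrite !expr2; lra.
Qed.

(** For positive resistances the square of the difference is at most the sum of the squares, after
    which no exponent exceeds [8]. The bound on eighth moments thereby controls the weights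
    [wmean]. *)
Lemma spread_le s s' : spread s s' <= 2 * (moment8 s * moment8 s').
Proof.
have s0 := pos_or_one_gt0 s; have s'0 := pos_or_one_gt0 s'.
have W2 := moment8_ge2 s; have W2' := moment8_ge2 s'.
have sqle x : 0 < x -> x ^+ 2 <= x ^+ 8 + x ^- 8 :> R.
  move=> x0; have y0 : 0 <= x ^- 8 by rewrite invr_ge0 exprn_ge0 // ltW.
  have [x1|x1] := leP 1 x.
    have : x ^+ 2 <= x ^+ 8 by rewrite ler_weXn2l.
    lra.
  have : x ^+ 2 <= 1 by rewrite exprn_ile1 // ltW.
  have : 1 <= x ^- 8.
    by rewrite invf_ge1 ?exprn_gt0 // exprn_ile1 // ltW.
  have : 0 <= x ^+ 8 by rewrite exprn_ge0 // ltW.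
  lra.
have q8 x : 0 < x -> x ^+ 2 * (1 / x ^+ 6 + x ^+ 6) <= 2 * (x ^+ 8 + x ^- 8) :> R.
  move=> x0; have x1 : x != 0 by rewrite gt_eqF.
  have -> : x ^+ 2 * (1 / x ^+ 6 + x ^+ 6) = (x^-1 ^+ 4) + x ^+ 8.
    by rewrite -exprVn; field.
  have := vv_ge2 (exprn_gt0 8 x0); rewrite /vv.
  have -> : x ^- 8 = (x^-1 ^+ 4) ^+ 2 by rewrite -exprVn -exprM.
  have : 0 <= x ^+ 8 by rewrite exprn_ge0 // ltW.
  move: (x ^+ 8) (x^-1 ^+ 4) => X y; have := sqr_ge0 (y - 1); have := sqr_ge0 y.
  by rewrite !expr2; lra.
have q6 x : 0 < x -> 1 / x ^+ 6 + x ^+ 6 <= x ^+ 8 + x ^- 8 :> R.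
  move=> x0; have x1 : x != 0 by rewrite gt_eqF.
  rewrite -subr_ge0.
  have -> : x ^+ 8 + x ^- 8 - (1 / x ^+ 6 + x ^+ 6) = (x ^+ 14 - 1) * (x ^+ 2 - 1) / x ^+ 8.
    by field.
  rewrite divr_ge0 ?exprn_ge0 ?(ltW x0) //.
  have [x1'|x1'] := leP 1 x.
    by rewrite mulr_ge0 // subr_ge0 exprn_ege1.
  by rewrite mulr_le0 // subr_le0 exprn_ile1 // ltW.
rewrite /spread; have := q8 _ s0; have := q6 _ s0; have := sqle _ s'0.
move: W2 W2'; rewrite /moment8.
set W := p s ^+ 8 + _; set W' := p s' ^+ 8 + _; set T := 1 / _ + _ => W2 W2' h1 h2 h3.
have T0 : 0 <= T by rewrite addr_ge0 ?exprn_ge0 // ?div1r ?invr_ge0 ?exprn_ge0 // ltW.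
have : (p s - p s') ^+ 2 <= p s ^+ 2 + p s' ^+ 2.
  have : 0 <= p s * p s' by rewrite mulr_ge0 // ltW.
  by rewrite !expr2; lra.
move=> /(ler_wpM2r T0) H; apply: (le_trans H); rewrite mulrDl.
have : p s' ^+ 2 * T <= W' * W by apply: ler_pM => //; exact: sqr_ge0.
have : 2 * W <= W' * W by rewrite ler_wpM2r //; lra.
move: h3; lra.
Qed.

End PositiveLaw.

Section UniversalConstant.
Context (R : realType).

(* [128], [256], [64] and [8192] come from [vv8_le], [interaction_mean_le],
   [wmean_le] and [second_difference_le]; the moments enter through [M ^+ 5]. *)
Definition universal : R := 1 + 8192 * (256 * 128 ^+ 2) * (2 * (128 * 64) * 128).

(** [a], [b], [c], [d] stand for the numerals, [x] for the moment bound and [y] for the ratio. The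
    degree in [x] is [2 + 2 + 1], and [1 <= x], [1 <= y] allow both the sixth power and the
    factorization of the initial [1]. *)
Lemma constant_le (a b c d x y : R) : 0 <= a -> 0 <= b -> 0 <= c -> 0 <= d ->
  1 <= x -> 1 <= y ->
  1 + a * (b * (c * x) ^+ 2) * (2 * ((c * x ^+ 2) * (d * y)) * (c * x)) <=
  (1 + a * (b * c ^+ 2) * (2 * (c * d) * c)) * (x ^+ 6 * y).
Proof.
move=> a0 b0 c0 d0 x1 y1.
have x0 : 0 <= x by apply: le_trans x1; exact: ler01.
have y0 : 0 <= y by apply: le_trans y1; exact: ler01.
have h1 : 1 <= x ^+ 6 * y by rewrite -[1]mulr1 ler_pM // exprn_ege1.
have h2 : x ^+ 5 * y <= x ^+ 6 * y by rewrite ler_wpM2r // ler_weXn2l.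
set k := a * (b * c ^+ 2) * (2 * (c * d) * c).
have k0 : 0 <= k.
  apply: mulr_ge0; first exact: mulr_ge0 a0 (mulr_ge0 b0 (sqr_ge0 c)).
  exact: mulr_ge0 (mulr_ge0 (ler0n _ _) (mulr_ge0 c0 d0)) c0.
have -> : a * (b * (c * x) ^+ 2) * (2 * ((c * x ^+ 2) * (d * y)) * (c * x)) =
    k * (x ^+ 5 * y) by rewrite /k; ring.
by rewrite mulrDl mul1r lerD // ler_wpM2l.
Qed.

Lemma universal_gt0 : 0 < universal.
Proof.
rewrite /universal; apply: ltr_wpDr; last exact: ltr01.
apply: mulr_ge0; first exact: mulr_ge0 (ler0n _ _) (mulr_ge0 (ler0n _ _) (sqr_ge0 _)).
exact: mulr_ge0 (mulr_ge0 (ler0n _ _) (mulr_ge0 (ler0n _ _) (ler0n _ _))) (ler0n _ _).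
Qed.

End UniversalConstant.

Section Moments.
Context (R : realType) (I : countType).
Context (mu : I -> probability (measurableTypeR R) R).
Hypothesis mom : forall i, (\int[mu i]_s ((s ^+ 2)%:E) < +oo)%E.
Implicit Types i : I.

Definition m8 i : \bar R := (\int[mu i]_s (moment8 s)%:E)%E.
Definition num i : \bar R := (\int[mu i]_s \int[mu i]_s' (spread s s')%:E)%E.
Definition den i : \bar R := (\int[mu i]_s \int[mu i]_s' (phi4 s s')%:E)%E.

Lemma measurable_iterated i (g : R -> R -> R) :
  measurable_fun setT (fun z : measurableTypeR R * measurableTypeR R => g z.1 z.2) ->
  (forall s s', 0 <= g s s') ->
  measurable_fun setT (fun s => \int[mu i]_s' (g s s')%:E)%E.
Proof.
move=> mg g0.
pose F (z : measurableTypeR R * measurableTypeR R) : \bar R := (g z.1 z.2)%:E.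
apply: (measurable_fun_fubini_tonelli_F F); first exact/measurable_EFinP.
by move=> z; rewrite lee_fin.
Qed.

Lemma measurable_sectionr (g : R -> R -> R) s :
  measurable_fun setT (fun z : measurableTypeR R * measurableTypeR R => g z.1 z.2) ->
  measurable_fun setT (fun s' => (g s s')%:E).
Proof.
move=> mg; apply/measurable_EFinP.
exact: (measurableT_comp mg (measurable_pair1 (T2 := measurableTypeR R) (s : measurableTypeR R))).
Qed.

Lemma le_iterated i (g h : R -> R -> R) :
  measurable_fun setT (fun z : measurableTypeR R * measurableTypeR R => g z.1 z.2) ->
  measurable_fun setT (fun z : measurableTypeR R * measurableTypeR R => h z.1 z.2) ->
  (forall s s', 0 <= g s s') -> (forall s s', g s s' <= h s s') ->
  (\int[mu i]_s \int[mu i]_s' (g s s')%:E <= \int[mu i]_s \int[mu i]_s' (h s s')%:E)%E.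
Proof.
move=> mg mh g0 gh; apply: ge0_le_integral; first exact: measurableT.
- by move=> s _; apply: integral_ge0 => s' _; rewrite lee_fin.
- exact: measurable_iterated.
- by apply: measurable_iterated => // s s'; apply: le_trans (gh s s').
move=> s _; apply: ge0_le_integral; first exact: measurableT.
- by move=> s' _; rewrite lee_fin.
- exact: measurable_sectionr.
- exact: measurable_sectionr.
- by move=> s' _; rewrite lee_fin.
Qed.

Lemma num_ge0 i : (0 <= num i)%E.
Proof.
apply: integral_ge0 => s _; apply: integral_ge0 => s' _.
by rewrite lee_fin spread_ge0.
Qed.

Lemma den_ge0 i : (0 <= den i)%E.
Proof.
apply: integral_ge0 => s _; apply: integral_ge0 => s' _.
by rewrite lee_fin phi4_ge0.
Qed.

Lemma den_le_num i : (den i <= num i)%E.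
Proof.
apply: le_iterated.
- exact: measurable_phi4.
- exact: measurable_spread.
- exact: phi4_ge0.
- exact: phi4_le_spread.
Qed.

Lemma integral_cst1 i (a : \bar R) : (\int[mu i]_s a = a)%E.
Proof.
have := @integral_cst _ _ _ (mu i) setT measurableT a; rewrite /cst => ->.
by rewrite [X in (_ * X)%E]probability_setT mule1.
Qed.

Lemma den_fin i : (den i < +oo)%E.
Proof.
have m2 : measurable_fun setT (fun z : measurableTypeR R * measurableTypeR R => 1 + z.1 ^+ 2).
  by apply: measurable_funD => //; apply: measurable_funX; exact: measurable_fst.
apply: (@le_lt_trans _ _ (\int[mu i]_s \int[mu i]_s' (1 + s ^+ 2)%:E)%E).
  apply: (@le_iterated i (@phi4 R) (fun s _ => 1 + s ^+ 2)).
  - exact: measurable_phi4.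
  - exact: m2.
  - exact: phi4_ge0.
  - by move=> s s'; apply: le_trans (phi4_le_sqr s s') (pos_or_one_sqr_le s).
under eq_integral do rewrite integral_cst1 EFinD.
rewrite ge0_integralD //.
- rewrite integral_cst1; apply: lte_add_pinfty (mom i); exact: ltry.
- by move=> s _; rewrite lee_fin sqr_ge0.
- by apply/measurable_EFinP; apply: measurable_funX; exact: measurable_id.
Qed.

Lemma m8_ge2 i : (2%:E <= m8 i)%E.
Proof.
rewrite -(integral_cst1 i 2%:E); apply: ge0_le_integral; first exact: measurableT.
- by [].
- exact: measurable_cst.
- by apply/measurable_EFinP; exact: measurable_moment8.
- by move=> s _; rewrite lee_fin moment8_ge2.
Qed.

Lemma vv8_mean_le i : (\int[mu i]_s (vv8 s)%:E <= 128%:E * m8 i)%E.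
Proof.
rewrite -ge0_integralZl //.
- apply: ge0_le_integral; first exact: measurableT.
  + by move=> s _; rewrite lee_fin ltW // vv8_gt0.
  + by apply/measurable_EFinP; exact: measurable_vv8.
  + by apply: measurable_funeM; apply/measurable_EFinP; exact: measurable_moment8.
  + by move=> s _; rewrite -EFinM lee_fin vv8_le.
- by apply/measurable_EFinP; exact: measurable_moment8.
- by move=> s _; rewrite lee_fin moment8_ge0.
Qed.

Lemma num_le i : (num i <= 2%:E * (m8 i * m8 i))%E.
Proof.
have mM : measurable_fun setT (fun s : measurableTypeR R => (moment8 s)%:E).
  by apply/measurable_EFinP; exact: measurable_moment8.
have M0 s : (0 <= (@moment8 R s)%:E)%E by rewrite lee_fin moment8_ge0.
have E : (2%:E * (m8 i * m8 i) =
    \int[mu i]_s \int[mu i]_s' (2 * (moment8 s * moment8 s'))%:E)%E.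
  transitivity (\int[mu i]_s (2%:E * ((moment8 s)%:E * m8 i)))%E.
    rewrite ge0_integralZl //; first last.
    - by move=> s _; rewrite mule_ge0 // integral_ge0.
    - by apply: emeasurable_funM => //; exact: measurable_cst.
    by rewrite ge0_integralZr // integral_ge0.
  apply: eq_integral => s _; rewrite -ge0_integralZl // -ge0_integralZl //.
  - by apply: measurable_funeM.
  - by move=> s' _; rewrite mule_ge0.
rewrite E; apply: le_iterated.
- exact: measurable_spread.
- apply: measurable_funM => //; apply: measurable_funM.
    exact: (measurableT_comp (@measurable_moment8 R) measurable_fst).
  exact: (measurableT_comp (@measurable_moment8 R) measurable_snd).
- exact: spread_ge0.
- exact: spread_le.
Qed.

Lemma symmetrized_integral i (a : R) (g : R -> R -> R) : 0 <= a ->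
  measurable_fun setT (fun z : measurableTypeR R * measurableTypeR R => g z.1 z.2) ->
  measurable_fun setT (fun z : measurableTypeR R * measurableTypeR R => g z.2 z.1) ->
  (forall s s', 0 <= g s s') ->
  (\int[mu i]_s \int[mu i]_s' (a * (g s s' + g s' s))%:E =
   (2 * a)%:E * \int[mu i]_s \int[mu i]_s' (g s s')%:E)%E.
Proof.
move=> a0 mg mg' g0; set n := (X in _ = (_ * X)%E).
have mEg : measurable_fun setT (fun z : measurableTypeR R * measurableTypeR R => (g z.2 z.1)%:E).
  exact/measurable_EFinP.
have nE : (n = \int[mu i]_s \int[mu i]_s' (g s' s)%:E)%E.
  by apply/esym; apply: (fubini_tonelli _ mEg) => z; rewrite lee_fin.
have inner s : (\int[mu i]_s' (a * (g s s' + g s' s))%:E =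
    a%:E * (\int[mu i]_s' (g s s')%:E + \int[mu i]_s' (g s' s)%:E))%E.
  have D := @ge0_integralD _ _ _ (mu i) setT measurableT
    (fun s' => (g s s')%:E) (fun s' => (g s' s)%:E).
  rewrite -D; first last.
  - exact: (measurable_sectionr (g := fun s s' => g s' s)).
  - by move=> s' _; rewrite lee_fin.
  - exact: measurable_sectionr.
  - by move=> s' _; rewrite lee_fin.
  rewrite -ge0_integralZl //.
  - by apply: emeasurable_funD; [exact: measurable_sectionr|
      exact: (measurable_sectionr (g := fun s s' => g s' s))].
  - by move=> s' _; rewrite adde_ge0 // lee_fin.
have i0 s : (0 <= \int[mu i]_s' (g s s')%:E)%E.
  by apply: integral_ge0 => s' _; rewrite lee_fin.
have i0' s : (0 <= \int[mu i]_s' (g s' s)%:E)%E.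
  by apply: integral_ge0 => s' _; rewrite lee_fin.
have mi : measurable_fun setT (fun s => \int[mu i]_s' (g s s')%:E)%E.
  exact: measurable_iterated.
have mi' : measurable_fun setT (fun s => \int[mu i]_s' (g s' s)%:E)%E.
  exact: (@measurable_iterated i (fun s s' => g s' s)).
under eq_integral do rewrite inner.
rewrite ge0_integralZl //; last 2 first.
- exact: emeasurable_funD.
- by move=> s _; exact: adde_ge0.
rewrite ge0_integralD // -nE -/n mulrC EFinM -muleA; congr (_ * _)%E.
by rewrite -mule2n mule_natl.
Qed.

(** [wt] contains sixth powers of both copies and [spread] those of the first one; symmetrization
    adds a factor [2] to the [32] of [vv6_le]. *)
Lemma wmean_le i : (wmean mu i <= 64%:E * num i)%E.
Proof.
pose S (z : measurableTypeR R * measurableTypeR R) := spread z.1 z.2.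
have mS : measurable_fun setT S by exact: measurable_spread.
have mS' : measurable_fun setT (fun z : measurableTypeR R * measurableTypeR R => spread z.2 z.1).
  exact: (measurableT_comp mS (measurable_fun_pair measurable_snd measurable_fst)).
have -> : 64 = 2 * 32 :> R by ring.
rewrite -(symmetrized_integral i (ler0n R 32) mS mS' (@spread_ge0 R)).
apply: le_iterated.
- by apply: measurable_wt; [exact: measurable_fst|exact: measurable_snd].
- by apply: measurable_funM; [exact: measurable_cst|exact: measurable_funD].
- exact: wt_ge0.
move=> s s'; rewrite /wt /spread.
have := vv6_le (pos_or_one_gt0 s); have := vv6_le (pos_or_one_gt0 s').
have e : (pos_or_one s' - pos_or_one s) ^+ 2 = (pos_or_one s - pos_or_one s') ^+ 2.
  by rewrite -sqrrN opprB.
rewrite e; move: (sqr_ge0 (pos_or_one s - pos_or_one s')).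
move: ((pos_or_one s - pos_or_one s') ^+ 2) => q q0 h1 h2.
rewrite -mulrDr mulrCA; apply: (ler_wpM2l q0); move: h1 h2; lra.
Qed.

End Moments.

(** * The reverse inequality in the limit and its degenerate cases *)

Section ReverseInequalityLimit.
Context (R : realType) (I : countType).
Context (mu : I -> probability (measurableTypeR R) R).
Context (Q : probability (pspace R I) R).
Hypothesis QE : forall (A : {fset I}) (B : I -> set (measurableTypeR R)),
  (forall i, measurable (B i)) ->
  Q (cylinder A B) = (\prod_(i <- A) mu i (B i))%E.
Hypothesis mom : forall i, (\int[mu i]_s ((s ^+ 2)%:E) < +oo)%E.
Local Notation X := (pspace R I).
Implicit Types (i : I) (A : seq I) (x : X).
Local Notation dif := (dif mu).
Local Notation sqn := (sqn Q).
Context (F : (I -> R) -> R) (rho : nat -> response R I).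
Local Notation f := (fun x : X => F (posf x)).
Local Notation u n := (fun x : X => nrg (rho n) (posf x)).
Hypotheses (qf : quad2 f) (mrho : forall n, measurable_response (rho n)).
Hypothesis u0 : forall n x, 0 <= nrg (rho n) (posf x).
Hypothesis uf : forall n x, nrg (rho n) (posf x) <= F (posf x).
Hypothesis ucvg : forall x, nrg (rho n) (posf x) @[n --> \oo] --> F (posf x).
Hypothesis Ecover : forall i, exists n0, forall n, (n0 <= n)%N -> i \in edges (rho n).
Local Notation V a := (sqn (fun x => f x - a)).

Lemma sqn_dif_center i (a : R) : sqn (dif i f) <= V a.
Proof.
have -> : dif i f = dif i (fun x => f x - a).
  apply/funext => x; rewrite /dif (avgB mom) ?(avg_indep mu (g := fun=> a)) //.
  - by ring.
  - exact: quad2_quad.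
  - exact: quad_cst.
by apply: (sqn_dif_le QE mom); exact: quad2B qf (quad2_cst I a).
Qed.

(** The second factor of [spread] is positive, so a null [num] forces two independent copies of the
    coordinate, read through [pos_or_one], to agree almost surely; resampling then leaves [f]
    unchanged. *)
Lemma sqn_dif_deterministic i : num mu i = 0%E -> sqn (dif i f) = 0.
Proof.
move=> num0; have [mf _] := qf.
pose H (x : X) : \bar R := (\int[mu i]_s (((f x - f (update x i s)) ^+ 2)%:E))%E.
have H0 x : (0 <= H x)%E by apply: integral_ge0 => s _; rewrite lee_fin sqr_ge0.
have mH : measurable_fun setT H.
  pose G (z : X * measurableTypeR R) : \bar R := ((f z.1 - f (upd i z)) ^+ 2)%:E.
  apply: (measurable_fun_fubini_tonelli_F G) => [|z]; last by rewrite lee_fin sqr_ge0.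
  apply/measurable_EFinP; apply: measurable_funX; apply: measurable_funB.
    exact: (measurableT_comp mf measurable_fst).
  exact: (measurableT_comp mf (@measurable_update_pair R I i)).
have HQ : (\int[Q]_x H x = 0)%E.
  (* Resampling the coordinate [i] of [x] itself produces the second copy. *)
  rewrite -(ge0_resample QE i mH H0).
  apply: integral0_eq => x _.
  have mg : measurable_fun setT (fun s : measurableTypeR R => f (update x i s)).
    exact: (measurableT_comp mf (@measurable_update_l R I i x)).
  rewrite (_ : (\int[mu i]_s H (update x i s) =
      \int[mu i]_s \int[mu i]_s' ((f (update x i s) - f (update x i s')) ^+ 2)%:E)%E); last first.
    by apply: eq_integral => s _; apply: eq_integral => s' _; rewrite update_update.
  apply: (iterated_integral0 (a := @spread R) _ _ (@spread_ge0 R) _ _ num0).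
  - exact: measurable_spread.
  - apply: measurable_funX; apply: measurable_funB.
      exact: (measurableT_comp mg measurable_fst).
    exact: (measurableT_comp mg measurable_snd).
  - by move=> s s'; exact: sqr_ge0.
  move=> s s' /eqP; rewrite /spread mulf_eq0 sqrf_eq0 subr_eq0 => /orP[/eqP ss'|].
    by rewrite !posf_update ss' subrr expr0n.
  have := sum_inv_ge2 (exprn_gt0 6 (pos_or_one_gt0 s)).
  by rewrite div1r => h /eqP h0; move: h; rewrite h0 lern0.
apply/eqP; rewrite eq_le sqn_ge0 andbT -lee_fin (sqnE QE mom (quad2_dif QE mom i qf)).
have [md _] := quad2_dif QE mom i qf; rewrite -[leRHS]HQ.
apply: ge0_le_integral; first exact: measurableT.
- by move=> x _; rewrite lee_fin sqr_ge0.
- by apply/measurable_EFinP; apply: measurable_funX.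
- exact: mH.
- by move=> x _; exact: jensen_dif.
Qed.

(** [reverse_bound] is applied with [c = 128 * M], [B = 128 * M ^+ 2] and ratio [64 * r], and
    [constant_le] collects the result. *)
Lemma reverse_bounded (M r a : R) : 1 <= M -> 1 <= r ->
  (forall i, m8 mu i <= M%:E)%E -> (forall i, num mu i <= r%:E * den mu i)%E ->
  forall A, uniq A ->
  \sum_(i <- A) sqn (dif i f) <= universal R * (M ^+ 6 * r) * V a.
Proof.
move=> M1 r1 m8M numr A uA.
have M0 : 0 < M by apply: lt_le_trans M1; exact: ltr01.
have r0 : 0 < r by apply: lt_le_trans r1; exact: ltr01.
have c128 : 0 < 128 :> R by rewrite ltr0n.
have vM i : (\int[mu i]_s (vv8 s)%:E <= (128 * M)%:E)%E.
  by apply: (le_trans (vv8_mean_le mu i)); rewrite EFinM lee_wpmul2l ?lee_fin ?ler0n.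
pose d i := fine (den mu i); pose w i := fine (wmean mu i).
have dE i : den mu i = (d i)%:E.
  by rewrite fineK // ge0_fin_numE ?den_ge0 // den_fin.
have d0 i : 0 <= d i by apply: fine_ge0; exact: den_ge0.
have wle i : (wmean mu i <= (64 * r * d i)%:E)%E.
  apply: (le_trans (wmean_le mu i)); rewrite -mulrA EFinM lee_wpmul2l ?lee_fin ?ler0n //.
  by rewrite EFinM -dE; exact: numr.
have w_ge0 i : (0 <= wmean mu i)%E.
  by apply: integral_ge0 => s _; exact: beta_ge0.
have wE i : wmean mu i = (w i)%:E.
  by rewrite fineK // ge0_fin_numE // (le_lt_trans (wle i)) // ltry.
have w0 i : 0 <= w i by rewrite -lee_fin -wE.
have wB i : w i <= 128 * M ^+ 2.
  rewrite -lee_fin -wE; apply: (le_trans (wmean_le mu i)).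
  apply: (@le_trans _ _ (64%:E * (2%:E * (m8 mu i * m8 mu i))))%E.
    by rewrite lee_wpmul2l ?lee_fin ?ler0n // num_le.
  have m0 : (0 <= m8 mu i)%E by apply: le_trans (m8_ge2 mu i); rewrite lee_fin.
  have -> : (128 * M ^+ 2)%:E = (64%:E * (2%:E * (M%:E * M%:E)))%E.
    by rewrite -!EFinM; congr (_%:E); ring.
  rewrite lee_wpmul2l ?lee_fin ?ler0n // lee_wpmul2l ?lee_fin ?ler0n //.
  by apply: lee_pmul.
have B0 : 0 <= 128 * M ^+ 2 by rewrite mulr_ge0 ?sqr_ge0 ?ltW.
have wd i : w i <= 64 * r * d i by rewrite -lee_fin -wE.
have r64 : 0 <= 64 * r by rewrite mulr_ge0 ?ler0n ?ltW.
have qu n : quad2 (u n) := quad2_u qf (fun n => let: And3 _ _ h := mrho n in h) u0 uf n.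
pose K := 1 + 8192 * (256 * (128 * M) ^+ 2) * (2 * (128 * M ^+ 2 * (64 * r)) * (128 * M)).
have KU : K <= universal R * (M ^+ 6 * r).
  exact: constant_le (ler0n R 8192) (ler0n R 256) (ler0n R 128) (ler0n R 64) M1 r1.
have K0 : 0 <= K.
  rewrite /K; apply: addr_ge0; first exact: ler01.
  apply: mulr_ge0; first exact: mulr_ge0 (ler0n _ _) (mulr_ge0 (ler0n _ _) (sqr_ge0 _)).
  exact: mulr_ge0 (mulr_ge0 (ler0n _ _) (mulr_ge0 B0 r64)) (mulr_ge0 (ltW c128) (ltW M0)).
apply: (le_trans (reverse_limit QE mom qf (fun n => let: And3 _ _ h := mrho n in h)
  u0 uf ucvg (fun n => edges_uniq (rho n)) Ecover K0 _ uA)).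
  move=> n; apply: (reverse_bound QE mom (mrho n) (qu n) (mulr_gt0 c128 M0) vM B0 r64 w0 wB wd wE dE).
exact: ler_wpM2r (sqn_ge0 _ _) _ _ KU.
Qed.

Local Notation M6 := (ereal_sup (range (fun i => m8 mu i ^+ 6)))%E.
Local Notation rat := (ereal_sup (range (fun i => num mu i / den mu i)))%E.

(** If [V a] or the ratio vanishes, so does every difference on the left; otherwise an infinite
    supremum makes the right side [+oo]. The index [i0] keeps the suprema from ranging over the
    empty set. *)
Lemma reverse_inequality (i0 : I) (a : R) A : uniq A ->
  (\sum_(i <- A) (sqn (dif i f))%:E <= (universal R)%:E * M6 * rat * (V a)%:E)%E.
Proof.
move=> uA; rewrite sumEFin.
have U0 := universal_gt0 R.
have m81 i : (1 <= m8 mu i)%E.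
  by apply: le_trans (m8_ge2 mu i); rewrite lee_fin ler1n.
have M60 : (0 < M6)%E.
  apply: (@lt_le_trans _ _ (m8 mu i0 ^+ 6)%E).
    by apply: expe_gt0; apply: lt_le_trans (m81 i0).
  by apply: ereal_sup_ubound; exists i0.
have rati i : (num mu i / den mu i <= rat)%E by apply: ereal_sup_ubound; exists i.
have rat0 : (0 <= rat)%E.
  by apply: le_trans (rati i0); rewrite mule_ge0 ?inve_ge0 ?num_ge0 ?den_ge0.
have V0 : 0 <= V a by exact: sqn_ge0.
have [Vz|Vn] := eqVneq (V a) 0.
  rewrite Vz mule0 lee_fin; apply: sumr_le0 => i _.
  by rewrite -Vz; exact: sqn_dif_center.
have Vp : 0 < V a by rewrite lt_def Vn V0.
have [rz|rn] := eqVneq rat 0%E.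
  rewrite rz mule0 mul0e lee_fin big1 // => i _; apply: sqn_dif_deterministic.
  have := rati i; rewrite rz; have := den_fin mom i; have := den_ge0 mu i.
  have := num_ge0 mu i; case: (den mu i) => [z| |] //; rewrite inver.
  case: (num mu i) => [y| |] // y0 z0 _; case: eqP => zz.
  - have [->//|yn] := eqVneq y 0.
    by rewrite gt0_muley ?leNgt ?ltry // lte_fin lt_def yn.
  - rewrite -EFinM lee_fin => h; congr (_%:E); apply/eqP; rewrite eq_le.
    move: y0 h; rewrite !lee_fin => -> /=; rewrite andbT pmulr_lle0 // invr_gt0 lt_def.
    by rewrite -lee_fin z0 andbT; apply/eqP.
  - by rewrite mulyy.
  - by rewrite gt0_mulye ?leNgt ?ltry // lte_fin invr_gt0 lt_def -lee_fin z0 andbT; apply/eqP.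
have rp : (0 < rat)%E by rewrite lt_def rn rat0.
have CV : (0 < (universal R)%:E)%E by rewrite lte_fin.
have [M6y|M6n] := eqVneq M6 +oo%E.
  by rewrite M6y gt0_muley // gt0_mulye // gt0_mulye ?lte_fin // leey.
have [ry|ryn] := eqVneq rat +oo%E.
  by rewrite ry gt0_muley ?mule_gt0 // gt0_mulye ?lte_fin // leey.
have [m6 m6E] : exists m, M6 = m%:E.
  by case: M6 M60 M6n => [z| |] //; exists z.
have [r rE] : exists r, rat = r%:E.
  by case: rat rp ryn => [z| |] //; exists z.
have m60 : 0 < m6 by rewrite -lte_fin -m6E.
(* The supremum is one of sixth powers, whereas a bound on each moment is needed. *)
pose M := m6 `^ (6%:R^-1).
have M6E : M ^+ 6 = m6.
  by rewrite -powR_mulrn ?powR_ge0 // -powRrM mulVf ?powRr1 ?ltW // pnatr_eq0.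
have m8M i : (m8 mu i <= M%:E)%E.
  have : (m8 mu i ^+ 6 <= m6%:E)%E by rewrite -m6E; apply: ereal_sup_ubound; exists i.
  have := m81 i; case: (m8 mu i) => [z| |] //.
    rewrite -EFin_expe !lee_fin -M6E => z1.
    have z0 : 0 <= z by apply: le_trans z1; exact: ler01.
    by rewrite ler_pXn2r // nnegrE ?powR_ge0.
have M1 : 1 <= M by rewrite -lee_fin; apply: le_trans (m8M i0).
have numr i : (num mu i <= r%:E * den mu i)%E.
  have := rati i; rewrite rE; have := den_fin mom i; have := den_ge0 mu i.
  have := num_ge0 mu i; case: (den mu i) => [z| |] //; rewrite inver.
  case: eqP => [->|/eqP zz]; case: (num mu i) => [y| |] // y0 z0 _.
  - have [->|yn] := eqVneq y 0; first by rewrite mule0.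
    by rewrite gt0_muley ?leNgt ?ltry // lte_fin lt_def yn.
  - have zp : 0 < z by rewrite lt_def zz -lee_fin.
    by rewrite -!EFinM !lee_fin ler_pdivrMr.
  - by rewrite gt0_mulye ?leNgt ?ltry // lte_fin invr_gt0 lt_def zz -lee_fin.
(* If [r < 1], then [den <= num <= r * den] makes both vanish for every index, and the supremum
   would be [0]. *)
have r1 : 1 <= r.
  rewrite leNgt; apply/negP => r1; move: rp; rewrite ltNge => /negP; apply.
  apply: ge_ereal_sup => _ [i _ <-].
  have := numr i; have := den_le_num mu i; have := den_fin mom i; have := den_ge0 mu i.
  case: (den mu i) => [z| |] // z0 _ zn nz.
  have z00 : z = 0.
    have := le_trans zn nz; rewrite -EFinM lee_fin => h; apply/eqP; rewrite eq_le.
    rewrite -[0 <= z]lee_fin z0 andbT; have : (1 - r) * z <= 0 by lra.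
    by rewrite pmulr_rle0 // subr_gt0.
  have -> : num mu i = 0%E.
    by apply/eqP; rewrite eq_le num_ge0 andbT; move: nz; rewrite z00 mule0.
  by rewrite mul0e.
by rewrite m6E rE -!EFinM lee_fin -M6E -[universal R * _ * r]mulrA; exact: reverse_bounded.
Qed.

End ReverseInequalityLimit.

(** * The joint law of the resistances *)

Section JointLaw.
Context (R : realType) (I : countType).
Context (mu : I -> probability (measurableTypeR R) R).
Context d (Omega : measurableType d) (P : probability Omega R).
Context (r : I -> {RV P >-> measurableTypeR R}).

Definition joint (w : Omega) : pspace R I := fun i => r i w.

Lemma measurable_joint : measurable_fun setT joint.
Proof. by apply: measurable_into => i; exact: measurable_funPT. Qed.

HB.instance Definition _ :=
  isMeasurableFun.Build _ _ _ _ joint measurable_joint.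

Definition law : probability (pspace R I) R := distribution P joint.

Lemma law_cylinder : has_product_law mu r ->
  forall (A : {fset I}) (B : I -> set (measurableTypeR R)),
  (forall i, measurable (B i)) ->
  law (cylinder A B) = (\prod_(i <- A) mu i (B i))%E.
Proof.
move=> rmu A B mB; rewrite -rmu //; congr (P _).

Qed.

Lemma ge0_integral_law (g : pspace R I -> \bar R) : measurable_fun setT g ->
  (forall x, (0 <= g x)%E) ->
  (\int[law]_x g x = \int[P]_w g (joint w))%E.
Proof. by move=> mg g0; exact: (ge0_integral_distribution _ mg g0). Qed.

Hypothesis mu0 : forall i, carried_by_pos (mu i).
Hypothesis mom : forall i, (\int[mu i]_s ((s ^+ 2)%:E) < +oo)%E.
Hypothesis r0 : forall i w, 0 < r i w.
Hypothesis rmu : has_product_law mu r.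
Let QE := law_cylinder rmu.

Context (F : (I -> R) -> R).
Local Notation f := (fun x : pspace R I => F (posf x)).
Hypotheses (qf : quad2 f) (f0 : forall x, 0 <= F (posf x)).

Lemma posf_joint w : posf (joint w) = (fun i => r i w).
Proof. by apply: posf_id => i; exact: r0. Qed.

Lemma varianceE :
  (variance P (fun w => F (fun i => r i w)) =
   (sqn law (fun x => f x - \int[law]_x f x))%:E)%E.
Proof.
have [mf _] := qf.
have E : (\int[law]_x f x = fine (\int[P]_w (F (fun i => r i w))%:E))%R.
  congr fine; rewrite (ge0_integral_law (g := EFin \o f)).
  - by apply: eq_integral => w _; rewrite /= posf_joint.
  - exact/measurable_EFinP.
  - by move=> x; rewrite lee_fin.
set a := (\int[law]_x f x)%R.
have qa : quad2 (fun x => f x - a) := quad2B qf (quad2_cst I a).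
rewrite (sqnE QE mom qa) ge0_integral_law.
- rewrite /variance unlock [in LHS]unlock; apply: eq_integral => w _.
  by rewrite /= posf_joint expr2 /a E.
- by apply/measurable_EFinP; apply: measurable_funX; case: qa.
- by move=> x; rewrite lee_fin sqr_ge0.
Qed.

(** [Delta] integrates over the positive half-line and [avg] over the whole line through [posf]; the
    difference is invisible to a law carried by the half-line. *)
Lemma DeltaE i w : Delta mu i F (fun j => r j w) = dif mu i f (joint w).
Proof.
rewrite /Delta /dif posf_joint; congr (_ - _).
pose pos : set (measurableTypeR R) := [set` `]0%R, +oo[].
pose x := joint w.
rewrite /avg /Rintegral; congr fine.
transitivity (\int[mu i]_(s in pos) (f (update x i s))%:E)%E.
  apply: eq_integral => s /set_mem /pos_gt0 s0; congr (_%:E).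
  by rewrite posf_update pos_or_one_id // posf_joint.
rewrite [RHS](negligible_integral (N := ~` pos)) //.
- by rewrite setTD setCK.
- by apply: measurableC; exact: measurable_pos.
- exact: (quad_integrable_section mom i x (quad2_quad qf)).
- exact: null_nonpos.
Qed.

Lemma sqn_DeltaE i :
  ('N[P]_2%:E[EFin \o (fun w => Delta mu i F (fun j => r j w))] ^+ 2 =
   (sqn law (dif mu i f))%:E)%E.
Proof.
have sq (y : \bar R) : (0 <= y)%E -> (y ^+ 2 = y `^ 2%:R)%E.
  case: y => [z z0| _ |//]; first by rewrite poweR_EFin powR_mulrn // -EFin_expe.
  by rewrite poweRyr // expe2 mulyy.
have qd := quad2_dif QE mom i qf.
rewrite sq ?Lnorm_ge0 // powR_Lnorm // (sqnE QE mom qd) ge0_integral_law.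
- apply: eq_integral => w _; rewrite /= DeltaE powR_mulrn //.
  by rewrite real_normK ?num_real.
- by apply/measurable_EFinP; apply: measurable_funX; case: qd.
- by move=> x; rewrite lee_fin sqr_ge0.
Qed.

End JointLaw.

(** * The effective resistance as a limit of finite networks *)

Section NetworkApproximation.
Context (R : realType) (G : graph) (half : pred (edge G)).
Hypothesis orient : is_orientation half.
Local Notation I := (half_edge half).
Implicit Types (u v : G).

Lemma half_edge_exists u v : u != v -> exists i : I, True.
Proof.
move=> uv; have [[|z p] [/= up pv]] := adj_connected u v.
  by rewrite pv eqxx in uv.
case/andP: up => uz _.
pose e : edge G := exist (fun e : G * G => adj e.1 e.2) (u, z) uz.
have [he|he] := boolP (half e); first by exists (Sub e he).
have hr : half (rev_edge e) by rewrite orient.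
by exists (Sub (rev_edge e) hr).
Qed.

Context (u v : G) (phi : I -> R) (A : seq I).
Hypotheses (uA : uniq A) (phiA : forall i, i \notin A -> phi i = 0).
Hypothesis phid : forall y,
  divg (@incident G half) (@incidence R G half) phi y = (y == u)%:R - (y == v)%:R.
Local Notation rho n := (net (@incident G half) (@incidence R G half) phi n).
Local Notation f := (fun x : pspace R I => resistance u v (posf x)).

Lemma resistance_posf (x : pspace R I) :
  [/\ nrg (rho n) (posf x) @[n --> \oo] --> resistance u v (posf x),
    forall n, nrg (rho n) (posf x) <= resistance u v (posf x) &
    resistance u v (posf x) <= \sum_(i <- A) posf x i * phi i ^+ 2].
Proof. by apply: (resistance_limit orient uA phiA phid) => i; exact: posf_gt0. Qed.

Lemma nrg_posf_ge0 n (x : pspace R I) : 0 <= nrg (rho n) (posf x).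
Proof.
apply: (nrg_ge0 (@incident_uniq G half) (@incidence_out R G half)) => i.
exact: posf_gt0.
Qed.

Lemma measurable_net n : measurable_response (rho n).
Proof. exact: measurable_network_response. Qed.

Lemma resistance_posf_ge0 (x : pspace R I) : 0 <= resistance u v (posf x).
Proof. by have [_ h _] := resistance_posf x; apply: le_trans (nrg_posf_ge0 0 x) (h 0%N). Qed.

Lemma nrg_local n : depends_on (edges (rho n)) (fun x : pspace R I => nrg (rho n) (posf x)).
Proof.
move=> x y xy; rewrite /= /net_nrg; congr min_energy; apply/funext => k.
by rewrite /posf xy // mem_tnth.
Qed.

(** The resistance is at most the energy of the finitely supported flow [phi], which is linear in
    finitely many resistances, so its square grows at most quadratically. It is measurable as a
    limit of energies of finite networks. *)
Lemma quad2_resistance : quad2 f.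
Proof.
have mf : measurable_fun setT f.
  have mn n : measurable_fun setT (fun x : pspace R I => nrg (rho n) (posf x)).
    by have [] := measurable_net n.
  by apply: (measurable_fun_cvg mn) => x _; have [] := resistance_posf x.
have qp i : quad2 (fun x : pspace R I => posf x i).
  split; first exact: measurable_posf_coord.
  apply: (@quad_bound _ _ _ [:: i] 1) => [|x].
    by apply: measurable_funX; exact: measurable_posf_coord.
  rewrite /bd big_seq1 mul1r ger0_norm ?sqr_ge0 //; exact: pos_or_one_sqr_le.
have qS : quad2 (fun x : pspace R I => \sum_(i <- A) phi i ^+ 2 * posf x i).
  by apply: quad2_sum => i; apply: quad2Z.
split => //; apply: (quad_le _ (proj2 qS)); first exact: measurable_funX.
move=> x; rewrite ger0_norm ?sqr_ge0 //.
have [_ _ h] := resistance_posf x; have f0 := resistance_posf_ge0 x.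
under eq_bigr do rewrite mulrC.
by apply: lerXn2r => //; rewrite nnegrE // (le_trans f0 h).
Qed.

End NetworkApproximation.

Theorem corollary3p7 (R : realType) :
  exists C : R, 0 < C /\
  forall (G : graph) (half : pred (edge G)), is_orientation half ->
  forall mu : half_edge half -> probability (measurableTypeR R) R,
    (forall e, carried_by_pos (mu e)) ->
    (forall e, (expect_law (mu e) (fun s => s ^+ 2)%R < +oo)%E) ->
  forall (d : measure_display) (Omega : measurableType d)
    (P : probability Omega R)
    (r : half_edge half -> {RV P >-> measurableTypeR R}),
    (forall e w, 0 < r e w) ->
    has_product_law mu r ->
  forall u v : G, u != v ->
  let Ruv := fun w => resistance u v (fun e => r e w) in
  let DeltaR := fun e w => Delta mu e (resistance u v) (fun e' => r e' w) in
  let sumDelta :=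
    (\esum_(e in [set: half_edge half]) ('N[P]_2%:E[EFin \o DeltaR e] ^+ 2))%E in
  (variance P Ruv <= sumDelta)%E /\
  (sumDelta <= Kconst mu C * variance P Ruv)%E.
Proof.
exists (universal R); split; first exact: universal_gt0.
move=> G half orient mu mu0 mom2 d Omega P r r0 rmu u v uv Ruv DeltaR sumDelta.
have mom i : (\int[mu i]_s ((s ^+ 2)%:E) < +oo)%E by rewrite -second_momentE.
have QE := law_cylinder rmu.
have [phi [A0 [phiA0 phid]]] := unit_flow_exists R orient u v.
pose A := undup A0; have uA : uniq A := undup_uniq A0.
have phiA i : i \notin A -> phi i = 0 by rewrite mem_undup; exact: phiA0.
have qf := quad2_resistance orient uA phiA phid.
have f0 := resistance_posf_ge0 orient uA phiA phid.
have lim := resistance_posf orient uA phiA phid.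
pose rho n := net (@incident G half) (@incidence R G half) phi n.
have Ecover i : exists n0, forall n, (n0 <= n)%N -> i \in edges (rho n).
  exists (choice.pickle i).+1 => n; exact: pickle_net_edges.
have sE e : ('N[P]_2%:E[EFin \o DeltaR e] ^+ 2 =
    (sqn (law r) (dif mu e (fun x : pspace R _ => resistance u v (posf x))))%:E)%E.
  exact: (sqn_DeltaE mu0 mom r0 rmu).
have vE := varianceE mom r0 rmu qf f0.
have s0 (B : seq (half_edge half)) : uniq B ->
  ((\sum_(e <- B) sqn (law r) (dif mu e (fun x : pspace R _ => resistance u v (posf x))))%:E
    <= sumDelta)%E.
  move=> uB; apply: le_trans (sum_le_esum _ uB); rewrite -sumEFin.
  by rewrite le_eqVlt; apply/orP; left; apply/eqP; apply: eq_bigr => e _; rewrite sE.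
split.
  (* The empty sum excludes the value [-oo], and [+oo] leaves nothing to prove; a finite value
     bounds all the finite partial sums. *)
  rewrite /Ruv vE; have := s0 [::] isT; rewrite big_nil.
  case: sumDelta s0 => [S| |] // s0 _; last exact: leey.
  rewrite lee_fin; apply: (variance_le QE mom (u := fun n x => nrg (rho n) (posf x))
    (E := fun n => edges (rho n)) qf).
  - by move=> n; have [] := measurable_net phi n.
  - by move=> n x; exact: nrg_posf_ge0.
  - by move=> n x; have [_ h _] := lim x.
  - by move=> x; have [h _ _] := lim x.
  - exact: nrg_local.
  - by move=> n; exact: edges_uniq.
  - by move=> B uB; rewrite -lee_fin; exact: s0.
rewrite /Ruv vE; have [i0 _] := half_edge_exists orient uv.
have KE : Kconst mu (universal R) = ((universal R)%:E *
    ereal_sup (range (fun i => m8 mu i ^+ 6)) *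
    ereal_sup (range (fun i => num mu i / den mu i)))%E.
  rewrite /Kconst; congr (_ * ereal_sup _ * ereal_sup _)%E;
    apply: eq_imagel => i _.
  - by rewrite moment8E.
  - by rewrite spreadE // phi4E.
rewrite KE; apply: esum_le => B uB; under eq_bigr do rewrite sE.
apply: (reverse_inequality QE mom (rho := rho) qf (@measurable_net R G half phi) _ _ _ Ecover i0 _ uB).
- by move=> n x; exact: nrg_posf_ge0.
- by move=> n x; have [_ h _] := lim x.
- by move=> x; have [h _ _] := lim x.
Qed.
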